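(* Let $S$ be a generating set of $\operatorname{Sym}(\mathbb{N})$ with $S_{\mathbb{N}}^{\mathrm{Cox}}\subset S\subset T_{\mathbb{N}}$, and let $S'$ be a generating set of $\operatorname{Alt}(\mathbb{N})$ with $S_{\mathbb{N}}^{A}\subset S'\subset T_{\mathbb{N}}^{A}$. Let $\ell=5$ or $\ell=7$ and let $j\geq 1$ be an integer. Then for all integers $n\ge 0$ with $24n\equiv 1\pmod{\ell^j}$, $$\gamma_{\operatorname{Alt}(\mathbb{N}),S'}(2n)\equiv\gamma_{\operatorname{Sym}(\mathbb{N}),S}(n)\equiv 0\pmod{\ell^{\lfloor j/2-1\rfloor}}.$$
   Context: $\mathbb{N}$ is the set of positive integers. $\operatorname{Sym}(\mathbb{N})$ is the finitary symmetric group: the group of permutations $g$ of $\mathbb{N}$ whose support $\{x\in\mathbb{N}: g(x)\neq x\}$ is finite. $\operatorname{Alt}(\mathbb{N})$ is the finitary alternating group: the subgroup of permutations of even signature in $\operatorname{Sym}(\mathbb{N})$. Generating sets: $S_{\mathbb{N}}^{\mathrm{Cox}}:=\{(i,i+1): i\in\mathbb{N}\}$ (adjacent transpositions); $T_{\mathbb{N}}:=\{(x,y)\in\operatorname{Sym}(\mathbb{N}): x,y\in\mathbb{N}\text{ distinct}\}$ (all transpositions); $S_{\mathbb{N}}^{A}:=\{(i,i+1,i+2)\in\operatorname{Alt}(\mathbb{N}): i\in\mathbb{N}\}$ (3-cycles); $T_{\mathbb{N}}^{A}:=\bigcup_{g\in\operatorname{Alt}(\mathbb{N})} g\,S_{\mathbb{N}}^{A}\,g^{-1}$.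 For a group $G$ generated by a set $X$ and $g\in G$, the word length $\ell_{G,X}(g)$ is the minimal non-negative integer $n$ such that $g=s_1s_2\cdots s_n$ with $s_1,\ldots,s_n\in X\cup X^{-1}$. The conjugacy length $\kappa_{G,X}(g)$ is the minimal integer $n$ such that some $h$ in the conjugacy class of $g$ in $G$ has $\ell_{G,X}(h)=n$. For $n\geq 0$, $\gamma_{G,X}(n)$ is the number of conjugacy classes of $G$ consisting of elements $g$ with $\kappa_{G,X}(g)=n$. For the pairs $(\operatorname{Sym}(\mathbb{N}),S)$ and $(\operatorname{Alt}(\mathbb{N}),S')$ these numbers are finite for all $n$. For $j=1$ the exponent $\lfloor j/2-1\rfloor$ equals $-1$; a congruence $a\equiv b\pmod M$ with $M=\ell^{-1}$ means that $(a-b)/M$ is an integer, so it is vacuous. *)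

(* Defs.v *)
From HB Require Import structures.
From mathcomp Require Import all_boot all_order all_algebra all_fingroup.
From mathcomp Require Import finmap boolp classical_sets functions cardinality.

Set Implicit Arguments.
Unset Strict Implicit.
Unset Printing Implicit Defensive.

Import Order.TTheory GRing.Theory Num.Theory.

Local Open Scope classical_set_scope.
Local Open Scope group_scope.

Definition posint := {n : nat | (0 < n)%N}.

(* [pos k] is the positive integer k + 1, so that [pos] enumerates [posint]
   from k = 0 on. *)
Definition pos (k : nat) : posint := exist _ k.+1 (ltn0Sn k).

Definition posS (x : posint) : posint := pos (val x).

Lemma posP (x : posint) : exists k, x = pos k.
Proof. by case: x => [[|k] // hk]; exists k; apply/val_inj. Qed.

Definition finitary (f : posint -> posint) : bool :=
  `[< bijective f /\ finite_set [set x | f x != x] >].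

Record symN := SymN { symN_fun :> posint -> posint; _ : finitary symN_fun }.

HB.instance Definition _ := [isSub for symN_fun].
HB.instance Definition _ := [Choice of symN by <:].

Lemma symN_bij (g : symN) : bijective g.
Proof. by case: g => f /= /asboolP []. Qed.

Lemma symN_fin (g : symN) : finite_set [set x | g x != x].
Proof. by case: g => f /= /asboolP []. Qed.

Lemma symNP (g h : symN) : g =1 h -> g = h.
Proof. by move=> gh; apply/val_inj/funext. Qed.

Lemma finitary_id : finitary id.
Proof.
apply/asboolP; split; first by exists id.
by apply: (sub_finite_set _ (finite_set0 posint)) => x /=; rewrite eqxx.
Qed.

Lemma finitary_comp (g h : symN) : finitary (g \o h).
Proof.
apply/asboolP; split; first exact: bij_comp (symN_bij g) (symN_bij h).
apply: (@sub_finite_set _ _ ([set x | g x != x] `|` [set x | h x != x])).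
  move=> x /=; case: (eqVneq (h x) x) => [->|]; first by left.
  by right.
by rewrite finite_setU; split; exact: symN_fin.
Qed.

Lemma symN_surj (g : symN) (y : posint) : exists x, g x == y.
Proof. by have [f _ gK] := symN_bij g; exists (f y); rewrite gK. Qed.

Definition symN_invfun (g : symN) (y : posint) : posint := xchoose (symN_surj g y).

Lemma symN_invfunK (g : symN) : cancel (symN_invfun g) g.
Proof. by move=> y; apply/eqP/(xchooseP (symN_surj g y)). Qed.

Lemma symN_funK (g : symN) : cancel g (symN_invfun g).
Proof. by move=> x; apply: (bij_inj (symN_bij g)); rewrite symN_invfunK. Qed.

Lemma finitary_inv (g : symN) : finitary (symN_invfun g).
Proof.
apply/asboolP; split; first exact: Bijective (symN_invfunK g) (symN_funK g).
apply: sub_finite_set (symN_fin g) => x /=; apply: contraNN => /eqP gx.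
by rewrite -{1}gx symN_funK.
Qed.

Definition symN_one : symN := SymN finitary_id.
Definition symN_mul (g h : symN) : symN := SymN (finitary_comp g h).
Definition symN_inv (g : symN) : symN := SymN (finitary_inv g).

Lemma symN_mulA : associative symN_mul.
Proof. by move=> f g h; apply: symNP. Qed.
Lemma symN_mul1 : left_id symN_one symN_mul.
Proof. by move=> g; apply: symNP. Qed.
Lemma symN_mulr1 : right_id symN_one symN_mul.
Proof. by move=> g; apply: symNP. Qed.
Lemma symN_mulV : left_inverse symN_one symN_inv symN_mul.
Proof. by move=> g; apply: symNP => x /=; rewrite symN_funK. Qed.
Lemma symN_mulrV : right_inverse symN_one symN_inv symN_mul.
Proof. by move=> g; apply: symNP => x /=; rewrite symN_invfunK. Qed.

HB.instance Definition _ := isGroup.Build symN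
  symN_mulA symN_mul1 symN_mulr1 symN_mulV symN_mulrV.

Lemma symNM (g h : symN) x : (g * h) x = g (h x).
Proof. by []. Qed.
Lemma symN1 x : (1 : symN) x = x.
Proof. by []. Qed.

(* [g] permutes the first [n] positive integers as [s] permutes ['I_n], and
   fixes all the others. *)
Definition restricts_to (g : symN) (n : nat) (s : 'S_n) : Prop :=
  (forall i : 'I_n, g (pos i) = pos (s i)) /\
  (forall k, (n <= k)%N -> g (pos k) = pos k).

Definition even_symN : {pred symN} := fun g =>
  `[< exists n, exists s : 'S_n, restricts_to g s /\ ~~ odd_perm s >].

Lemma restricts_to_lift (g : symN) n (s : 'S_n) :
  restricts_to g s -> restricts_to g (lift_perm ord_max ord_max s).
Proof.
move=> [gs gfix]; split=> [i|k /ltnW]; last exact: gfix.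
case: (unliftP ord_max i) => [j ->|->].
  by rewrite lift_perm_lift !lift_max gs.
by rewrite lift_perm_id /= gfix.
Qed.

Lemma restricts_to_widen (g : symN) n m (s : 'S_n) : (n <= m)%N ->
  restricts_to g s ->
  exists2 t : 'S_m, restricts_to g t & odd_perm t = odd_perm s.
Proof.
move=> /subnK <-; elim: (m - n)%N => [|d IH] gs; first by exists s.
have [t gt ts] := IH gs; exists (lift_perm ord_max ord_max t).
  exact: restricts_to_lift.
by rewrite odd_lift_perm addbb ts.
Qed.

Lemma even_symN_group_closed : group_closed even_symN.
Proof.
split.
  apply/asboolP; exists 0%N, 1; split; last by rewrite odd_perm1.
  by split => // -[].
move=> g h /asboolP[n [s [gs es]]] /asboolP[m [t [ht et]]].
have [s' [gs1 gs2] es'] := restricts_to_widen (leq_maxl n m) gs.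
have [t' [ht1 ht2] et'] := restricts_to_widen (leq_maxr n m) ht.
apply/asboolP; exists (maxn n m), (t'^-1 * s'); split; last first.
  by rewrite odd_permM odd_permV es' et' (negbTE es) (negbTE et).
have hV x y : h x = y -> h^-1 y = x by move=> <-; apply: symN_funK.
split=> [i|k hk]; rewrite symNM.
  by rewrite permM -gs1; congr (g _); apply: hV; rewrite ht1 permKV.
by rewrite (hV (pos k) _ (ht2 _ hk)) gs2.
Qed.

Record altN := AltN { altN_val :> symN; _ : even_symN altN_val }.

HB.instance Definition _ := [isSub for altN_val].
HB.instance Definition _ := [Choice of altN by <:].
HB.instance Definition _ :=
  SubChoice_isSubGroup.Build symN even_symN altN even_symN_group_closed.

Definition is_transposition (x y : posint) (g : symN) : Prop :=
  x != y /\ g =1 [eta id with x |-> y, y |-> x].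

Definition is_three_cycle (x y z : posint) (g : symN) : Prop :=
  uniq [:: x; y; z] /\ g =1 [eta id with x |-> y, y |-> z, z |-> x].

Definition S_Cox : set symN := [set g | exists i, is_transposition i (posS i) g].

Definition T_N : set symN := [set g | exists x y, is_transposition x y g].

Definition S_A : set altN :=
  [set g | exists i, is_three_cycle i (posS i) (posS (posS i)) g].

Definition T_A : set altN :=
  [set t | exists g s : altN, S_A s /\ t = g * s * g^-1].

Definition is_min (P : nat -> Prop) (n : nat) : Prop :=
  P n /\ forall m, P m -> (n <= m)%N.

Section Lengths.
Variable G : groupType.
Implicit Types (X C : set G) (g h : G) (n : nat).

Definition is_word X n g : Prop := exists w : seq G,
  [/\ size w = n, (forall s, s \in w -> (X `|` [set x^-1%g | x in X]) s)
    & g = \prod_(s <- w) s].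

Definition generates X : Prop := forall g, exists n, is_word X n g.

Definition word_length X g n : Prop := is_min (fun m => is_word X m g) n.

Definition conj_class g : set G := [set h | exists x : G, h = x * g * x^-1].

Definition conj_length X g n : Prop :=
  is_min (fun m => exists2 h, conj_class g h & word_length X h m) n.

Definition classes_of_length X n : set (set G) :=
  [set C | (exists g, C = conj_class g) /\ forall g, C g -> conj_length X g n].

(* [fset_set] agrees with its argument on finite sets, and is empty on
   infinite ones. *)
Definition gamma X n : nat := #|` fset_set (classes_of_length X n)|%fset.

End Lengths.

Local Open Scope ring_scope.

(* The modulus is rational so as to allow l ^ (-1). *)
Definition congr_mod (M a b : rat) : Prop := (a - b) / M \is a Num.int.

(* Main.v *)
Require Import Defs.
From HB Require Import structures.
From mathcomp Require Import all_boot all_order all_algebra all_fingroup all_field.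
From mathcomp Require Import finmap boolp classical_sets functions cardinality.
From mathcomp Require Import ring lra zify.

Set Implicit Arguments.
Unset Strict Implicit.
Unset Printing Implicit Defensive.

(** A conjugacy class of [symN] is given by its multiset of cycle lengths at
    least 2, and if it consists of even permutations it is a single class of
    [altN].  Its length is the sum of the [k - 1] over the cycle lengths [k] in
    the symmetric case and the sum of the [k./2] in the alternating one:
    products of generators on consecutive segments attain these values.  For the
    lower bound, label the points and merge labels along a word: the sum of
    [pw (block size)], with [pw] the weight of a cycle, grows by at most one for
    each generator.  Hence [gamma (n)] is the number [p (n)] of partitions of
    [n] for [symN], and
    [2 gamma (2 n) = p_2 (2 n) + p (n)] for [altN], where [p] and [p_2] are the
    coefficients of [1 / E] and [1 / E ^ 2], [E] the product of the [1 - q ^ n].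

    The Ramanujan congruences for [1 / E ^ k], [k <= 2], follow Watson.  Let [U]
    keep the exponents divisible by [l] and divide them by [l].  Splitting [E]
    by exponents mod [l], with the vanishing sections provided by the expansions
    of [E] and [E ^ 3], and taking the norm of [E] under [q -> w q], [w ^ l = 1],
    gives a modular equation of degree [l] for [F = eta (l ^ 2 tau) / eta (tau)]
    over [Z [V t]], [t = (eta (l tau) / eta (tau)) ^ w].  It makes
    [U (F ^ a)] an integer polynomial in [t] with controlled [l]-adic
    valuations, so that two applications of [U] gain one factor [l]. *)

(** * Cycle decompositions of finitary permutations *)

Local Open Scope group_scope.

(** The term [p (n)] in the alternating count comes from averaging the constant 1 and the sign over
    all cycle types. The lengths [2 v] and [2 v + 1] both weigh [v] and have opposite signs: without
    signs they contribute [1 / (1 - q^v)^2], with signs [1 / (1 - q^(2 v))]. So the difference of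
    the two gammas is half of [p_2 (2 n) - p (n)]. As [24 n = 1] implies [24 (2 n) = 2], one
    congruence for [1 / E^k] covers both terms, and the factor 2 is harmless because [l] is odd. The
    modular equations are polynomial identities between the sections of [E]. These sections are
    algebraically related because whole residue classes of exponents are missing from [E^3]. Roots
    of unity enter only through the norm, taken over [algC] and pulled back to [int] along an
    injective map. The two applications of [U] behave differently: before one of them the series is
    shifted by [q^(k (l^2 - 1) / 24)], which amounts to a factor [F^k] and only preserves the power
    of [l]; the other has no shift and gains a factor [l]. Hence the exponent [j./2]. *)

Section Decomposition.
Implicit Types (x y z : posint) (g h : symN) (c u e : seq posint) (cs ds : seq (seq posint)).

Lemma symN_inj g : injective g.
Proof. exact: bij_inj (symN_bij g). Qed.

Lemma symNVK g : cancel (g^-1 : symN)%g g. Proof. exact: symN_invfunK. Qed.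

Definition swap x y z := if z == x then y else if z == y then x else z.

Lemma swapK x y : involutive (swap x y).
Proof.
move=> z; rewrite /swap; case: (eqVneq z x) => [->|zx].
  by case: (eqVneq y x) => [//|yx]; rewrite eqxx.
case: (eqVneq z y) => [->|zy]; first by rewrite eqxx.
by rewrite (negbTE zx) (negbTE zy).
Qed.

Lemma finitary_swap x y : finitary (swap x y).
Proof.
apply/asboolP; split; first exact: inv_bij (swapK x y).
apply: (@sub_finite_set _ _ [set` [:: x; y]]); last exact: finite_seq.
move=> z /=; rewrite /swap !inE; case: (eqVneq z x) => // _.
by case: (eqVneq z y) => // _; rewrite eqxx.
Qed.

Definition transp x y : symN := SymN (finitary_swap x y).

Lemma transpE x y z : transp x y z = swap x y z. Proof. by []. Qed.

(** The induction leaves the image of the head to be corrected. Composing with the transposition of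
    [z x] and [y] does so without disturbing the tail, since neither point is an image of the
    tail. *)
Lemma perm_extend (a b : seq posint) : uniq a -> uniq b -> size a = size b ->
  exists z : symN, map z a = b.
Proof.
elim: a b => [|x a IH] [|y b] //=; first by exists 1.
move=> /andP[xa ua] /andP[yb ub] [/(IH _ ua ub)[z zab]].
exists (transp (z x) y * z); rewrite symNM transpE /swap eqxx; congr (_ :: _).
rewrite -[RHS]zab; apply/eq_in_map => v va; rewrite symNM transpE /swap.
rewrite (inj_eq (@symN_inj z)); case: eqP => [vx|_]; first by rewrite -vx va in xa.
by case: eqP => // zy; rewrite -zy -zab map_f in yb.
Qed.

(** Cycles of length one, and even empty ones, are allowed, so that constructions can start from a
    trivial cycle; uniqueness statements ask for lengths at least 2. *)
Definition dec g cs := [/\ uniq (flatten cs), {in cs, forall c, fcycle g c} &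
  forall x, x \notin flatten cs -> g x = x].

Lemma dec_conj (z : symN) g cs : dec g cs -> dec (z * g * z^-1) (map (map z) cs).
Proof.
move=> [ucs cy fx]; split.
- by rewrite -map_flatten map_inj_uniq //; apply: symN_inj.
- move=> _ /mapP[c /cy cc ->]; case: c cc => // x c.
  move=> cc; rewrite /= -map_rcons path_map; apply: sub_path cc => a b /= /eqP <-.
  by rewrite symN_funK.
move=> x; rewrite -map_flatten => nx; rewrite !symNM fx ?symNVK //.
by apply: contraNN nx => zx; rewrite -[x](symNVK z) map_f.
Qed.

Lemma dec_next g cs c x : dec g cs -> c \in cs -> x \in c -> g x = next c x.
Proof. by move=> [_ cy _] ccs xc; apply/eqP/(next_cycle (cy c ccs) xc). Qed.

Lemma dec_fun g h cs : dec g cs -> dec h cs -> g = h.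
Proof.
move=> dg dh; apply: symNP => x; have [|nx] := boolP (x \in flatten cs).
  by case/flattenP => c ccs xc; rewrite (dec_next dg ccs xc) (dec_next dh ccs xc).
by case: dg dh => [_ _ fg] [_ _ fh]; rewrite fg ?fh.
Qed.

(** A permutation carrying one concatenation of cycles to the other carries cycle to cycle, because
    a list of lists is determined by its flattening and its shape. *)
Lemma dec_conj_ex g h cs ds : dec g cs -> dec h ds -> map size cs = map size ds ->
  exists z : symN, h = z * g * z^-1.
Proof.
move=> dg dh s; have [ug _ _] := dg; have [uh _ _] := dh.
have [|z zE] := perm_extend ug uh; first by rewrite !size_flatten /shape s.
exists z; apply: dec_fun dh _; rewrite (_ : ds = map (map z) cs); first exact: dec_conj.
apply: eq_from_flatten_shape; first by rewrite -map_flatten zE.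
by rewrite /shape -s -map_comp; apply: eq_map => c /=; rewrite size_map.
Qed.

Lemma dec_perm g cs ds : perm_eq cs ds -> dec g cs -> dec g ds.
Proof.
move=> p [u cy fx]; have pf := perm_flatten p; split.
- by rewrite -(perm_uniq pf).
- by move=> c; rewrite -(perm_mem p); apply: cy.
by move=> x; rewrite -(perm_mem pf); apply: fx.
Qed.

Lemma dec_uniq g cs c : dec g cs -> c \in cs -> uniq c.
Proof.
move=> [u _ _] /splitPr ccs; case: ccs u => a b.
by rewrite flatten_cat /= !cat_uniq => /and3P[_ _ /and3P[]].
Qed.

Lemma fcycle_traject g c x : fcycle g c -> x \in c ->
  forall y, y \in c -> exists i, y = iter i g x.
Proof.
move=> cc xc; have [i s rE] := rot_to xc => y.
rewrite -(mem_rot i) rE; move: cc; rewrite -(rot_cycle i) rE /= => /fpathP[n nE].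
have {nE} sE : rcons s x = traject g (g x) n by [].
rewrite inE => /orP[/eqP -> |ys]; first by exists 0%N.
have : y \in traject g (g x) n by rewrite -sE mem_rcons inE ys orbT.
by case/trajectP => j _ ->; exists j.+1; rewrite iterSr.
Qed.

Lemma fcycle_closed g c x i : fcycle g c -> x \in c -> iter i g x \in c.
Proof.
move=> cc xc; elim: i => // i IH /=.
by rewrite (eqP (next_cycle cc IH)) mem_next.
Qed.

(** A moved point has the same orbit in both decompositions. So for each [k >= 2] both have the same
    points on cycles of length [k], and dividing their number by [k] counts these cycles. *)
Lemma dec_size_mono g cs ds : dec g cs -> dec g ds -> all (leq 2) (map size cs) ->
  all (leq 2) (map size ds) -> perm_eq (map size cs) (map size ds).
Proof.
have key cs' ds' c d x : dec g cs' -> dec g ds' -> c \in cs' -> d \in ds' -> x \in c ->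
    x \in d -> {subset c <= d}.
  move=> [_ cy _] [_ dy _] cc dd xc xd y yc.
  have [i ->] := fcycle_traject (cy _ cc) xc yc.
  exact: fcycle_closed (dy _ dd) xd.
have sub cs' ds' k : dec g cs' -> dec g ds' -> all (leq 2) (map size cs') ->
    {subset flatten [seq c <- cs' | size c == k] <= flatten [seq c <- ds' | size c == k]}.
  move=> dc dd ac x /flattenP[c]; rewrite mem_filter => /andP[/eqP ck ccs] xc.
  have [ucs cy _] := dc; have [uds dy dfx] := dd.
  have uc := dec_uniq dc ccs.
  have c2 : (2 <= size c)%N by apply: (allP ac); apply: map_f.
  have gx : g x != x.
    rewrite (dec_next dc ccs xc); have [i s rE] := rot_to xc.
    rewrite -(next_rot i uc) rE.
    have : uniq (x :: s) by rewrite -rE rot_uniq.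
    have : (2 <= size (x :: s))%N by rewrite -rE size_rot.
    by case: s {rE} => //= y s _; rewrite eqxx !inE negb_or eq_sym => /andP[/andP[]].
  have : x \in flatten ds' by apply: contraNT gx => /dfx ->.
  case/flattenP => d dds xd; apply/flattenP; exists d => //.
  rewrite mem_filter dds andbT -ck.
  have ud := dec_uniq dd dds.
  rewrite eqn_leq !uniq_leq_size //; first exact: key dc dd ccs dds xc xd.
  exact: key dd dc dds ccs xd xc.
move=> dc dd ac ad; apply/allP => k _ /=; apply/eqP.
have ct cs' : all (leq 2) (map size cs') -> size (flatten [seq c <- cs' | size c == k]) =
    (k * count_mem k (map size cs'))%N.
  move=> _; elim: cs' => [|c cs' IH] /=; first by rewrite muln0.
  by case: (eqVneq (size c) k) => [ck|_] /=; rewrite ?size_cat IH ?ck ?mulnDr ?muln1 ?add0n.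
have uf cs' : dec g cs' -> uniq (flatten [seq c <- cs' | size c == k]).
  case=> u _ _; apply: subseq_uniq u.
  elim: cs' => //= c cs' IH; case: ifP => _ /=; first exact: cat_subseq.
  by apply: subseq_trans IH _; apply: suffix_subseq.
have [k2|k2] := leqP 2 k.
  apply/eqP; rewrite -(eqn_pmul2l (m := k)) ?(leq_trans _ k2) // -!ct //.
  by rewrite eqn_leq !uniq_leq_size ?uf //; apply: sub.
have z ss : all (leq 2) ss -> count_mem k ss = 0%N.
  move=> /allP H; apply/eqP; rewrite eqn0Ngt -has_count; apply/negP => /hasP[v /H].
  by move=> v2 /eqP vk; rewrite vk leqNgt k2 in v2.
by rewrite !z.
Qed.
End Decomposition.

(** * Existence and composition of cycle decompositions *)

Section Existence.
Implicit Types (x y : posint) (g h t : symN) (c u e s : seq posint) (cs ds : seq (seq posint)).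

(** By pigeonhole the trajectory of [x] inside [s] repeats itself, and injectivity moves the
    repetition back to [x]; the least return time gives a cycle without repetitions. *)
Lemma orbit_exists g s x : x \in s -> {in s, forall y, g y \in s} ->
  exists c, [/\ uniq c, x \in c, fcycle g c & {subset c <= s}].
Proof.
move=> xs sg.
have its i : iter i g x \in s by elim: i => //= i; apply: sg.
have ex : exists n, iter n.+1 g x == x.
  have : ~~ uniq (traject g x (size s).+1).
    apply/negP => u; have : (size (traject g x (size s).+1) <= size s)%N.
      by apply: uniq_leq_size => // y /trajectP[i _ ->].
    by rewrite size_traject ltnn.
  rewrite looping_uniq negbK => /trajectP[i il iE].
  exists (size s - i).-1; apply/eqP.
  have inj k a b : iter k g a = iter k g b -> a = b by elim: k => //= k IH /symN_inj/IH.
  by apply: (inj i); rewrite -iterD prednK ?subn_gt0 // subnKC 1?ltnW.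
case: (ex_minnP ex) => n /eqP nx nmin; exists (traject g x n.+1); split.
- rewrite looping_uniq; apply/negP => /trajectP[i il iE].
  have inj k a b : iter k g a = iter k g b -> a = b by elim: k => //= k IH /symN_inj/IH.
  have : iter (n - i).-1.+1 g x == x.
    by apply/eqP; apply: (inj i); rewrite -iterD prednK ?subn_gt0 // subnKC 1?ltnW.
  by move/nmin; lia.
- by rewrite /= inE eqxx.
- rewrite /=; apply/fpathP; exists n.+1.
  by rewrite trajectSr -iterSr nx.
by move=> y /trajectP[i _ ->].
Qed.

Lemma dec_exists g : exists cs, dec g cs /\ all (leq 2) (map size cs).
Proof.
have [s0 s0E] : exists s, forall x, (x \in s) = (g x != x).
  have /finite_seqP[s sE] := symN_fin g; exists s => x.
  have : ([set x | g x != x]%classic x) = ([set` s]%classic x) by rewrite sE.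
  by move=> /= E; apply/idP/idP => H; [rewrite E|rewrite -E].
(* The induction peels off one orbit at a time, so it ranges over all lists stable under [g]. Cycles
   are kept nonempty because, all their points being moved, they then have length at least 2. *)
suff H s : uniq s -> {in s, forall y, g y \in s} -> exists cs,
    [/\ uniq (flatten cs), {in cs, forall c, fcycle g c /\ c != [::]} & flatten cs =i s].
  have [||cs [u cy E]] := H (undup s0); first exact: undup_uniq.
    by move=> x; rewrite !mem_undup !s0E (inj_eq (@symN_inj g)).
  have moved c x : c \in cs -> x \in c -> g x != x.
    by move=> ccs xc; rewrite -s0E -mem_undup -E; apply/flattenP; exists c.
  exists cs; split; first split => //.
  - by move=> c /cy[].
  - by move=> x; rewrite E mem_undup s0E negbK => /eqP.
  apply/allP => _ /mapP[c ccs ->]; have [cc c0] := cy _ ccs.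
  case: c c0 ccs cc => [//|x [|//]] _ ccs /= /andP[gx _].
  by have := moved _ x ccs (mem_head _ _); rewrite gx.
have [n] := ubnP (size s); elim: n s => // n IH s sn us sg.
case: s sn us sg => [|x s'] sn us sg; first by exists [::].
set s := x :: s' in sn us sg *.
have [c [uc xc cc cs]] := orbit_exists (mem_head x s') sg.
have [|||cs' [u cy E]] := IH [seq y <- s | y \notin c].
- apply: (leq_trans _ (sn : size s <= n)%N); rewrite size_filter -(count_predC (mem c) s).
  rewrite -[X in (X < _)%N]add0n ltn_add2r -has_count; apply/hasP; exists x => //.
  exact: mem_head.
- exact: filter_uniq.
- move=> y; rewrite !mem_filter => /andP[yc ys]; rewrite (sg _ ys) andbT.
  apply: contraNN yc => gyc; have := mem_prev c (g y); rewrite gyc => pc.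
  have /eqP := prev_cycle cc gyc; move/symN_inj => <-; exact: pc.
exists (c :: cs'); split => /=.
- rewrite cat_uniq uc u andbT; apply/hasPn => y; rewrite E mem_filter.
  by case/andP.
- move=> d; rewrite inE => /orP[/eqP ->|]; last exact: cy.
  by split=> //; case: (c) xc.
move=> y; rewrite mem_cat E mem_filter.
by have [/cs ->|_] := boolP (y \in c).
Qed.

Lemma dec_mul g h cs ds : dec g cs -> dec h ds -> uniq (flatten (cs ++ ds)) ->
  dec (g * h) (cs ++ ds).
Proof.
move=> dg dh u; have [ug cg fg] := dg; have [uh ch fh] := dh.
move: (u); rewrite flatten_cat cat_uniq => /and3P[_ /hasPn disj _].
have gd x : x \in flatten ds -> g x = x by move=> /disj; apply: fg.
have hc x : x \in flatten cs -> h x = x.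
  by move=> xc; apply: fh; apply: contraL xc => /disj.
have cyc_eq (f f' : symN) c : {in c, f =1 f'} -> fcycle f c -> fcycle f' c.
  move=> E cc; rewrite -(eq_in_cycle (P := mem c) (e := frel f)) //.
  by move=> a b /= /E ->.
split=> //.
- move=> c; rewrite mem_cat => /orP[ccs|cds].
    by apply: (cyc_eq g); [|exact: cg] => x xc; rewrite symNM hc //; apply/flattenP; exists c.
  apply: (cyc_eq h); [|exact: ch] => x xc; rewrite symNM gd //.
  apply/flattenP; exists c => //.
  by rewrite (eqP (next_cycle (ch c cds) xc)) mem_next.
by move=> x; rewrite flatten_cat mem_cat negb_or => /andP[xc xd]; rewrite symNM fh // fg.
Qed.

Let path_fixed (f f' : symN) x e : {in e, f =1 id} -> fpath f' x e -> fpath (f * f') x e.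
Proof.
elim: e x => //= y e IH x fe /andP[/eqP fx pe]; rewrite -/(f' x) fx (fe y) ?mem_head // eqxx.
by apply: IH => // z ze; apply: fe; rewrite inE ze orbT.
Qed.

(** A path depends on the map only at the points it leaves: the start, whose image is given by
    [f a = f' b], and the points of [u]. The end [x] is never mapped. *)
Let path_sources (f f' : symN) a b u x : f a = f' b -> {in u, f =1 f'} ->
  fpath f' b (rcons u x) -> fpath f a (rcons u x).
Proof.
elim: u a b => [|y u IH] a b /= ab fu; first by rewrite ab.
case/andP=> fb pu; rewrite ab fb /=; apply: IH pu; first by apply: fu; rewrite mem_head.
by move=> z zu; apply: fu; rewrite inE zu orbT.
Qed.

(* [t] extends the first cycle of [g], with which it shares only the point [x]. *)
Lemma dec_glue g t u x e cs ds :
  dec g (rcons u x :: cs) -> dec t ((x :: e) :: ds) ->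
  uniq (flatten ((rcons u x ++ e) :: cs ++ ds)) ->
  dec (g * t) ((rcons u x ++ e) :: cs ++ ds).
Proof.
move=> dg dt uu; have [ug cg fg] := dg; have [ut ct ft] := dt.
have pe : perm_eq (flatten ((rcons u x ++ e) :: cs ++ ds))
   ((u ++ flatten cs) ++ x :: (e ++ flatten ds)).
  by apply/seq.permP => p; rewrite /= flatten_cat -cats1 !count_cat /= !count_cat; lia.
move: (uu); rewrite (perm_uniq pe) cat_uniq => /and3P[_ /hasPn disj xe].
have gE z : z \in e ++ flatten ds -> g z = z.
  move=> ze; apply: fg; have zx : z != x by apply: contraTneq ze => ->; case/andP: xe.
  have := disj z; rewrite inE ze orbT => /(_ isT).
  by rewrite /= !mem_cat mem_rcons inE !negb_or zx.
have tE z : z \in u ++ flatten cs -> t z = z.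
  move=> zu; apply: ft; have := contraL (disj z) zu.
  by rewrite /= !inE !mem_cat orbA.
split=> //.
- move=> c; rewrite inE mem_cat => /or3P[/eqP -> |ccs|cds].
  (* The glued cycle is rotated to start at [x]: it first follows [t] through [e], where [g] is the
     identity, and then, as [t] leads back to [x], follows [g] through [u]. *)
  + rewrite cat_rcons cycle_catC /= rcons_cat cat_path.
    have /= := ct _ (mem_head _ _); rewrite rcons_path => /andP[pt /eqP tl].
    have := cg _ (mem_head _ _); rewrite -cats1 cycle_catC /= => pg.
    apply/andP; split.
      by apply: path_fixed pt => z ze; apply: gE; rewrite mem_cat ze.
rewrite cats1. apply: (@path_sources (g * t) g _ x) pg; first by rewrite symNM tl.
    by move=> z zu; rewrite symNM tE // mem_cat zu.
  + have cc : c \in rcons u x :: cs by rewrite inE ccs orbT.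
    have cgc := cg _ cc; rewrite -(eq_in_cycle (P := mem c) (e := frel g)) // => a b /= ac _.
    rewrite tE //.
    by rewrite mem_cat; apply/orP; right; apply/flattenP; exists c.
  have cc : c \in (x :: e) :: ds by rewrite inE cds orbT.
  have ctc := ct _ cc; rewrite -(eq_in_cycle (P := mem c) (e := frel t)) // => a b /= ac _.
  rewrite gE // mem_cat; apply/orP; right; apply/flattenP; exists c => //.
  by rewrite (eqP (next_cycle (ct _ cc) ac)) mem_next.
move=> z; rewrite (perm_mem pe) mem_cat inE !negb_or => /and3P[zu zx ze].
rewrite symNM ft; last by rewrite /= inE negb_or zx.
rewrite fg // /= mem_cat mem_rcons inE !negb_or zx.
by move: zu; rewrite mem_cat negb_or.
Qed.
End Existence.

Section Words.
Variables (G : groupType) (Q : G -> Prop).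

(** Unlike [is_word] this takes any predicate and adds no inverses: it is used with the generators
    for upper bounds, and with the predicate [cheap], which is stable under inverses, for lower
    bounds. *)
Definition gen_word n (g : G) := exists w : seq G,
  [/\ size w = n, forall s, s \in w -> Q s & g = \prod_(s <- w) s].

Lemma gen_word1 : gen_word 0 1.
Proof. by exists [::]; split; rewrite ?big_nil. Qed.

Lemma gen_word_gen g : Q g -> gen_word 1 g.
Proof. by move=> Qg; exists [:: g]; split; rewrite ?big_seq1 // => s /[!inE] /eqP ->. Qed.

Lemma gen_wordM m n g h : gen_word m g -> gen_word n h -> gen_word (m + n) (g * h).
Proof.
move=> [v [<- Qv ->]] [w [<- Qw ->]]; exists (v ++ w); split.
- by rewrite size_cat.
- by move=> s; rewrite mem_cat => /orP[/Qv|/Qw].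
by rewrite big_cat.
Qed.
End Words.

(** * Short words with prescribed cycle lengths *)

Section Blocks.
Implicit Types (x y z : posint) (g h t : symN) (c u e s : seq posint) (cs ds : seq (seq posint)).

Definition seg a n := map pos (iota a n).
Arguments seg : simpl never.

Lemma pos_inj : injective pos.
Proof. by move=> a b /(congr1 val) /= []. Qed.

Lemma seg_uniq a n : uniq (seg a n).
Proof. by rewrite map_inj_uniq ?iota_uniq //; apply: pos_inj. Qed.

Lemma seg_cat a m n : seg a (m + n) = seg a m ++ seg (a + m) n.
Proof. by rewrite /seg iotaD map_cat. Qed.

Lemma segS a n : seg a n.+1 = rcons (seg a n) (pos (a + n)).
Proof. by rewrite -addn1 seg_cat cats1. Qed.

Lemma dec_transposition x y g : is_transposition x y g -> dec g [:: [:: x; y]].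
Proof.
move=> [xy gE].
have gx : g x = y by rewrite gE /= eqxx.
have gy : g y = x by rewrite gE /= eq_sym (negbTE xy) eqxx.
split.
- by rewrite /= inE xy.
- by move=> c; rewrite inE => /eqP -> /=; rewrite gx gy !eqxx.
by move=> z; rewrite /= !inE negb_or gE /= => /andP[/negbTE -> /negbTE ->].
Qed.

Lemma dec_three_cycle x y z g : is_three_cycle x y z g -> dec g [:: [:: x; y; z]].
Proof.
move=> [u gE]; move: (u); rewrite /= !inE negb_or andbT => /andP[/andP[xy xz] yz].
have gx : g x = y by rewrite gE /= eqxx.
have gy : g y = z by rewrite gE /= eq_sym (negbTE xy) eqxx.
have gz : g z = x by rewrite gE /= eq_sym (negbTE xz) eq_sym (negbTE yz) eqxx.
split=> [|c|v]; first by rewrite /= !inE negb_or xy xz yz.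
  by rewrite inE => /eqP -> /=; rewrite gx gy gz !eqxx.
rewrite /= !inE !negb_or gE /=.
by case/and3P=> /negbTE -> /negbTE -> /negbTE ->.
Qed.

Lemma transpP x y : x != y -> is_transposition x y (transp x y).
Proof. by move=> xy; split=> // z. Qed.

Definition tri x y z := transp x y * transp y z.

Lemma triP x y z : uniq [:: x; y; z] -> is_three_cycle x y z (tri x y z).
Proof.
move=> u; split=> // v; move: u; rewrite /= !inE negb_or andbT => /andP[/andP[xy xz] yz].
rewrite -[LHS]/(swap x y (swap y z v)) /swap.
case: (eqVneq v y) => [->|vy].
  by rewrite eq_sym (negbTE xz) [z == y]eq_sym (negbTE yz) [y == x]eq_sym (negbTE xy).
case: (eqVneq v z) => [->|vz]; first by rewrite [y == x]eq_sym (negbTE xy) eqxx [z == x]eq_sym (negbTE xz).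
by case: (eqVneq v x) => // _; rewrite (negbTE vy).
Qed.

Definition coxeter_gen g := exists i, is_transposition (pos i) (pos i.+1) g.
Definition three_gen g := exists i, is_three_cycle (pos i) (pos i.+1) (pos i.+2) g.

Lemma coxeter_gen_ex i : exists2 g, coxeter_gen g & dec g [:: seg i 2].
Proof.
have T : is_transposition (pos i) (pos i.+1) (transp (pos i) (pos i.+1)).
  by apply: transpP; rewrite (inj_eq pos_inj); lia.
by exists (transp (pos i) (pos i.+1)); [exists i|apply: dec_transposition].
Qed.

Lemma three_gen_ex i : exists2 g, three_gen g & dec g [:: seg i 3].
Proof.
have T : is_three_cycle (pos i) (pos i.+1) (pos i.+2) (tri (pos i) (pos i.+1) (pos i.+2)).
  by apply: triP; rewrite -[[:: _; _; _]]/(seg i 3) seg_uniq.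
by exists (tri (pos i) (pos i.+1) (pos i.+2)); [exists i|apply: dec_three_cycle].
Qed.

(** The starting point [a] is universally quantified so that realizations can be placed side by side
    on disjoint segments. *)
Definition realized (Q : symN -> Prop) ls n := forall a, exists g cs,
  [/\ gen_word Q n g, dec g cs, map size cs = ls & flatten cs = seg a (sumn ls)].

Lemma realized_nil Q : realized Q [::] 0.
Proof. by move=> a; exists 1, [::]; split=> //; apply: gen_word1. Qed.

Lemma realized_cat Q l1 l2 n1 n2 : realized Q l1 n1 -> realized Q l2 n2 ->
  realized Q (l1 ++ l2) (n1 + n2).
Proof.
move=> r1 r2 a; have [g [cs [wg dg sg fg]]] := r1 a.
have [h [ds [wh dh sh fh]]] := r2 (a + sumn l1)%N.
have f : flatten (cs ++ ds) = seg a (sumn (l1 ++ l2)).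
  by rewrite flatten_cat fg fh sumn_cat seg_cat.
exists (g * h), (cs ++ ds); split=> //; first exact: gen_wordM.
  by apply: dec_mul => //; rewrite f seg_uniq.
by rewrite map_cat sg sh.
Qed.

Lemma realized_cycle k : realized coxeter_gen [:: k.+1] k.
Proof.
move=> a; rewrite /= addn0; suff [g [wg dg]] : exists g, gen_word coxeter_gen k g /\ dec g [:: seg a k.+1].
  by exists g, [:: seg a k.+1]; split=> //; rewrite /= ?size_map ?size_iota ?cats0.
elim: k => [|k [g [wg dg]]].
  exists 1; split; first exact: gen_word1.
  split=> //; move=> c; rewrite inE => /eqP ->; rewrite /= eqxx //.
have [t Qt dt] := coxeter_gen_ex (a + k); exists (g * t); split.
  by rewrite -addn1; apply: gen_wordM wg (gen_word_gen Qt).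
have := @dec_glue g t (seg a k) (pos (a + k)) [:: pos (a + k).+1] [::] [::].
rewrite -segS cats1 -addnS -segS; apply=> //; first by rewrite addnS; exact: dt.
by rewrite (_ : flatten _ = seg a k.+2) ?seg_uniq //; apply: cats0.
Qed.

(** Gluing a 3-cycle at the last point adds two points for one generator. *)
Lemma realized_odd_cycle k : realized three_gen [:: k.*2.+1] k.
Proof.
move=> a; rewrite /= addn0.
suff [g [wg dg]] : exists g, gen_word three_gen k g /\ dec g [:: seg a k.*2.+1].
  by exists g, [:: seg a k.*2.+1]; split=> //; rewrite /= ?size_map ?size_iota ?cats0.
elim: k => [|k [g [wg dg]]].
  exists 1; split; first exact: gen_word1.
  split=> //; move=> c; rewrite inE => /eqP ->; rewrite /= eqxx //.
have [t Qt dt] := three_gen_ex (a + k.*2); exists (g * t); split.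
  by rewrite -addn1; apply: gen_wordM wg (gen_word_gen Qt).
have := @dec_glue g t (seg a k.*2) (pos (a + k.*2)) [:: pos (a + k.*2).+1; pos (a + k.*2).+2] [::] [::].
rewrite -segS.
have -> : seg a k.*2.+1 ++ [:: pos (a + k.*2).+1; pos (a + k.*2).+2] = seg a k.+1.*2.+1.
  by rewrite doubleS -[in RHS]addn2 seg_cat addnS.
apply=> //.
by rewrite (_ : flatten _ = seg a k.+1.*2.+1) ?seg_uniq //; apply: cats0.
Qed.

(** This is the identity [(0 1 2) (1 2 3) = (0 1) (2 3)], the right factor being applied first. *)
Lemma double_transposition i : exists2 g, gen_word three_gen 2 g &
  dec g [:: seg i 2; seg i.+2 2].
Proof.
pose p j := pos (i + j)%N.
have pE j k : (p j == p k) = (j == k) by rewrite /p (inj_eq pos_inj) eqn_add2l.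
have t1 : is_three_cycle (p 0%N) (p 1%N) (p 2%N) (tri (p 0%N) (p 1%N) (p 2%N)).
  by apply: triP; rewrite /= !inE !pE.
have t2 : is_three_cycle (p 1%N) (p 2%N) (p 3%N) (tri (p 1%N) (p 2%N) (p 3%N)).
  by apply: triP; rewrite /= !inE !pE.
have p0 : p 0%N = pos i by rewrite /p addn0.
have p1 : p 1%N = pos i.+1 by rewrite /p addn1.
have p2 : p 2%N = pos i.+2 by rewrite /p addn2.
have p3 : p 3%N = pos i.+3 by rewrite /p addn3.
have seg0 : seg i 2 = [:: p 0%N; p 1%N] by rewrite p0 p1.
have seg2 : seg i.+2 2 = [:: p 2%N; p 3%N] by rewrite p2 p3.
move: (tri (p 0%N) (p 1%N) (p 2%N)) (tri (p 1%N) (p 2%N) (p 3%N)) t1 t2 => f1 f2 t1 t2.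
exists (f1 * f2).
  rewrite -[2%N]/(1 + 1)%N; apply: gen_wordM; apply: gen_word_gen.
    by exists i; rewrite -p0 -p1 -p2.
  by exists i.+1; rewrite -p1 -p2 -p3.
rewrite seg0 seg2; case: t1 t2 => _ e1 [_ e2].
set g := _ * _; have gE z : g z = f1 (f2 z) by [].
clearbody g.
have g0 : g (p 0%N) = p 1%N by rewrite gE e2 /= !pE /= e1 /= !eqxx.
have g1 : g (p 1%N) = p 0%N by rewrite gE e2 /= !pE /= e1 /= !pE.
have g2 : g (p 2%N) = p 3%N by rewrite gE e2 /= !pE /= e1 /= !pE.
have g3 : g (p 3%N) = p 2%N by rewrite gE e2 /= !pE /= e1 /= !pE.
split.
- by rewrite /= !inE !pE.
- by move=> c; rewrite !inE => /orP[] /eqP -> /=; rewrite ?g0 ?g1 ?g2 ?g3 !eqxx.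
move=> z; rewrite /= !inE !negb_or gE e2 /= => /and4P[z0 z1 z2 z3].
by rewrite (negbTE z1) (negbTE z2) (negbTE z3) e1 /= (negbTE z0) (negbTE z1) (negbTE z2).
Qed.

Let perm_swap c e : perm_eq [:: c; e] [:: e; c].
Proof. by apply/seq.permP => p /=; lia. Qed.

(** An even cycle is an odd permutation, so even cycles must be made two at a time. A double
    transposition lengthens the odd cycle on its left and the one on its right by one point each, at
    the cost of two generators. *)
Lemma realized_even_pair k m : realized three_gen [:: k.*2.+2; m.*2.+2] (k + m + 2).
Proof.
move=> a; have [g [cs [wg dg sg fg]]] := realized_odd_cycle k a.
have [h [ds [wh dh sh fh]]] := realized_odd_cycle m (a + k.*2.+3)%N.
have [t wt dt] := double_transposition (a + k.*2).
move: sg fg dg; case: cs => [|c [|]] //= [sc]; rewrite cats0 addn0 => -> dg {c sc}.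
move: sh fh dh; case: ds => [|c [|]] //= [sc]; rewrite cats0 addn0 => -> dh {c sc}.
rewrite segS in dg.
have -> : seg a (k.*2.+2 + (m.*2.+2 + 0)) = seg a k.*2.+2 ++ seg (a + k.*2.+2) m.*2.+2.
  by rewrite addn0 seg_cat.
have s1 : rcons (seg a k.*2) (pos (a + k.*2)) ++ [:: pos (a + k.*2).+1] = seg a k.*2.+2.
  by rewrite -segS cats1 -addnS -segS.
have s2 : [:: pos (a + k.*2.+2); pos (a + k.*2.+3)] ++ seg (a + k.*2.+4) m.*2 = seg (a + k.*2.+2) m.*2.+2.
  by rewrite -[m.*2.+2]/(2 + m.*2)%N seg_cat addnS -!addnS addn2 /= -!addnS.
have d1 : dec (g * t) [:: seg a k.*2.+2; [:: pos (a + k.*2.+2); pos (a + k.*2.+3)]].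
  have := @dec_glue g t (seg a k.*2) (pos (a + k.*2)) [:: pos (a + k.*2).+1] [::]
    [:: [:: pos (a + k.*2).+2; pos (a + k.*2).+3]].
  rewrite s1 -!addnS => H; apply: H => //; first by rewrite !addnS; exact: dt.
  rewrite (_ : flatten _ = seg a (k.*2.+2 + 2)) ?seg_uniq // seg_cat /= /seg /=.
  by rewrite !addnS.
have := @dec_glue (g * t) h [:: pos (a + k.*2.+2)] (pos (a + k.*2.+3)) (seg (a + k.*2.+4) m.*2)
   [:: seg a k.*2.+2] [::].
rewrite [rcons _ _ ++ _]s2 => H.
exists (g * t * h), [:: seg a k.*2.+2; seg (a + k.*2.+2) m.*2.+2]; split.
- have -> : (k + m + 2 = k + 2 + m)%N by lia.
  by do 2![apply: gen_wordM => //].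
- apply: (@dec_perm _ [:: seg (a + k.*2.+2) m.*2.+2; seg a k.*2.+2]); first exact: perm_swap.
  apply: H.
  + exact: (dec_perm (perm_swap _ _) d1).
  + by rewrite !addnS in dh *; exact: dh.
  rewrite (_ : flatten _ = seg (a + k.*2.+2) m.*2.+2 ++ seg a k.*2.+2); last by rewrite /= cats0.
  by rewrite uniq_catC -seg_cat seg_uniq.
- by rewrite /= !size_map !size_iota.
by rewrite /= cats0.
Qed.
End Blocks.

Definition idx (x : posint) := (val x).-1.
Lemma posK : cancel pos idx. Proof. by []. Qed.
Lemma idxK : cancel idx pos. Proof. by case=> -[|k] // hk; apply/val_inj. Qed.

Lemma pos_eq k x : (pos k == x) = (k == idx x).
Proof. by rewrite -{1}[x]idxK (inj_eq pos_inj). Qed.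

(** * Parity of finitary permutations *)

Section Parity.
Implicit Types (x y z : posint) (g h t : symN) (c u e : seq posint) (cs ds : seq (seq posint)).

Lemma finite_symN_bound g : exists n, forall k, (n <= k)%N -> g (pos k) = pos k.
Proof.
have /finite_seqP[s sE] := symN_fin g; exists (\max_(x <- s) (idx x).+1)%N => k nk.
apply: contrapT => /eqP gk; have ks : pos k \in s.
  have : [set x | g x != x]%classic (pos k) by [].
  by rewrite sE.
have := @leq_bigmax_seq _ s xpredT (fun x => (idx x).+1) _ ks isT.
by rewrite posK => /leq_trans/(_ nk); rewrite ltnn.
Qed.

Lemma restricts_to_exists g : exists n (s : 'S_n), restricts_to g s.
Proof.
have [n nfix] := finite_symN_bound g; exists n.
have lt (i : 'I_n) : (idx (g (pos i)) < n)%N.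
  rewrite ltnNge; apply/negP => ni; have := nfix _ ni; rewrite idxK => /symN_inj E.
  by move: ni; rewrite E posK leqNgt ltn_ord.
have inj : injective (fun i : 'I_n => Ordinal (lt i)).
  move=> i j /(congr1 val) /= /(can_inj idxK)/symN_inj/pos_inj; exact: val_inj.
by exists (perm inj); split=> // i; rewrite permE /= idxK.
Qed.

(** Two windows widen to their maximum, where the permutation is determined by [g]; so the parity,
    defined by an existential, can be computed in any window. *)
Lemma even_restricts g n (s : 'S_n) : restricts_to g s -> even_symN g = ~~ odd_perm s.
Proof.
move=> gs; apply/idP/idP => [/asboolP[m [t [gt]]]|es]; last by apply/asboolP; exists n, s.
have [s' [gs' _] <-] := restricts_to_widen (leq_maxl n m) gs.
have [t' [gt' _] <-] := restricts_to_widen (leq_maxr n m) gt.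
have -> // : s' = t'; apply/permP => i; apply/val_inj/pos_inj.
by rewrite -gs' gt'.
Qed.

Lemma evenM g h : even_symN (g * h) = (even_symN g == even_symN h).
Proof.
have [n [s gs]] := restricts_to_exists g; have [m [t ht]] := restricts_to_exists h.
have [s' gs' _] := restricts_to_widen (leq_maxl n m) gs.
have [t' ht' _] := restricts_to_widen (leq_maxr n m) ht.
rewrite (even_restricts gs') (even_restricts ht') (@even_restricts _ _ (t' * s')).
  by rewrite odd_permM; do 2!case: (odd_perm _).
case: gs' ht' => g1 g2 [h1 h2]; split=> [i|k nk]; last by rewrite symNM h2 ?g2.
by rewrite symNM h1 g1 permM.
Qed.

Lemma even1 : even_symN 1.
Proof. by have := evenM 1 1; rewrite mulg1; case: (even_symN 1). Qed.

Lemma evenV g : even_symN g^-1%g = even_symN g.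
Proof. by have := evenM g g^-1%g; rewrite mulgV even1 => /esym/eqP. Qed.

Lemma even_conjg (z : symN) g : even_symN (z * g * z^-1) = even_symN g.
Proof. by rewrite !evenM evenV; do 2!case: (even_symN _). Qed.

Lemma even_transposition x y g : is_transposition x y g -> even_symN g = false.
Proof.
move=> [xy gE]; pose n := (idx x + idx y).+1.
have xn : (idx x < n)%N by rewrite /n; lia.
have yn : (idx y < n)%N by rewrite /n; lia.
pose i := Ordinal xn; pose j := Ordinal yn.
rewrite (@even_restricts _ _ (tperm i j)).
  by rewrite odd_tperm -val_eqE /= (inj_eq (can_inj idxK)) xy.
split=> [k|k nk]; rewrite gE /=.
  case: tpermP => [->|->|ki kj] /=; rewrite ?idxK ?eqxx //.
    by rewrite eq_sym (negbTE xy).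
  rewrite !pos_eq.
  have /negbTE -> : (k : nat) != idx x by apply/eqP => E; apply: ki; apply/val_inj.
  by have /negbTE -> : (k : nat) != idx y by apply/eqP => E; apply: kj; apply/val_inj.
rewrite !pos_eq.
by do 2?[case: eqP => [?|_]; first by rewrite /n in nk; lia].
Qed.

Lemma three_cycleE x y z g : is_three_cycle x y z g -> g = tri x y z.
Proof. by move=> [u gE]; apply: symNP => v; rewrite gE; have [_ ->] := triP u. Qed.

Lemma even_three_cycle x y z g : is_three_cycle x y z g -> even_symN g.
Proof.
move=> tg; rewrite (three_cycleE tg) evenM; case: tg => u _.
move: u; rewrite /= !inE negb_or andbT => /andP[/andP[xy _] yz].
by rewrite (even_transposition (transpP xy)) (even_transposition (transpP yz)).
Qed.

Lemma even_gen_word (Q : symN -> Prop) n g : (forall s, Q s -> even_symN s = false) ->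
  gen_word Q n g -> even_symN g = ~~ odd n.
Proof.
move=> QF [w [<- Qw ->]]; elim: w Qw => [|s w IH] Qw; first by rewrite big_nil even1.
have Qs : Q s by apply: Qw; apply: mem_head.
have {}/IH IH : forall v, v \in w -> Q v by move=> v vw; apply: Qw; rewrite inE vw orbT.
by rewrite big_cons evenM (QF _ Qs) IH /=; case: (odd _).
Qed.

Lemma realized_coxeter ls : all (leq 1) ls ->
  realized coxeter_gen ls (\sum_(k <- ls) k.-1)%N.
Proof.
elim: ls => [|k ls IH] /=; first by move=> _; rewrite big_nil; apply: realized_nil.
case/andP=> k0 /IH r; rewrite big_cons -cat1s; apply: realized_cat r.
by rewrite -{1}(prednK k0); apply: realized_cycle.
Qed.

Lemma realized_three_even ls : all (fun k => ~~ odd k && (2 <= k)%N) ls -> ~~ odd (size ls) ->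
  realized three_gen ls (\sum_(k <- ls) k./2)%N.
Proof.
have [n] := ubnP (size ls); elim: n ls => // n IH [|k [|m ls]] //= sz.
  by move=> _ _; rewrite big_nil; apply: realized_nil.
case/and3P=> /andP[ok k2] /andP[om m2] al; rewrite negbK => os.
rewrite !big_cons addnA -[[:: k, m & ls]]/([:: k; m] ++ ls); apply: realized_cat; last by apply: IH => //; lia.
have kE : k = (k./2.-1).*2.+2 by lia.
have mE : m = (m./2.-1).*2.+2 by lia.
rewrite {1}kE {1}mE (_ : (k./2 + m./2 = k./2.-1 + m./2.-1 + 2)%N); last by lia.
exact: realized_even_pair.
Qed.

Lemma realized_three_odd ls : all odd ls -> realized three_gen ls (\sum_(k <- ls) k./2)%N.
Proof.
elim: ls => [|k ls IH] /=; first by move=> _; rewrite big_nil; apply: realized_nil.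
case/andP=> k0 /IH r; rewrite big_cons -cat1s; apply: realized_cat r.
by rewrite {1}(_ : k = k./2.*2.+1); [apply: realized_odd_cycle | lia].
Qed.

(** The permutation is conjugate to a product of [k - 1] adjacent transpositions for each cycle
    length [k], and each of them is odd. *)
Lemma even_dec g cs : dec g cs -> all (leq 1) (map size cs) ->
  even_symN g = ~~ odd (\sum_(k <- map size cs) k.-1)%N.
Proof.
move=> dg al; have [h [ds [wh dh sh _]]] := realized_coxeter al 0.
have [z ->] := dec_conj_ex dh dg sh; rewrite even_conjg.
by apply: even_gen_word wh => s [i /even_transposition].
Qed.
End Parity.

(** * A lower bound for word lengths *)

Section Labels.
Implicit Types (x y z : posint) (g h t : symN) (f : posint -> nat) (N n p q r v : nat) (c : seq posint)
  (cs : seq (seq posint)).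
(** To be instantiated with [predn] for the symmetric group and with [half] for the alternating one.
    The bound [pw_merge3] assumed further down holds for [half] only: three blocks merged at once
    cost [predn] two units. *)
Variable pw : nat -> nat.
Hypotheses (pw0 : pw 0 = 0%N) (pw1 : pw 1 = 0%N).
Hypothesis pw_super : forall a b, (pw a + pw b <= pw (a + b))%N.
Hypothesis pw_merge : forall a b, (pw (a + b) <= pw a + pw b + 1)%N.

Lemma pw_mono a b : (a <= b)%N -> (pw a <= pw b)%N.
Proof. by move=> ab; have := pw_super a (b - a); rewrite subnKC //; lia. Qed.

Definition label_count N f v := count (fun i => f (pos i) == v) (iota 0 N).
Definition potential N f := (\sum_(v < N) pw (label_count N f v))%N.
Definition merge p q v := if v == q then p else v.

Lemma label_count_merge N f p q v : p != q -> label_count N (merge p q \o f) v =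
  if v == p then (label_count N f p + label_count N f q)%N else
  if v == q then 0%N else label_count N f v.
Proof.
move=> pq; rewrite /label_count; elim: (iota 0 N) => [|i s IH] /=; first by case: ifP => // _; case: ifP.
rewrite IH /merge; case: (eqVneq v p) => [->|vp].
  case: (eqVneq (f (pos i)) q) => [->|_]; last by lia.
  by rewrite eqxx eq_sym (negbTE pq) /=; lia.
case: (eqVneq v q) => [->|vq].
  case: (eqVneq (f (pos i)) q) => [_|/negbTE ->]; last by [].
  by rewrite (negbTE pq).
case: (eqVneq (f (pos i)) q) => [->|_] //.
by rewrite eq_sym (negbTE vp) eq_sym (negbTE vq).
Qed.

Lemma potential_merge N f p q : p != q -> (p < N)%N -> (q < N)%N ->
  (potential N (merge p q \o f) + pw (label_count N f p) + pw (label_count N f q) =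
  potential N f + pw (label_count N f p + label_count N f q))%N.
Proof.
move=> pq pN qN; rewrite /potential.
have sp (F : nat -> nat) : (\sum_(v < N) F v =
    F p + (F q + \sum_(v < N | (v != Ordinal pN) && (v != Ordinal qN)) F v))%N.
  rewrite (bigD1 (Ordinal pN)) //= (bigD1 (Ordinal qN)) //.
  by rewrite -val_eqE /= eq_sym.
rewrite (sp (fun v => pw (label_count N (merge p q \o f) v))) (sp (fun v => pw (label_count N f v))).
rewrite !label_count_merge // eqxx eq_sym (negbTE pq) eqxx pw0.
set S1 := (\sum_(i < N | _) _)%N; set S2 := (\sum_(i < N | _) _)%N.
have -> : S1 = S2; last by lia.
apply: eq_bigr => i; rewrite -!val_eqE /= => /andP[ip iq].
by rewrite label_count_merge // (negbTE ip) (negbTE iq).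
Qed.

(* Merging the labels of the points moved by [t] makes the labelling invariant
   under [t], at the cost of at most one unit of potential. *)
Definition cheap t := exists N0, forall N f, (N0 <= N)%N ->
  (forall k, (k < N)%N -> (f (pos k) < N)%N) -> exists phi : nat -> nat,
  [/\ forall v, (v < N)%N -> (phi v < N)%N, forall x, phi (f (t x)) = phi (f x) &
    (potential N (phi \o f) <= potential N f + 1)%N].

Lemma merge_lt N p q v : (p < N)%N -> (v < N)%N -> (merge p q v < N)%N.
Proof. by rewrite /merge; case: ifP. Qed.

Lemma potential_merge_le N f p q : (p < N)%N -> (q < N)%N ->
  (potential N (merge p q \o f) <= potential N f + 1)%N.
Proof.
move=> pN qN; have [->|pq] := eqVneq p q.
  rewrite (_ : merge q q \o f = f) ?leq_addr //.
  by apply/funext => x /=; rewrite /merge; case: eqP.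
have := potential_merge f pq pN qN.
have := pw_merge (label_count N f p) (label_count N f q); lia.
Qed.

Lemma cheapV t : cheap t -> cheap t^-1%g.
Proof.
move=> [N0 H]; exists N0 => N f N0N fN; have [phi [p1 p2 p3]] := H N f N0N fN.
by exists phi; split=> // x; rewrite -p2 symNVK.
Qed.

Lemma cheap_transposition x y t : is_transposition x y t -> cheap t.
Proof.
move=> [xy tE]; exists (idx x + idx y).+1 => N f NN fN.
have fx : (f x < N)%N by rewrite -[x]idxK fN //; lia.
have fy : (f y < N)%N by rewrite -[y]idxK fN //; lia.
exists (merge (f x) (f y)); split=> [v|z|]; first exact: merge_lt.
  rewrite tE /=; case: (eqVneq z x) => [->|_].
    by rewrite /merge eqxx; case: eqP.
  case: (eqVneq z y) => [->|//].
  by rewrite /merge eqxx; case: eqP.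
exact: potential_merge_le.
Qed.

Hypothesis pw_merge3 : forall a b d, (pw (a + b + d) <= pw a + pw b + pw d + 1)%N.

(** If two of the three labels already agree, a single merge suffices. If all differ, two merges
    taken separately would only give a cost of two, and [pw_merge3] bounds them jointly by one. *)
Lemma cheap_three_cycle x y z t : is_three_cycle x y z t -> cheap t.
Proof.
move=> [u tE]; exists (idx x + idx y + idx z).+1 => N f NN fN.
have fx : (f x < N)%N by rewrite -[x]idxK fN //; lia.
have fy : (f y < N)%N by rewrite -[y]idxK fN //; lia.
have fz : (f z < N)%N by rewrite -[z]idxK fN //; lia.
suff [phi [p1 p2 p3 p4]] : exists phi : nat -> nat, [/\ forall v, (v < N)%N -> (phi v < N)%N,
    phi (f y) = phi (f x), phi (f z) = phi (f x) &
    (potential N (phi \o f) <= potential N f + 1)%N].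
  exists phi; split=> // v; rewrite tE /=.
  case: (eqVneq v x) => [->|_]; first by rewrite p2.
  case: (eqVneq v y) => [->|_]; first by rewrite p2 p3.
  by case: (eqVneq v z) => [->|_] //; rewrite p3.
have m1 p q : merge p q q = p by rewrite /merge eqxx.
have m2 p q : merge p q p = p by rewrite /merge; case: eqP.
have [xy|xy] := eqVneq (f x) (f y).
  exists (merge (f x) (f z)); rewrite -xy m1 m2; split=> // [v|]; first exact: merge_lt.
  exact: potential_merge_le.
have [xz|xz] := eqVneq (f x) (f z).
  exists (merge (f x) (f y)); rewrite -xz m1 m2; split=> // [v|]; first exact: merge_lt.
  exact: potential_merge_le.
have [yz|yz] := eqVneq (f y) (f z).
  exists (merge (f x) (f y)); rewrite -yz m1 m2; split=> // [v|]; first exact: merge_lt.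
  exact: potential_merge_le.
exists (merge (f x) (f z) \o merge (f x) (f y)) => /=; split.
- by move=> v vN; apply/merge_lt/merge_lt.
- by rewrite m1 !m2.
- by rewrite [merge (f x) (f y) (f z)]/merge [f z == _]eq_sym (negbTE yz) m1 !m2.
have E1 := potential_merge f xy fx fy.
have E2 := potential_merge (merge (f x) (f y) \o f) xz fx fz.
rewrite !label_count_merge // eqxx [f z == f x]eq_sym (negbTE xz) [f z == f y]eq_sym (negbTE yz) in E2.
have E3 := pw_merge3 (label_count N f (f x)) (label_count N f (f y)) (label_count N f (f z)).
rewrite -[_ \o f]/(merge (f x) (f z) \o (merge (f x) (f y) \o f)); lia.
Qed.

(** The empty word starts from pairwise distinct labels, whose potential is 0 because [pw 1 = 0];
    each letter then costs at most one unit. *)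
Lemma cheap_labels n g : gen_word cheap n g -> exists N0, forall N, (N0 <= N)%N ->
  exists f, [/\ forall k, (k < N)%N -> (f (pos k) < N)%N, forall x, f (g x) = f x &
    (potential N f <= n)%N].
Proof.
move=> [w [<- Qw ->]] {n g}; elim: w Qw => [|t w IH] Qw.
  exists 0%N => N _; exists idx; split=> [k|x|]; rewrite ?big_nil //.
  rewrite leqn0 /potential sum_nat_eq0; apply/forallP => v; apply/implyP => _.
  by rewrite /label_count (eq_count (a2 := pred1 (v : nat))) // count_uniq_mem ?iota_uniq //; case: (_ \in _); rewrite ?pw0 ?pw1.
have [N1 H1] : cheap t by apply: Qw; apply: mem_head.
have {}/IH [N2 H2] : forall s : symN, s \in w -> cheap s by move=> s sw; apply: Qw; rewrite inE sw orbT.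
exists (N1 + N2)%N => N NN; have [|f [f1 f2 f3]] := H2 N; first by lia.
have [|phi [p1 p2 p3]] := H1 N f _ f1; first by lia.
exists (phi \o f); split=> [k kN|x|]; first by apply/p1/f1.
  by rewrite /= big_cons symNM p2 f2.
by rewrite (leq_trans p3) // addn1 ltnS.
Qed.

(** A labelling invariant under [g] is constant on each cycle, so every label class below [N]
    contains whole cycles, and superadditivity compares their weights with that of the class. *)
Lemma dec_lower_bound n g cs : gen_word cheap n g -> dec g cs ->
  (\sum_(c <- cs) pw (size c) <= n)%N.
Proof.
move=> /cheap_labels[N0 H] [ucs cy _].
pose N := (N0 + \sum_(x <- flatten cs) (idx x).+1)%N.
have [f [fN fg fn]] := H N (leq_addr _ _); apply: leq_trans fn.
have csN x : x \in flatten cs -> (idx x < N)%N.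
  move=> xc; rewrite /N (big_rem x) //=; lia.
pose cnt (s : seq posint) v := count (fun x => f x == v) s.
(* Cycles are added one by one; a new cycle enlarges only the block of its own label, by its full
   size. *)
have step ds : {subset ds <= cs} -> (\sum_(c <- ds) pw (size c) <= \sum_(v < N) pw (cnt (flatten ds) v))%N.
  elim: ds => [|c ds IH] sub; first by rewrite big_nil.
  have {}/IH IH : {subset ds <= cs} by move=> d dd; apply: sub; rewrite inE dd orbT.
  have ccs : c \in cs by apply: sub; apply: mem_head.
  rewrite big_cons; case: (posnP (size c)) => [/size0nil -> |c0]; first by rewrite pw0.
  have [x xc] : exists x, x \in c by case: (c) c0 => // x c' _; exists x; apply: mem_head.
  have fc y : y \in c -> f y = f x.
    move=> yc; have [i ->] := fcycle_traject (cy c ccs) xc yc.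
    by elim: i => //= i <-; rewrite fg.
  have xN : (f x < N)%N.
    by rewrite -[x]idxK fN // csN //; apply/flattenP; exists c.
  have cE v : cnt c v = if v == f x then size c else 0%N.
    rewrite /cnt; case: eqP => [->|vx]; first by apply/eqP; rewrite -all_count; apply/allP => y /fc /eqP.
    by apply/eqP; rewrite -leqn0 leqNgt -has_count; apply/hasPn => y /fc ->; apply/eqP => E; case: vx.
  rewrite (bigD1 (Ordinal xN)) //= /cnt count_cat -/(cnt c _) -/(cnt (flatten ds) _) cE eqxx.
  apply: (leq_trans (n := (pw (size c) + \sum_(v < N) pw (cnt (flatten ds) v))%N)).
    by rewrite leq_add2l.
  rewrite [in X in (X <= _)%N](bigD1 (Ordinal xN)) //= addnA leq_add ?pw_super //.
  by apply: leq_sum => v _; apply: pw_mono; rewrite count_cat leq_addl.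
apply: leq_trans (step cs _) _ => //; apply: leq_sum => v _; apply: pw_mono.
rewrite /cnt /label_count -!size_filter.
rewrite -(size_map pos [seq i <- _ | _]); apply: uniq_leq_size; first exact: filter_uniq.
move=> x; rewrite mem_filter => /andP[/eqP fx xc]; apply/mapP; exists (idx x); rewrite ?idxK //.
by rewrite mem_filter idxK fx eqxx mem_iota /= add0n csN.
Qed.
End Labels.

(** * Conjugacy lengths and classes *)

Local Close Scope group_scope.
Local Open Scope classical_set_scope.

(** Multisets of cycle lengths are encoded by multiplicity functions on a finite type, so that cycle
    types can be counted by a cardinal. *)
Definition lengths_of N B (m : {ffun 'I_N -> 'I_B}) : seq nat :=
  flatten [seq nseq (m i) i.+2 | i <- enum 'I_N].

Lemma is_min_uniq P a b : is_min P a -> is_min P b -> a = b.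
Proof. by move=> [Pa Ha] [Pb Hb]; apply/eqP; rewrite eqn_leq Ha ?Hb. Qed.

Lemma lengths_of_ge2 N B (m : {ffun 'I_N -> 'I_B}) : all (leq 2) (lengths_of m).
Proof.
apply/allP => k /flattenP[s /mapP[i _ ->]].
by rewrite mem_nseq => /andP[_ /eqP ->].
Qed.

Lemma count_lengths_of N B (m : {ffun 'I_N -> 'I_B}) p :
  count p (lengths_of m) = (\sum_(i < N) p i.+2 * m i)%N.
Proof.
rewrite /lengths_of count_flatten -map_comp sumnE big_map big_enum /=.
by apply: eq_bigr => i _; rewrite /= count_nseq.
Qed.

Lemma count_mem_lengths_of N B (m : {ffun 'I_N -> 'I_B}) (i : 'I_N) :
  count_mem i.+2 (lengths_of m) = m i.
Proof.
rewrite count_lengths_of (bigD1 i) //= eqxx mul1n big1 ?addn0 // => j /negbTE ji.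
by rewrite !eqSS val_eqE ji.
Qed.

Lemma sum_lengths_of N B (m : {ffun 'I_N -> 'I_B}) (F : nat -> nat) :
  (\sum_(k <- lengths_of m) F k = \sum_(i < N) F i.+2 * m i)%N.
Proof.
rewrite /lengths_of big_flatten big_map big_enum /=; apply: eq_bigr => i _.
by rewrite big_nseq iter_addn_0.
Qed.

Section Counting.
(** One count for both groups: [cl ls] is the conjugacy class of cycle type [ls], [par] selects the
    types that occur, and [pw] is the contribution of a cycle to the length. The bound [pw_ge1]
    keeps multiplicities at most [n], and [pw_bound] keeps cycle lengths at most [N + 1]. *)
Variables (G : groupType) (X : set G) (cl : seq nat -> set G).
Variables (par : pred (seq nat)) (pw : nat -> nat) (n N : nat).
Hypothesis cl_ex : forall ls, all (leq 2) ls -> par ls -> exists g, cl ls g.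
Hypothesis cl_class : forall ls g, all (leq 2) ls -> cl ls g -> conj_class g = cl ls.
Hypothesis cl_all : forall g, exists ls, [/\ all (leq 2) ls, par ls & cl ls g].
Hypothesis cl_inj : forall ls ls' g, all (leq 2) ls -> all (leq 2) ls' ->
  cl ls g -> cl ls' g -> perm_eq ls ls'.
Hypothesis cl_perm : forall ls ls', perm_eq ls ls' -> cl ls = cl ls'.
Hypothesis par_perm : forall ls ls', perm_eq ls ls' -> par ls = par ls'.
Hypothesis cl_len : forall ls g, all (leq 2) ls -> cl ls g ->
  conj_length X g (\sum_(k <- ls) pw k)%N.
Hypothesis pw_ge1 : forall k, (2 <= k)%N -> (1 <= pw k)%N.
Hypothesis pw_bound : forall k, (pw k <= n)%N -> (k <= N.+1)%N.

Let lam (m : {ffun 'I_N -> 'I_n.+1}) := lengths_of m.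
Let A := [set m : {ffun 'I_N -> 'I_n.+1} | par (lengths_of m) &&
  (\sum_(i < N) pw i.+2 * m i == n)%N]%SET.

Let cl_fun ls : all (leq 2) ls -> par ls -> (\sum_(k <- ls) pw k = n)%N ->
  exists2 m, m \in A & perm_eq (lam m) ls.
Proof.
move=> l2 pl sl; have cn i : (count_mem i.+2 ls < n.+1)%N.
  rewrite ltnS -sl; apply: leq_trans (count_size _ _) _.
  rewrite -sum1_size big_seq [X in (_ <= X)%N]big_seq; apply: leq_sum => k kl.
  by apply/pw_ge1/(allP l2).
have bound k : k \in ls -> (k <= N.+1)%N.
  by move=> kl; apply: pw_bound; rewrite -sl (big_rem k) //= leq_addr.
pose m : {ffun 'I_N -> 'I_n.+1} := [ffun i : 'I_N => Ordinal (cn i)].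
have pm : perm_eq (lam m) ls.
  apply/allP => k _ /=; apply/eqP; rewrite count_lengths_of.
  have [k0|k0] := boolP (2 <= k <= N.+1)%N.
    have kN : (k.-2 < N)%N by lia.
    rewrite (bigD1 (Ordinal kN)) //= ffunE /= big1 ?addn0; last first.
      by move=> i; rewrite -val_eqE /= => ik; case: (eqVneq i.+2 k) => // E; rewrite -E eqxx in ik.
    by rewrite (_ : k.-2.+2 = k) ?eqxx ?mul1n //; lia.
  rewrite big1 => [|i _]; last first.
    rewrite /=; case: (eqVneq i.+2 k) => // E; case/negP: k0; have := ltn_ord i; lia.
  apply/esym/eqP; rewrite -leqn0 leqNgt -has_count has_pred1; apply/negP => kl.
  by case/negP: k0; rewrite bound // andbT; apply: (allP l2).
exists m => //; rewrite inE (par_perm pm) pl /=.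
by rewrite -sum_lengths_of (perm_big _ pm) /= sl.
Qed.

Lemma gamma_count : gamma X n = #|A|.
Proof.
have inj : {in A &, injective (fun m => cl (lam m))}.
  move=> m m'; rewrite !inE => /andP[pm _] /andP[pm' _] E.
  have [g gm] := cl_ex (lengths_of_ge2 m) pm.
  have gm' : cl (lam m') g by rewrite -E.
  have := cl_inj (lengths_of_ge2 m) (lengths_of_ge2 m') gm gm' => /seq.permP P.
  apply/ffunP => i; apply/val_inj; have := P (pred1 i.+2).
  by rewrite !count_mem_lengths_of.
(* Listing the classes explicitly also proves that there are finitely many; [fset_set] would be
   empty on an infinite set. *)
rewrite /gamma; have -> : classes_of_length X n = [set` [fset C in [seq cl (lam m) | m <- enum A]]%fset].
  apply/seteqP; split=> C /=.
    move=> [[g ->] H]; have [ls [l2 pl lg]] := cl_all g.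
    have gg : conj_class g g by exists 1%g; rewrite mul1g invg1 mulg1.
    have sn := is_min_uniq (cl_len l2 lg) (H g gg).
    have [m mA pm] := cl_fun l2 pl sn.
    rewrite in_fset /= (cl_class l2 lg) -(cl_perm pm); apply/mapP; exists m => //.
    by rewrite mem_enum.
  rewrite in_fset /= => /mapP[m]; rewrite mem_enum inE => /andP[pm /eqP sm] ->.
  have [g gm] := cl_ex (lengths_of_ge2 m) pm; split.
    by exists g; rewrite (cl_class (lengths_of_ge2 m) gm).
  by move=> h hm; rewrite -[X in conj_length _ _ X]sm -sum_lengths_of; apply: cl_len => //; apply: lengths_of_ge2.
rewrite set_fsetK card_fseq undup_id ?size_map -?cardE //.
rewrite map_inj_in_uniq ?enum_uniq // => m m'; rewrite !mem_enum; exact: inj.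
Qed.
End Counting.

Local Open Scope group_scope.

(** * Conjugacy classes and their lengths in both groups *)

Definition cyc_type (ls : seq nat) : set symN :=
  [set h | exists2 cs, dec h cs & perm_eq (map size cs) ls].

Lemma cyc_type_ex g : exists2 ls, all (leq 2) ls & cyc_type ls g.
Proof. by have [cs [dg a2]] := dec_exists g; exists (map size cs) => //; exists cs. Qed.

Lemma cyc_type_perm ls ls' : perm_eq ls ls' -> cyc_type ls = cyc_type ls'.
Proof.
move=> p; apply/seteqP; split=> g [cs dg q]; exists cs => //; apply: perm_trans q _ => //.
by rewrite perm_sym.
Qed.

Lemma cyc_type_inj ls ls' g : all (leq 2) ls -> all (leq 2) ls' ->
  cyc_type ls g -> cyc_type ls' g -> perm_eq ls ls'.
Proof.
move=> l2 l2' [cs dg p] [ds dg' p'].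
have := dec_size_mono dg dg'; rewrite (perm_all _ p) (perm_all _ p') => /(_ l2 l2') q.
by apply: perm_trans p'; rewrite perm_sym in p; apply: perm_trans p q.
Qed.

Lemma perm_map_lift (T U : eqType) (f : T -> U) s t : perm_eq (map f s) t ->
  exists2 s', perm_eq s s' & map f s' = t.
Proof.
elim: t s => [|y t IH] s p.
  by exists [::] => //; move/perm_size: p; case: s.
have : y \in map f s by rewrite (perm_mem p) mem_head.
case/mapP=> x xs yE; have px := perm_to_rem xs.
have [|s' ps sE] := IH (rem x s).
  by rewrite -(perm_cons y) {1}yE -map_cons -(permPr p); apply: perm_map; rewrite perm_sym.
exists (x :: s'); last by rewrite /= sE yE.
by apply: perm_trans px _; rewrite perm_cons.
Qed.

Lemma cyc_type_conj ls g h : cyc_type ls g -> cyc_type ls h <-> exists z : symN, h = z * g * z^-1.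
Proof.
move=> [cs dg p]; split=> [[ds dh p']|[z ->]]; last first.
  exists (map (map z) cs); first exact: dec_conj.
  by rewrite -map_comp (eq_map (g := size)) // => c /=; rewrite size_map.
have q : perm_eq (map size ds) (map size cs) by rewrite (perm_trans p') // perm_sym.
have [ds' pd sd] := perm_map_lift q.
exact: (dec_conj_ex dg (dec_perm pd dh)).
Qed.

Lemma cyc_type_even ls g : all (leq 2) ls -> cyc_type ls g ->
  even_symN g = ~~ odd (\sum_(k <- ls) k.-1)%N.
Proof.
move=> l2 [cs dg p]; rewrite (even_dec dg).
  by rewrite (perm_big _ p).
by rewrite (perm_all _ p); apply: sub_all l2 => k; apply: leq_trans.
Qed.

Lemma cyc_type_lower (pw : nat -> nat) n g ls :
  pw 0%N = 0%N -> pw 1%N = 0%N -> (forall a b, pw a + pw b <= pw (a + b))%N ->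
  (forall a b, pw (a + b) <= pw a + pw b + 1)%N ->
  cyc_type ls g -> gen_word (cheap pw) n g -> (\sum_(k <- ls) pw k <= n)%N.
Proof.
move=> p0 p1 ps pm [cs dg p] w.
by rewrite -(perm_big _ p) big_map /=; apply: dec_lower_bound w dg.
Qed.

Section Lengths.
Variables (G : groupType).
Implicit Types (X : set G) (Q : G -> Prop).

Lemma conj_length_class X g h n : conj_class g h -> is_word X n h ->
  (forall m h', conj_class g h' -> is_word X m h' -> (n <= m)%N) -> conj_length X g n.
Proof.
move=> gh w H; split.
  by exists h => //; split => // m; apply: H.
by move=> m [h' gh' [w' _]]; apply: H gh' w'.
Qed.
End Lengths.

Lemma gen_word_sub (G : groupType) (Q Q' : G -> Prop) n g : (forall s, Q s -> Q' s) ->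
  gen_word Q n g -> gen_word Q' n g.
Proof. by move=> QQ [w [sw Qw gE]]; exists w; split=> // s /Qw /QQ. Qed.

Section Symmetric.
Variable S : set symN.
Hypotheses (CoxS : S_Cox `<=` S) (ST : S `<=` T_N).

Lemma sym_conj_class ls g : cyc_type ls g -> conj_class g = cyc_type ls.
Proof.
by move=> lg; apply/seteqP; split=> h /=; [apply: (cyc_type_conj h lg).2|apply: (cyc_type_conj h lg).1].
Qed.

Lemma sym_realized ls : all (leq 2) ls -> exists2 h, cyc_type ls h &
  is_word S (\sum_(k <- ls) k.-1)%N h.
Proof.
move=> l2; have l1 : all (leq 1) ls by apply: sub_all l2 => k; apply: leq_trans.
have [h [cs [wh dh sh _]]] := realized_coxeter l1 0%N; exists h.
  by exists cs; rewrite // sh.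
by apply: gen_word_sub wh => s [i si]; left; apply: CoxS; exists (pos i).
Qed.

Lemma sym_conj_length ls g : all (leq 2) ls -> cyc_type ls g ->
  conj_length S g (\sum_(k <- ls) k.-1)%N.
Proof.
move=> l2 lg; have [h lh wh] := sym_realized l2; have cg := sym_conj_class lg.
apply: (conj_length_class (h := h)) => //; first by rewrite cg.
move=> m h'; rewrite cg => lh' w; apply: (@cyc_type_lower predn _ h') => //; try by move=> a b; lia.
apply: gen_word_sub w => s [/ST[x [y /cheap_transposition]]|[t /ST[x [y /cheap_transposition H]] <-]].
  by apply=> // a b; lia.
by apply: cheapV; apply: H => // a b; lia.
Qed.

(** A cycle of length [i + 2] becomes a part [i + 1], so the classes of length [n] correspond to the
    partitions of [n]. *)
Lemma gamma_sym n : gamma S n =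
  #|[set m : {ffun 'I_n -> 'I_n.+1} | \sum_(i < n) i.+1 * m i == n]%SET|%N.
Proof.
rewrite (@gamma_count _ S cyc_type xpredT predn n n) //.
- by move=> ls /sym_realized[h lh _] _; exists h.
- by move=> ls g _; apply: sym_conj_class.
- by move=> g; have [ls l2 lg] := cyc_type_ex g; exists ls.
- exact: cyc_type_inj.
- exact: cyc_type_perm.
- exact: sym_conj_length.
- by case=> [|[|k]].
by case.
Qed.
End Symmetric.

Section Alternating.
Variable S : set altN.
Hypotheses (AS : S_A `<=` S) (ST : S `<=` T_A).

Definition alt_type (ls : seq nat) : set altN := [set h | cyc_type ls h].

Lemma altN_valM (g h : altN) : (g * h)%g = (g : symN) * h :> symN. Proof. by []. Qed.
Lemma altN_valV (g : altN) : (g^-1)%g = (g : symN)^-1 :> symN. Proof. by []. Qed.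
Lemma altN_val_prod (w : seq altN) :
  (\prod_(s <- w) s)%g = \prod_(s <- map altN_val w) s :> symN.
Proof. by elim: w => [|s w IH]; rewrite ?big_nil // /= !big_cons altN_valM IH. Qed.

Lemma altN_even (g : altN) : even_symN g. Proof. by case: g. Qed.

(** Classes do not split in the alternating group: an odd conjugator is made even by a transposition
    of two points beyond the support of [g], which commutes with [g]. *)
Lemma alt_conj_class ls g : alt_type ls g -> conj_class g = alt_type ls.
Proof.
move=> lg; apply/seteqP; split=> h /=.
  by move=> [z ->]; apply/(cyc_type_conj _ lg).2; exists z.
move=> /(cyc_type_conj _ lg).1[z hE].
suff [z' ez hz] : exists2 z' : symN, even_symN z' & h = z' * g * z'^-1 :> symN.
  by exists (AltN ez); apply/val_inj.
have [ez|oz] := boolP (even_symN z); first by exists z.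
have [k gk] := finite_symN_bound g.
have T : is_transposition (pos k) (pos k.+1) (transp (pos k) (pos k.+1)).
  by apply: transpP; rewrite (inj_eq pos_inj); lia.
exists (z * transp (pos k) (pos k.+1)).
  by rewrite evenM (negbTE oz) (even_transposition T).
rewrite hE invgM !mulgA; congr (_ * _).
set t := transp _ _ in T *.
rewrite -!mulgA; congr (_ * _); rewrite mulgA.
have -> : t * (g : symN) = (g : symN) * t; last by rewrite mulgK.
have [_ tE] := T; apply: symNP => x; rewrite !symNM !tE /=.
have g1 := gk k (leqnn _); have g2 := gk k.+1 (leqnSn _).
case: (eqVneq x (pos k)) => [->|x1]; first by rewrite g1 eqxx g2.
case: (eqVneq x (pos k.+1)) => [->|x2].
  by rewrite g2 (inj_eq pos_inj) eqxx g1; case: eqP => //; lia.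
have gx y : (g : symN) y = y -> ((g : symN) x == y) = (x == y).
  by move=> gy; rewrite -{1}gy (inj_eq (@symN_inj g)).
by rewrite !gx ?g1 ?g2 // (negbTE x1) (negbTE x2).
Qed.

Lemma three_gen_word_lift n (g : symN) : gen_word three_gen n g ->
  exists g' : altN, g = g' /\ is_word S n g'.
Proof.
move=> [w [<- Qw ->]]; suff [w' [wE Sw]] : exists w' : seq altN, map altN_val w' = w /\ forall s, s \in w' -> S s.
  exists (\prod_(s <- w') s); split; first by rewrite altN_val_prod wE.
  by exists w'; split=> //; [rewrite -wE size_map|move=> s /Sw; left].
elim: w Qw => [|s w IH] Qw; first by exists [::].
have [|w' [wE Sw]] := IH; first by move=> t tw; apply: Qw; rewrite inE tw orbT.
have [i Ti] : three_gen s by apply: Qw; apply: mem_head.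
exists (AltN (even_three_cycle Ti) :: w'); split; first by rewrite /= wE.
move=> t; rewrite inE => /orP[/eqP ->|]; last exact: Sw.
by apply: AS; exists (pos i).
Qed.

Definition even_type ls := ~~ odd (\sum_(k <- ls) k.-1)%N.

(** Evenness of the permutation makes the number of even lengths even, so these can be realized in
    pairs; odd lengths are realized one by one. *)
Lemma alt_realized ls : all (leq 2) ls -> even_type ls -> exists2 h, alt_type ls h &
  is_word S (\sum_(k <- ls) k./2)%N h.
Proof.
move=> l2 pl; pose ev := [seq k <- ls | ~~ odd k]; pose od := [seq k <- ls | odd k].
have pp : perm_eq (ev ++ od) ls by rewrite perm_sym -(perm_filterC odd ls) perm_catC perm_refl.
have oev : ~~ odd (size ev).
  move: pl; rewrite /even_type; suff -> : odd (\sum_(k <- ls) k.-1) = odd (size ev) by [].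
  rewrite /ev; elim: (ls) l2 => [|k s IH] /=; first by rewrite big_nil.
  case/andP=> k2 /IH E; rewrite big_cons oddD E; case: ifP => /= ok; lia.
have aev : all (fun k => ~~ odd k && (2 <= k)%N) ev.
  by apply/allP => k; rewrite mem_filter => /andP[-> kl]; apply: (allP l2).
have rev := realized_three_even aev oev.
have rod := realized_three_odd (filter_all odd ls).
have [h [cs [wh dh sh _]]] := realized_cat rev rod 0%N.
have [h' [hE wh']] := three_gen_word_lift wh; exists h'.
  by exists cs; rewrite -?hE // sh.
by rewrite -(perm_big _ pp) big_cat.
Qed.

Lemma alt_conj_length ls g : all (leq 2) ls -> alt_type ls g ->
  conj_length S g (\sum_(k <- ls) k./2)%N.
Proof.
move=> l2 lg; have pl : even_type ls by rewrite /even_type -(cyc_type_even l2 lg) altN_even.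
have [h lh wh] := alt_realized l2 pl; have cg := alt_conj_class lg.
apply: (conj_length_class (h := h)) => //; first by rewrite cg.
move=> m h'; rewrite cg => lh' w; apply: (@cyc_type_lower half _ h') => //; try by move=> a b; lia.
(* A conjugate of a 3-cycle is the 3-cycle on the images of its points, hence cheap wherever these
   lie. *)
have chT (t : altN) : T_A t -> cheap half t.
  move=> [z [s [[i Ti] ->]]].
  have : is_three_cycle (z i) (z (posS i)) (z (posS (posS i))) (z * s * z^-1 : altN).
    move: Ti => [u sE]; split.
      by rewrite -[[:: _; _; _]]/(map (z : symN) [:: i; posS i; posS (posS i)]) map_inj_uniq //; apply: symN_inj.
    move=> x; rewrite !altN_valM altN_valV !symNM sE /=.
    have zV y : (x == (z : symN) y) = ((z : symN)^-1%g x == y :> posint).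
      by rewrite -{1}[x](symNVK (z : symN)) (inj_eq (@symN_inj z)).
    rewrite !zV; do 3?[case: ifP => // _].
    by rewrite symNVK.
  by move/cheap_three_cycle; apply=> //; lia.
case: w => w [<- Qw ->]; exists (map altN_val w); split.
- by rewrite size_map.
- move=> _ /mapP[s /Qw Xs ->]; case: Xs => [/ST/chT //|[t /ST/chT ct <-]].
  by rewrite altN_valV; apply: cheapV.
exact: altN_val_prod.
Qed.

Lemma gamma_alt n : gamma S n =
  #|[set m : {ffun 'I_n.*2 -> 'I_n.+1} | even_type (lengths_of m) &&
     (\sum_(i < n.*2) i.+2./2 * m i == n)%N]%SET|.
Proof.
rewrite (@gamma_count _ S alt_type even_type half n n.*2) //.
- by move=> ls l2 pl; have [h lh _] := alt_realized l2 pl; exists h.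
- by move=> ls g _; apply: alt_conj_class.
- move=> g; have [ls l2 lg] := cyc_type_ex g; exists ls; split=> //.
  by rewrite /even_type -(cyc_type_even l2 lg) altN_even.
- by move=> ls ls' g l2 l2'; apply: cyc_type_inj.
- by move=> ls ls' p; rewrite /alt_type (cyc_type_perm p).
- by move=> ls ls' p; rewrite /even_type (perm_big _ p).
- exact: alt_conj_length.
- by move=> k k2; rewrite half_gt0.
by move=> k; lia.
Qed.
End Alternating.

Local Close Scope group_scope.
Local Close Scope classical_set_scope.

Import Order.TTheory GRing.Theory Num.Theory.
Local Open Scope ring_scope.

(** * Formal power series *)

Record fps (R : Type) := Fps { fcoef :> nat -> R }.

HB.instance Definition _ (R : Type) := gen_eqMixin (fps R).
HB.instance Definition _ (R : Type) := gen_choiceMixin (fps R).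

Lemma fpsP (R : Type) (f g : fps R) : f =1 g -> f = g.
Proof. by case: f g => f [g] /funext /= ->. Qed.

Section FpsRing.
Variable R : comNzRingType.
Implicit Types (f g h : fps R).

Definition fps_add f g := Fps (fun n => f n + g n).
Definition fps_zero : fps R := Fps (fun=> 0).
Definition fps_opp f := Fps (fun n => - f n).
Definition fps_mul f g := Fps (fun n => \sum_(i < n.+1) f i * g (n - i)%N).
Arguments fps_add : simpl never.
Arguments fps_opp : simpl never.
Arguments fps_mul : simpl never.
Definition fpsC (c : R) : fps R := Fps (fun n => if n == 0%N then c else 0).

Lemma fps_addA : associative fps_add.
Proof. by move=> f g h; apply: fpsP => n /=; rewrite addrA. Qed.
Lemma fps_addC : commutative fps_add.
Proof. by move=> f g; apply: fpsP => n /=; rewrite addrC. Qed.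
Lemma fps_add0 : left_id fps_zero fps_add.
Proof. by move=> f; apply: fpsP => n /=; rewrite add0r. Qed.
Lemma fps_addN : left_inverse fps_zero fps_opp fps_add.
Proof. by move=> f; apply: fpsP => n /=; rewrite addNr. Qed.

HB.instance Definition _ := GRing.isZmodule.Build (fps R)
  fps_addA fps_addC fps_add0 fps_addN.

(** A coefficient of a product depends only on truncations, so associativity and commutativity are
    inherited from polynomials. *)
Let tr N f : {poly R} := \poly_(i < N) f i.

Let trE N f i : (i < N)%N -> (tr N f)`_i = f i.
Proof. by move=> iN; rewrite coef_poly iN. Qed.

Let mul_tr N f g n : (n < N)%N -> fps_mul f g n = (tr N f * tr N g)`_n.
Proof.
move=> nN; rewrite coefM; apply: eq_bigr => -[i iN] _ /=.
by rewrite !trE //; lia.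
Qed.

Lemma fps_mulA : associative fps_mul.
Proof.
move=> f g h; apply: fpsP => n.
transitivity ((tr n.+1 f * tr n.+1 g * tr n.+1 h)`_n).
  rewrite -mulrA coefM; apply: eq_bigr => -[i iN] _ /=.
  by rewrite trE // -(mul_tr (N := n.+1)) //; lia.
rewrite coefM; apply: eq_bigr => -[i iN] _.
by rewrite [nat_of_ord _]/= (mul_tr f g iN) trE //; lia.
Qed.

Lemma fps_mulC : commutative fps_mul.
Proof.
by move=> f g; apply: fpsP => n; rewrite !(mul_tr _ _ (leqnn n.+1)) mulrC.
Qed.

Lemma fps_mul1 : left_id (fpsC 1) fps_mul.
Proof.
move=> f; apply: fpsP => n /=; rewrite big_ord_recl /= mul1r subn0.
by rewrite big1 ?addr0 // => i _; rewrite mul0r.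
Qed.

Lemma fps_mulDl : left_distributive fps_mul fps_add.
Proof.
move=> f g h; apply: fpsP => n /=; rewrite -big_split.
by apply: eq_bigr => i _; rewrite mulrDl.
Qed.

Lemma fps_oner_neq0 : fpsC 1 != 0.
Proof. by apply/eqP => /(congr1 (fun f : fps R => f 0%N)) /= /eqP; rewrite oner_eq0. Qed.

HB.instance Definition _ := GRing.Zmodule_isComNzRing.Build (fps R)
  fps_mulA fps_mulC fps_mul1 fps_mulDl fps_oner_neq0.

Lemma fpsD f g n : (f + g) n = f n + g n. Proof. by []. Qed.
Lemma fpsN f n : (- f) n = - f n. Proof. by []. Qed.
Lemma fpsB f g n : (f - g) n = f n - g n. Proof. by []. Qed.
Lemma fps0 n : (0 : fps R) n = 0. Proof. by []. Qed.
Lemma fps1 n : (1 : fps R) n = (n == 0%N)%:R. Proof. by case: n. Qed.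
Lemma fpsM f g n : (f * g) n = \sum_(i < n.+1) f i * g (n - i)%N. Proof. by []. Qed.
Lemma fps_sum I (r : seq I) (P : pred I) (F : I -> fps R) n :
  (\sum_(i <- r | P i) F i) n = \sum_(i <- r | P i) F i n.
Proof. by elim/big_rec2: _ => // i x y _ <-. Qed.
Lemma fpsM0 f g : (f * g) 0%N = f 0%N * g 0%N.
Proof. by rewrite fpsM big_ord_recl big_ord0 addr0. Qed.
Lemma fpsX0 f m : (f ^+ m) 0%N = f 0%N ^+ m.
Proof. by elim: m => // m IH; rewrite !exprS fpsM0 IH. Qed.

Lemma fpsC_mul c f n : (fpsC c * f) n = c * f n.
Proof. by rewrite fpsM big_ord_recl /= subn0 big1 ?addr0 // => i _; rewrite mul0r. Qed.

Lemma fpsCM c d : fpsC (c * d) = fpsC c * fpsC d.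
Proof. by apply: fpsP => n; rewrite fpsC_mul /=; case: eqP; rewrite ?mulr0. Qed.

Lemma fpsCX c m : fpsC (c ^+ m) = fpsC c ^+ m.
Proof. by elim: m => // m IH; rewrite !exprS fpsCM IH. Qed.

Lemma fpsMn f m n : (f *+ m) n = f n *+ m.
Proof. by elim: m => // m IH; rewrite !mulrS fpsD IH. Qed.

Lemma fpsC_nat m : fpsC m%:R = m%:R.
Proof. by apply: fpsP => n; rewrite fpsMn fps1 /=; case: eqP => // _; rewrite mul0rn. Qed.

Lemma fps_intrM (m : int) f n : (m%:~R * f) n = m%:~R * f n.
Proof.
by case: m => m; rewrite ?NegzE ?mulrNz ?mulNr ?fpsN -!pmulrn -fpsC_nat fpsC_mul.
Qed.

Lemma fps_natM (m : nat) f n : (m%:R * f) n = m%:R * f n.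
Proof. by rewrite -fpsC_nat fpsC_mul. Qed.

Lemma fps_signM k f n : ((-1) ^+ k * f) n = (-1) ^+ k * f n.
Proof.
elim: k f => [|k IH] f; first by rewrite !mul1r.
by rewrite exprSr -mulrA IH mulN1r fpsN exprSr -mulrA mulN1r.
Qed.

(* Congruence modulo [q ^ N]; [asbool] keeps it from unfolding to a product. *)
Definition eqm (N : nat) f g := `[< forall n, (n < N)%N -> f n = g n >].

Lemma eqmE N f g n : eqm N f g -> (n < N)%N -> f n = g n.
Proof. by move=> /asboolP; apply. Qed.
Lemma eqmI N f g : (forall n, (n < N)%N -> f n = g n) -> eqm N f g.
Proof. by move=> ?; apply/asboolP. Qed.
Lemma eqm_refl N f : eqm N f f. Proof. exact: eqmI. Qed.
Hint Resolve eqm_refl : core.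
Lemma eq_eqm N f g : f = g -> eqm N f g. Proof. by move=> ->. Qed.
Lemma eqm_sym N f g : eqm N f g -> eqm N g f.
Proof. by move=> fg; apply: eqmI => n /(eqmE fg). Qed.
Lemma eqm_trans N g f h : eqm N f g -> eqm N g h -> eqm N f h.
Proof. by move=> fg gh; apply: eqmI => n nN; rewrite (eqmE fg) ?(eqmE gh). Qed.
Lemma eqm_le M N f g : (M <= N)%N -> eqm N f g -> eqm M f g.
Proof.
by move=> MN fg; apply: eqmI => n nM; apply: (eqmE fg); apply: leq_trans MN.
Qed.
Lemma eqmP f g : (forall N, eqm N f g) -> f = g.
Proof. by move=> fg; apply: fpsP => n; apply: (eqmE (fg n.+1)). Qed.
Lemma eqmD N f f' g g' : eqm N f f' -> eqm N g g' -> eqm N (f + g) (f' + g').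
Proof.
by move=> Hf Hg; apply: eqmI => n nN; rewrite !fpsD (eqmE Hf) ?(eqmE Hg).
Qed.
Lemma eqmN N f f' : eqm N f f' -> eqm N (- f) (- f').
Proof. by move=> Hf; apply: eqmI => n nN; rewrite !fpsN (eqmE Hf). Qed.
Lemma eqmM N f f' g g' : eqm N f f' -> eqm N g g' -> eqm N (f * g) (f' * g').
Proof.
move=> Hf Hg; apply: eqmI => n nN; rewrite !fpsM.
by apply: eq_bigr => -[i iN] _ /=; rewrite (eqmE Hf) ?(eqmE Hg) //; lia.
Qed.
Lemma eqmX N f f' m : eqm N f f' -> eqm N (f ^+ m) (f' ^+ m).
Proof. by move=> H; elim: m => // m IH; rewrite !exprS; apply: eqmM. Qed.
Lemma eqm_prod N I (r : seq I) (P : pred I) (F G : I -> fps R) :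
  (forall i, P i -> eqm N (F i) (G i)) ->
  eqm N (\prod_(i <- r | P i) F i) (\prod_(i <- r | P i) G i).
Proof. by move=> H; elim/big_rec2: _ => // i x y Pi; apply: eqmM; apply: H. Qed.
Lemma eqm_sum N I (r : seq I) (P : pred I) (F G : I -> fps R) :
  (forall i, P i -> eqm N (F i) (G i)) ->
  eqm N (\sum_(i <- r | P i) F i) (\sum_(i <- r | P i) G i).
Proof. by move=> H; elim/big_rec2: _ => // i x y Pi; apply: eqmD; apply: H. Qed.

Lemma eqm_sum0 N I (r : seq I) (P : pred I) (F : I -> fps R) :
  (forall i, P i -> eqm N (F i) 0) -> eqm N (\sum_(i <- r | P i) F i) 0.
Proof.
move=> H; elim/big_ind: _ => // x y Hx Hy.
by rewrite -[X in eqm _ _ X]addr0; apply: eqmD.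
Qed.

(** If [u M.+1] agrees with [u M] below degree [M], then [u n.+1] is the first term whose
    coefficient of index [n] is already final. *)
Definition fps_lim (u : nat -> fps R) : fps R := Fps (fun n => u n.+1 n).

Lemma fps_limP (u : nat -> fps R) N :
  (forall M, eqm M (u M.+1) (u M)) -> eqm N (fps_lim u) (u N).
Proof.
move=> Hu; apply: eqmI => n nN /=; elim: N nN => // N IH; rewrite ltnS leq_eqVlt.
by case/orP => [/eqP -> //|nN]; rewrite IH // (eqmE (Hu N)).
Qed.

Definition fq : fps R := Fps (fun n => (n == 1%N)%:R).

Lemma fqM f n : (fq * f) n = if n is m.+1 then f m else 0.
Proof.
case: n => [|n]; first by rewrite fpsM0 mul0r.
rewrite fpsM big_ord_recl mul0r add0r big_ord_recl /= mul1r subn1 /=.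
by rewrite big1 ?addr0 // => i _; rewrite mul0r.
Qed.

Lemma fqXM m f n : (fq ^+ m * f) n = if (m <= n)%N then f (n - m)%N else 0.
Proof.
elim: m n => [|m IH] n; first by rewrite expr0 mul1r subn0.
by rewrite exprS -mulrA fqM; case: n.
Qed.

Lemma fqX m n : (fq ^+ m) n = (n == m)%:R.
Proof. by rewrite -[fq ^+ m]mulr1 fqXM fps1 subn_eq0 eqn_leq; case: leqP; rewrite ?andbF // andbT. Qed.

Lemma eqm_fqX N m f : (N <= m)%N -> eqm N (fq ^+ m * f) 0.
Proof. by move=> Nm; apply: eqmI => n nN; rewrite fqXM leqNgt (leq_trans nN Nm). Qed.

Lemma eqm_fqXM m N f g :
  eqm (m + N) (fq ^+ m * f) (fq ^+ m * g) <-> eqm N f g.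
Proof.
split=> H; apply: eqmI => n nN.
  by have := eqmE H (n := n + m); rewrite !fqXM leq_addl addnK; apply; lia.
by rewrite !fqXM; case: leqP => // mn; apply: (eqmE H); lia.
Qed.

Lemma eqm_fq1 N m : (N <= m)%N -> eqm N (1 - fq ^+ m) 1.
Proof.
by move=> Nm; apply: eqmI => n nN; rewrite fpsB fqX; case: eqP => [E|]; rewrite ?subr0 //; lia.
Qed.

Lemma eqm0_fqX N f : eqm N f 0 -> exists g, f = fq ^+ N * g.
Proof.
move=> H; exists (Fps (fun n => f (n + N)%N)); apply: fpsP => n.
by rewrite fqXM /=; case: leqP => [Nn|/(eqmE H) //]; rewrite subnK.
Qed.

(** The inverse is the geometric series in [1 - f], which converges because [1 - f] is divisible by
    [q]. *)
Lemma fps_inv_ex f : f 0%N = 1 -> exists g, g * f = 1.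
Proof.
move=> f0; set h := 1 - f.
have [k hk] : exists k, h = fq * k.
  have [|k ->] := @eqm0_fqX 1 h; last by exists k.
  by apply: eqmI => -[|//] _; rewrite /h fpsB fps1 f0 subrr.
pose u N := \sum_(i < N) h ^+ i.
have uS M : eqm M (u M.+1) (u M).
  rewrite /u big_ord_recr /= -[X in eqm _ _ X]addr0; apply: eqmD => //.
  by rewrite hk exprMn; apply: eqm_fqX.
exists (fps_lim u); apply: eqmP => N.
apply: eqm_trans (eqmM (fps_limP N uS) (eqm_refl N f)) _.
have -> : u N * f = 1 - fq ^+ N * k ^+ N.
  have fh : f = 1 - h by rewrite /h opprB addrC subrK.
  rewrite -exprMn -hk -[RHS]opprB subrX1 -/(u N) fh; ring.
rewrite -[X in eqm _ _ X]subr0; apply: eqmD => //; apply: eqmN.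
exact: eqm_fqX.
Qed.

(** The inverse is chosen classically; these instances lead to the integral domain structure, which
    provides the cancellations used below. *)
Definition fps_unit : {pred fps R} := fun f => `[< exists g, g * f = 1 >].
Definition fps_inv f : fps R :=
  if pselect (exists g, g * f = 1) is left e then projT1 (cid e) else f.

Lemma fps_mulVx : {in fps_unit, left_inverse 1 fps_inv *%R}.
Proof.
move=> f /asboolP fu; rewrite /fps_inv; case: pselect => // e.
by case: (cid e).
Qed.
Lemma fps_unitPl f g : g * f = 1 -> fps_unit f.
Proof. by move=> gf; apply/asboolP; exists g. Qed.
Lemma fps_inv_out : {in [predC fps_unit], fps_inv =1 id}.
Proof.
by move=> f /asboolP fu; rewrite /fps_inv; case: pselect.
Qed.

HB.instance Definition _ := GRing.ComNzRing_hasMulInverse.Build (fps R)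
  fps_mulVx fps_unitPl fps_inv_out.

End FpsRing.

Arguments fq {R}.

Section FpsDomain.
Variable R : idomainType.

Lemma fps_domain : GRing.integral_domain_axiom (fps R).
Proof.
move=> f g fg0; apply/norP => -[/eqP f0 /eqP g0].
have ex (h : fps R) : h <> 0 -> exists k, h k != 0 /\ forall n, (n < k)%N -> h n = 0.
  move=> h0; have e : exists k, h k != 0.
    apply/not_existsP => H; apply: h0; apply: fpsP => n.
    by have /negP := H n; rewrite negbK => /eqP.
  case: (ex_minnP e) => k hk Hk; exists k; split => // n nk.
  by apply/eqP; apply: contraLR nk => /Hk; rewrite -leqNgt.
have [a [fa Ha]] := ex f f0; have [b [gb Hb]] := ex g g0.
have := congr1 (fun h : fps R => h (a + b)%N) fg0; rewrite fps0.
have lt_a : (a < (a + b).+1)%N by lia.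
rewrite fpsM (bigD1 (Ordinal lt_a)) //= addKn big1 ?addr0.
  by move/eqP; rewrite mulf_eq0 (negbTE fa) (negbTE gb).
move=> [i iN] /=; rewrite -val_eqE /= => ia.
by case: (ltnP i a) => [/Ha -> | ai]; rewrite ?mul0r // Hb ?mulr0 //; lia.
Qed.

HB.instance Definition _ := GRing.ComUnitRing_isIntegral.Build (fps R) fps_domain.
End FpsDomain.

#[local] Hint Resolve eqm_refl : core.

(** * Sections, dilations and twists of power series *)

Section Operators.
Variable R : comNzRingType.
Implicit Types (f g h : fps R) (l r s : nat).

(* [fpsV l f] is [f (q ^ l)], [fpsU l] extracts the coefficients of the
   [q ^ (l n)], and [fpsT w f] is [f (w q)]. *)
Definition fpsV l f := Fps (fun n => if (l %| n)%N then f (n %/ l)%N else 0).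
Definition fpsU l f := Fps (fun n => f (l * n)%N).
Definition fpsT (w : R) f := Fps (fun n => w ^+ n * f n).
Definition fpsK l r f := Fps (fun n => if n == r %[mod l] then f n else 0).

Lemma fpsVE l f n : fpsV l f n = if (l %| n)%N then f (n %/ l)%N else 0.
Proof. by []. Qed.
Lemma fpsUE l f n : fpsU l f n = f (l * n)%N. Proof. by []. Qed.
Lemma fpsTE w f n : fpsT w f n = w ^+ n * f n. Proof. by []. Qed.
Lemma fpsKE l r f n : fpsK l r f n = if n == r %[mod l] then f n else 0.
Proof. by []. Qed.

Lemma sum_dvdn (F : nat -> R) l n : (0 < l)%N ->
  \sum_(i < (l * n).+1) (if (l %| i)%N then F i else 0) =
  \sum_(j < n.+1) F (l * j)%N.
Proof.
case: l => // l _; elim: n => [|n IH].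
  by rewrite muln0 !big_ord_recl !big_ord0 /= muln0.
rewrite [RHS]big_ord_recr -IH /=.
have -> : (l.+1 * n.+1).+1 = ((l.+1 * n).+1 + l).+1 by lia.
rewrite big_ord_recr big_split_ord /= [X in _ + X + _]big1 ?addr0.
  have -> : ((l.+1 * n).+1 + l)%N = (l.+1 * n.+1)%N by lia.
  by rewrite dvdn_mulr.
move=> [i il] _ /=; case: dvdnP => // -[k E]; exfalso.
have : (l.+1 * n < k * l.+1 < l.+1 * n.+1)%N by lia.
by rewrite [(l.+1 * n)%N]mulnC [(l.+1 * n.+1)%N]mulnC !ltn_pmul2r // ltnS; lia.
Qed.

Lemma fpsV_is_additive l : zmod_morphism (fpsV l).
Proof.
by move=> f g; apply: fpsP => n; rewrite fpsB /=; case: ifP; rewrite ?subr0.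
Qed.

Lemma fpsV_is_multiplicative l : monoid_morphism (fpsV l).
Proof.
split.
  apply: fpsP => n.
  transitivity (if (l %| n)%N then (1 : fps R) (n %/ l)%N else 0) => //.
  rewrite !fps1; case: n => [|n]; first by rewrite dvdn0 div0n.
  case: dvdnP => // -[k]; case: l => [|l] E; first by rewrite muln0 in E.
  by rewrite E mulnK // muln_eq0 orbF.
move=> f g; apply: fpsP => n; case: l => [|l].
  (* For [l = 0] only the constant coefficient survives, because [0 %| n] forces [n = 0]. *)
  rewrite fpsVE dvd0n; case: n => [|n]; first by rewrite !fpsM0.
  rewrite [LHS]/= fpsM big1 // => -[i ilt] _; rewrite !fpsVE !dvd0n /=.
  by case: i ilt => [|i] _; rewrite ?mul0r // subn0 mulr0.
rewrite fpsVE; case: dvdnP => [[m ->]|H]; last first.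
  rewrite fpsM big1 // => -[i ilt] _ /=.
  case: ifP => [di|_]; last by rewrite mul0r.
  case: ifP => [di'|_]; last by rewrite mulr0.
  by case: H; apply/dvdnP; move: (dvdn_add di di'); rewrite subnKC.
rewrite mulnK // [RHS]fpsM mulnC.
transitivity (\sum_(i < (l.+1 * m).+1) (if (l.+1 %| i)%N then
    f (i %/ l.+1)%N * g ((l.+1 * m - i) %/ l.+1)%N else 0)).
  rewrite (sum_dvdn (fun i => f (i %/ l.+1)%N * g ((l.+1 * m - i) %/ l.+1)%N)) //.
  rewrite fpsM; apply: eq_bigr => i _.
  by rewrite mulKn // -mulnBr mulKn.
apply: eq_bigr => -[i ilt] _ /=; case: ifP => di; last by rewrite mul0r.
by rewrite dvdn_sub ?dvdn_mulr.
Qed.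

HB.instance Definition _ l :=
  GRing.isZmodMorphism.Build (fps R) (fps R) (fpsV l) (fpsV_is_additive l).
HB.instance Definition _ l :=
  GRing.isMonoidMorphism.Build (fps R) (fps R) (fpsV l) (fpsV_is_multiplicative l).

Lemma fpsU_is_additive l : zmod_morphism (fpsU l).
Proof. by move=> f g; apply: fpsP. Qed.
HB.instance Definition _ l :=
  GRing.isZmodMorphism.Build (fps R) (fps R) (fpsU l) (fpsU_is_additive l).

Lemma fpsUD l f g : fpsU l (f + g) = fpsU l f + fpsU l g.
Proof. exact: raddfD. Qed.
Lemma fpsU_natM l m f : fpsU l (m%:R * f) = m%:R * fpsU l f.
Proof. by rewrite !mulr_natl raddfMn. Qed.

Lemma fpsK_is_additive l r : zmod_morphism (fpsK l r).
Proof.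
by move=> f g; apply: fpsP => n; rewrite fpsB /=; case: ifP; rewrite ?subr0.
Qed.
HB.instance Definition _ l r :=
  GRing.isZmodMorphism.Build (fps R) (fps R) (fpsK l r) (fpsK_is_additive l r).

Lemma fpsT_is_additive w : zmod_morphism (fpsT w).
Proof. by move=> f g; apply: fpsP => n; rewrite fpsB /= mulrBr. Qed.
Lemma fpsT_is_multiplicative w : monoid_morphism (fpsT w).
Proof.
split; first by apply: fpsP => -[|n]; rewrite fpsTE !fps1 ?mul1r ?mulr0.
move=> f g; apply: fpsP => n; rewrite fpsTE !fpsM mulr_sumr.
apply: eq_bigr => -[i ilt] _ /=; rewrite -{1}(subnKC (n := n) (m := i)) //.
by rewrite exprD; ring.
Qed.
HB.instance Definition _ w :=
  GRing.isZmodMorphism.Build (fps R) (fps R) (fpsT w) (fpsT_is_additive w).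
HB.instance Definition _ w :=
  GRing.isMonoidMorphism.Build (fps R) (fps R) (fpsT w) (fpsT_is_multiplicative w).

(** This projection formula turns an equation for [F] with coefficients in [fpsV l t] into a
    recurrence for the series [fpsU l (F ^+ a)] with coefficients in [t]. *)
Lemma fpsU_mulV l f g : (0 < l)%N -> fpsU l (f * fpsV l g) = fpsU l f * g.
Proof.
move=> l0; apply: fpsP => n; rewrite fpsUE [f * _]mulrC [_ * g]mulrC !fpsM.
transitivity (\sum_(i < (l * n).+1) (if (l %| i)%N then
    g (i %/ l)%N * f (l * n - i)%N else 0)).
  by apply: eq_bigr => i _ /=; case: ifP => // _; rewrite mul0r.
rewrite (sum_dvdn (fun i => g (i %/ l)%N * f (l * n - i)%N)) //.
by apply: eq_bigr => i _; rewrite mulKn //= mulnBr.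
Qed.

Lemma fpsUV l f : (0 < l)%N -> fpsU l (fpsV l f) = f.
Proof.
move=> l0; rewrite -[fpsV l f]mul1r fpsU_mulV // -[RHS]mul1r; congr (_ * _).
by apply: fpsP => n; rewrite fpsUE !fps1 muln_eq0; case: l l0.
Qed.

Lemma fpsVV l m f : (0 < l)%N -> fpsV l (fpsV m f) = fpsV (l * m) f.
Proof.
move=> l0; apply: fpsP => n /=.
have [/dvdnP[k ->]|H] := boolP (l %| n)%N.
  by rewrite mulnK // [(k * l)%N]mulnC dvdn_pmul2l // divnMl.
by case: ifP => // H'; rewrite (dvdn_trans _ H') ?dvdn_mulr in H.
Qed.

Lemma fpsV_q l : (0 < l)%N -> fpsV l fq = fq ^+ l :> fps R.
Proof.
move=> l0; apply: fpsP => n; rewrite fqX /=.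
have [/dvdnP[k ->]|H] := boolP (l %| n)%N.
  by rewrite mulnK // -{2}[l]mul1n eqn_pmul2r.
by case: eqP H => // ->; rewrite dvdnn.
Qed.

Lemma eqmV l N f g : eqm N f g -> eqm N (fpsV l f) (fpsV l g).
Proof.
move=> fg; apply: eqmI => n nN /=; case: ifP => // _; apply: (eqmE fg).
exact: leq_ltn_trans (leq_div n l) nN.
Qed.

Lemma eqmT w N f g : eqm N f g -> eqm N (fpsT w f) (fpsT w g).
Proof. by move=> fg; apply: eqmI => n nN /=; rewrite (eqmE fg). Qed.

Lemma fpsT_q w : fpsT w fq = fpsC w * fq.
Proof. by apply: fpsP => -[|[|n]]; rewrite fpsC_mul /= ?mulr0 ?expr1. Qed.

Definition inclass l r f := `[< forall n, f n != 0 -> n == r %[mod l] >].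

Lemma inclassE l r f n : inclass l r f -> n != r %[mod l] -> f n = 0.
Proof. by move=> /asboolP H; apply: contraNeq => /H. Qed.

Lemma inclassI l r f : (forall n, n != r %[mod l] -> f n = 0) -> inclass l r f.
Proof.
by move=> H; apply/asboolP => n; apply: contraNT => /H ->.
Qed.

Lemma inclassM l r s f g :
  inclass l r f -> inclass l s g -> inclass l (r + s) (f * g).
Proof.
move=> Hf Hg; apply: inclassI => n Hn; rewrite fpsM big1 // => -[i ilt] _ /=.
have [fi|fi] := boolP (i == r %[mod l]); last by rewrite (inclassE Hf fi) mul0r.
have [gi|gi] := boolP (n - i == s %[mod l])%N; last by rewrite (inclassE Hg gi) mulr0.
move: Hn; rewrite -(subnKC (n := n) (m := i)) //.
by rewrite -modnDm (eqP fi) (eqP gi) modnDm eqxx.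
Qed.

Lemma inclass1 l : inclass l 0 1.
Proof. by apply: inclassI => -[|n]; rewrite ?eqxx // fps1. Qed.

Lemma inclassX l r f m : inclass l r f -> inclass l (m * r) (f ^+ m).
Proof.
move=> Hf; elim: m => [|m IH]; first exact: inclass1.
by rewrite exprS mulSn; apply: inclassM.
Qed.

Lemma inclassD l r f g : inclass l r f -> inclass l r g -> inclass l r (f + g).
Proof.
move=> Hf Hg; apply: inclassI => n Hn.
by rewrite fpsD (inclassE Hf Hn) (inclassE Hg Hn) addr0.
Qed.

Lemma inclassN l r f : inclass l r f -> inclass l r (- f).
Proof. by move=> Hf; apply: inclassI => n Hn; rewrite fpsN (inclassE Hf Hn) oppr0. Qed.

Lemma inclassC l c : inclass l 0 (fpsC c).
Proof. by apply: inclassI => -[|n] //=; rewrite eqxx. Qed.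

Lemma inclass0 l r : inclass l r 0. Proof. exact: inclassI. Qed.

Lemma inclass_nat l m : inclass l 0 (m%:R : fps R).
Proof. by rewrite -fpsC_nat; apply: inclassC. Qed.

Lemma inclassV l f : inclass l 0 (fpsV l f).
Proof. by apply: inclassI => n /=; rewrite mod0n -[_ == _]/(dvdn l n) => /negbTE ->. Qed.

Lemma inclass_q l : inclass l 1 fq.
Proof. by apply: inclassI => n /=; case: (n =P 1%N) => // ->; rewrite eqxx. Qed.

Lemma inclassK l r f : inclass l r (fpsK l r f).
Proof. by apply: inclassI => n /= /negbTE ->. Qed.

Lemma inclass_mod l r s f : r = s %[mod l] -> inclass l r f -> inclass l s f.
Proof. by move=> E H; apply: inclassI => n; rewrite -E; apply: inclassE. Qed.

Lemma fpsK_id l r f : inclass l r f -> fpsK l r f = f.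
Proof.
by move=> H; apply: fpsP => n /=; case: ifP => // /negbT /(inclassE H).
Qed.

Lemma fpsK_0 l r s f : inclass l s f -> r != s %[mod l] -> fpsK l r f = 0.
Proof.
move=> H rs; apply: fpsP => n /=; case: ifP => // /eqP nr.
by apply: (inclassE H); rewrite nr.
Qed.

Lemma fpsT_inclass w l r f : w ^+ l = 1 -> inclass l r f ->
  fpsT w f = fpsC (w ^+ r) * f.
Proof.
move=> w1 H; apply: fpsP => n; rewrite fpsC_mul /=.
have [nr|/(inclassE H) ->] := boolP (n == r %[mod l]); last by rewrite !mulr0.
congr (_ * _); rewrite (divn_eq n l) (divn_eq r l) (eqP nr).
by rewrite !exprD ![(_ * l)%N]mulnC !exprM w1 !expr1n.
Qed.

Lemma fpsK_sum l f : (0 < l)%N -> f = \sum_(r < l) fpsK l r f.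
Proof.
move=> l0; apply: fpsP => n; rewrite fps_sum.
rewrite (bigD1 (Ordinal (ltn_pmod n l0))) //= modn_mod eqxx big1 ?addr0 // => i.
rewrite -val_eqE /= => /negbTE ni; rewrite (modn_small (ltn_ord i)) eq_sym ni //.
Qed.

End Operators.

Section Map.
Variables (R S : comNzRingType) (phi : {rmorphism R -> S}).

Definition fps_map (f : fps R) : fps S := Fps (fun n => phi (f n)).

Lemma fps_mapE f n : fps_map f n = phi (f n). Proof. by []. Qed.

Lemma fps_map_is_additive : zmod_morphism fps_map.
Proof. by move=> f g; apply: fpsP => n; rewrite fpsB /= rmorphB. Qed.
Lemma fps_map_is_multiplicative : monoid_morphism fps_map.
Proof.
split; first by apply: fpsP => n; rewrite fps_mapE !fps1 rmorph_nat.
move=> f g; apply: fpsP => n; rewrite fps_mapE !fpsM rmorph_sum.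
by apply: eq_bigr => i _ /=; rewrite rmorphM.
Qed.
HB.instance Definition _ :=
  GRing.isZmodMorphism.Build (fps R) (fps S) fps_map fps_map_is_additive.
HB.instance Definition _ :=
  GRing.isMonoidMorphism.Build (fps R) (fps S) fps_map fps_map_is_multiplicative.

Lemma fps_map_q : fps_map fq = fq.
Proof. by apply: fpsP => n /=; rewrite rmorph_nat. Qed.

Lemma fps_mapV l f : fps_map (fpsV l f) = fpsV l (fps_map f).
Proof. by apply: fpsP => n /=; case: ifP; rewrite ?rmorph0. Qed.

Lemma inclass_map l r f : inclass l r f -> inclass l r (fps_map f).
Proof. by move=> H; apply: inclassI => n /(inclassE H) /= ->; rewrite rmorph0. Qed.

Lemma fps_map_inj : injective phi -> injective fps_map.
Proof.
by move=> ip f g /(congr1 (@fcoef _)) /= fg; apply: fpsP => n; apply/ip/(congr1 (@^~ n) fg).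
Qed.

End Map.

(** * Euler's and Jacobi's identities *)

Lemma double_bin2 k : (2 * 'C(k.+1, 2) = k.+1 * k)%N.
Proof. by rewrite bin2 /= mul2n even_halfK // oddM /= andNb. Qed.

Section Euler.
Variable R : comNzRingType.
Implicit Types (f g h : fps R) (m n k s : nat).

Local Notation q := (fq : fps R).

Definition fin_euler n : fps R := \prod_(i < n) (1 - q ^+ i.+1).
Definition euler : fps R := fps_lim fin_euler.

Local Notation P := fin_euler.
Local Notation E := euler.

Lemma fin_eulerS n : P n.+1 = P n * (1 - q ^+ n.+1).
Proof. by rewrite /P big_ord_recr. Qed.

Lemma fin_euler_eqm m n : (m <= n)%N -> eqm m (P n) (P m).
Proof.
move=> /subnK <-; elim: (n - m)%N => [|d IH]; first exact: eqm_refl.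
rewrite addSn fin_eulerS -[P m]mulr1; apply: eqmM IH _.
by apply: eqm_fq1; lia.
Qed.

Lemma euler_eqm m n : (m <= n)%N -> eqm m E (P n).
Proof.
move=> mn; apply: eqm_le mn _; apply: fps_limP => M.
exact: fin_euler_eqm (leqnSn M).
Qed.

Lemma euler0 : E 0%N = 1.
Proof. by rewrite (eqmE (euler_eqm (leqnn 1))) // /P big_ord1 fpsB fps1 fqX subr0. Qed.

Definition pent n : fps R := 1 + \sum_(s < n)
  (-1) ^+ s.+1 * (q ^+ (s.+1 ^ 2 + 'C(s.+1, 2)) + q ^+ (s.+1 ^ 2 + 'C(s.+2, 2))).

Let Q n k : fps R := \prod_(k <= i < n) (1 - q ^+ i.+1).
Let T n k : fps R := (-1) ^+ k * Q n k * q ^+ (k * n + 'C(k.+1, 2)).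
Let G n k : fps R := (-1) ^+ k * Q n k * q ^+ (k.+1 * n.+1 + 'C(k.+1, 2)).

Let QS n k : (k <= n)%N -> Q n.+1 k = Q n k * (1 - q ^+ n.+1).
Proof. by move=> kn; rewrite /Q big_nat_recr. Qed.

Let QT n k : (k < n)%N -> Q n k = (1 - q ^+ k.+1) * Q n k.+1.
Proof. by move=> kn; rewrite /Q big_ltn. Qed.

(** Passing from [n] to [n + 1] in all terms telescopes to the boundary term [G n m]. At [m = n]
    this is one of the two new pentagonal terms; the other is [T n.+1 n.+1]. *)
Let sumT n m : (m <= n)%N ->
  \sum_(k < m.+1) T n.+1 k = \sum_(k < m.+1) T n k - G n m.
Proof.
elim: m => [|m IH] mn.
  rewrite !big_ord_recl !big_ord0 /T /G /= QS // !mul0n !add0n !mul1n.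
  by rewrite bin_small // addn0 expr0; ring.
rewrite big_ord_recr [in RHS]big_ord_recr /= IH 1?ltnW // /T /G QS //.
rewrite (QT mn).
have -> : (m.+1 * n.+1 + 'C(m.+1, 2) = m.+1 * n + 'C(m.+2, 2))%N.
  by rewrite [in RHS]binS bin1; lia.
have -> : (m.+2 * n.+1 + 'C(m.+2, 2) = n.+1 + m.+1 + (m.+1 * n + 'C(m.+2, 2)))%N by lia.
have -> : (m.+1 * n.+1 + 'C(m.+2, 2) = m.+1 + (m.+1 * n + 'C(m.+2, 2)))%N by lia.
by rewrite !exprD !exprS; ring.
Qed.

(* Shanks' finite form of the pentagonal number theorem. *)
Lemma shanks n : \sum_(k < n.+1) T n k = pent n.
Proof.
elim: n => [|n IH].
  rewrite big_ord_recl !big_ord0 /T /Q big_geq // /pent big_ord0 mul0n bin_small //.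
  by rewrite !expr0; ring.
rewrite big_ord_recr /= sumT // IH /pent [in RHS]big_ord_recr /=.
rewrite /T /G /Q !big_geq // !mulnn.
rewrite !exprS; ring.
Qed.

Lemma euler_pent n : eqm n E (pent n).
Proof.
apply: eqm_trans (euler_eqm (leqnn n)) _.
rewrite -shanks big_ord_recl -[X in eqm _ X _]addr0; apply: eqmD.
  rewrite /T /Q /= mul0n bin_small // expr0 mulr1 mul1r /P.
  by rewrite big_mkord.
apply/eqm_sym/eqm_sum0 => -[i ilt] _ /=; rewrite /T mulrC /=.
by apply: eqm_fqX; rewrite /bump /=; lia.
Qed.

(** Completing the square: an exponent [m = k (3 k - 1) / 2] or [m = k (3 k + 1) / 2] satisfies
    [24 m + 1 = (6 k - 1)^2] or [(6 k + 1)^2]. Here [k = s + 1]. *)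
Lemma pent_coef0 n m : (forall a, (a <= 6 * n + 1)%N -> (a ^ 2 != 24 * m + 1)%N) ->
  pent n m = 0.
Proof.
move=> H; rewrite /pent fpsD fps1 fps_sum big1 ?addr0.
  by case: eqP => // m0; have := H 1%N; rewrite m0; case: eqP => // _; lia.
move=> [s sn] _; rewrite fps_signM [nat_of_ord _]/=.
have bs := double_bin2 s; have bs2 := double_bin2 s.+1.
rewrite fpsD !fqX; case: eqP => [E1|_].
  by have /eqP := H (6 * s + 5)%N ltac:(lia); nia.
case: eqP => [E1|_]; last by rewrite addr0 mulr0.
by have /eqP := H (6 * s + 7)%N ltac:(lia); nia.
Qed.

(** For [a = 6 k - 1] and for [a = 6 k + 1] alike, the quotient of [a + 1] by 6 is the index [k]
    that carries the sign. *)
Lemma pent_coef n m a : (a ^ 2 = 24 * m + 1)%N -> (a <= 6 * n + 1)%N ->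
  pent n m = (-1) ^+ ((a + 1) %/ 6).
Proof.
move=> am; elim: n => [|n IH] an.
  have {am an} [-> ->] : (a = 1%N) /\ (m = 0%N) by split; nia.
  by rewrite /pent big_ord0 addr0 fps1.
have S1 : pent n.+1 = pent n + (-1) ^+ n.+1 *
    (q ^+ (n.+1 ^ 2 + 'C(n.+1, 2)) + q ^+ (n.+1 ^ 2 + 'C(n.+2, 2))).
  by rewrite /pent big_ord_recr /= addrA.
have bs := double_bin2 n; have bs2 := double_bin2 n.+1.
rewrite S1 fpsD fps_signM.
have [an'|an'] := leqP a (6 * n + 1).
  rewrite IH // fpsD !fqX; do 2![case: eqP => [?|_]; first nia].
  by rewrite addr0 mulr0 addr0.
rewrite pent_coef0 ?add0r; last by move=> b bn; apply/eqP; nia.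
have a6 : ((a %% 6) ^ 2 = 1 %[mod 6])%N by rewrite modnXm am; lia.
have : a = (6 * n + 5)%N \/ a = (6 * n + 7)%N.
  have : (a %% 6 < 6)%N by rewrite ltn_mod.
  move: a6; case E: (a %% 6)%N => [|[|[|[|[|[|]]]]]] // _ _; lia.
move=> [aE|aE].
  have -> : ((a + 1) %/ 6 = n.+1)%N by rewrite aE; lia.
  rewrite fpsD !fqX; case: eqP => [_|]; last nia.
  by case: eqP => [?|_]; [nia|rewrite addr0 mulr1].
have -> : ((a + 1) %/ 6 = n.+1)%N by rewrite aE; lia.
rewrite fpsD !fqX; case: eqP => [?|_]; first nia.
by case: eqP => [_|]; [rewrite add0r mulr1|nia].
Qed.

Lemma euler_coef m a : (a ^ 2 = 24 * m + 1)%N -> E m = (-1) ^+ ((a + 1) %/ 6).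
Proof.
move=> am; rewrite (eqmE (euler_pent (a + m).+1)); last by lia.
by apply: pent_coef => //; lia.
Qed.

Lemma euler_coef0 m : (forall a, (a ^ 2 != 24 * m + 1)%N) -> E m = 0.
Proof.
by move=> H; rewrite (eqmE (euler_pent m.+1)) // pent_coef0.
Qed.

End Euler.

(** * Gaussian binomials and the finite form of Jacobi's identity *)

Section QBinomial.
Variables (R : comNzRingType) (q : R).

Fixpoint qbin n k : R :=
  match n, k with
  | _, 0 => 1
  | 0, _.+1 => 0
  | n'.+1, k'.+1 => qbin n' k'.+1 + q ^+ (n' - k') * qbin n' k'
  end.

Definition qfact n : R := \prod_(i < n) (1 - q ^+ i.+1).

Lemma qbin0 n : qbin n 0 = 1. Proof. by case: n. Qed.

Lemma qbinS n k : qbin n.+1 k.+1 = qbin n k.+1 + q ^+ (n - k) * qbin n k.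
Proof. by []. Qed.

Lemma qbin_small n k : (n < k)%N -> qbin n k = 0.
Proof.
elim: n k => [|n IH] [|k] //= nk.
by rewrite !IH ?mulr0 ?addr0 //; lia.
Qed.

Lemma qfactS n : qfact n.+1 = qfact n * (1 - q ^+ n.+1).
Proof. by rewrite /qfact big_ord_recr. Qed.

Lemma qfact0 : qfact 0 = 1. Proof. by rewrite /qfact big_ord0. Qed.

Lemma qbin_qfact n k :
  (k <= n)%N -> qbin n k * qfact k * qfact (n - k) = qfact n.
Proof.
elim: n k => [|n IH] [|k] //.
- by rewrite qfact0 !mulr1.
- by rewrite qbin0 qfact0 !mul1r.
rewrite ltnS => kn; rewrite qbinS subSS; have IHk := IH _ kn.
move: kn; rewrite leq_eqVlt => /orP[/eqP Ekn|kn].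
  move: IHk; rewrite Ekn subnn (qbin_small (ltnSn n)) qfactS => IHn.
  by rewrite -[in RHS]IHn qfact0 expr0; ring.
have IHk1 := IH _ kn.
have E : (n - k = (n - k.+1).+1)%N by lia.
have -> : qfact n.+1 = qfact n * (1 - q ^+ (n - k)) + qfact n * q ^+ (n - k) * (1 - q ^+ k.+1).
  by rewrite qfactS (_ : n.+1 = (n - k) + k.+1)%N ?exprD; [ring | lia].
rewrite -[X in _ = X * (1 - _) + _]IHk1 -[X in _ = _ + X * _ * _]IHk E !qfactS -E; ring.
Qed.

(** The morphism [phi] allows [z] to be a polynomial indeterminate over the ring of [q]; Jacobi's
    identity is obtained by differentiating in it. *)
Lemma gauss_binomial (S : comNzRingType) (phi : {rmorphism R -> S}) (y z : S) n :
  \prod_(i < n) (y + z * phi q ^+ i) =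
  \sum_(j < n.+1) phi (q ^+ 'C(j, 2) * qbin n j) * z ^+ j * y ^+ (n - j).
Proof.
elim: n => [|n IH].
  by rewrite big_ord0 big_ord_recl big_ord0 /= !expr0 !mulr1 addr0 rmorph1.
rewrite big_ord_recr /= IH mulrDr [X in X + _]big_distrl [X in _ + X]big_distrl /=.
rewrite [in X in X + _]big_ord_recl [RHS]big_ord_recl /= !qbin0 !subn0 -addrA.
congr (_ + _); first by rewrite !expr0 !mulr1 exprSr mulrA.
rewrite [X in _ + X]big_ord_recr /= [RHS]big_ord_recr /= addrA; congr (_ + _); last first.
  rewrite (qbin_small (ltnSn n)) add0r !subnn !expr0 add0n !rmorphM /=.
  by rewrite binS bin1 exprD !rmorphM !rmorphXn rmorph1 /= !exprS; ring.
rewrite -big_split /=; apply: eq_bigr => -[i ilt] _ /=; rewrite /bump /= add0n add1n.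
rewrite subSS (_ : (n - i = (n - i.+1).+1)%N); last by lia.
have -> : phi q ^+ n = phi q ^+ i * phi q ^+ (n - i.+1).+1.
  by rewrite -exprD; congr (_ ^+ _); lia.
by rewrite binS bin1 !(rmorphM, rmorphD, rmorphXn) /= !exprD !exprS; ring.
Qed.
End QBinomial.

Arguments qbin : simpl never.

Section Jacobi.
Variable R : comNzRingType.
Local Notation q := (fq : fps R).
Local Notation E := (euler R).
Local Notation P := (qfact q).
Implicit Types (m n k : nat).

(** The product of the [q ^ n - X q ^ i] over [i < 2 n + 1] is expanded by [gauss_binomial] and
    differentiated at [X = 1]. The factor [i = n] vanishes there, so only the term differentiating
    it survives. *)
Let jac_sum n :
  (-1) ^+ n.+1 * q ^+ (n + 'C(n, 2) + n * n) * P n ^+ 2 =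
  \sum_(j < (n.+1 + n).+1)
     j%:R * (-1) ^+ j * q ^+ ('C(j, 2) + n * (n.+1 + n - j)) * qbin q (n.+1 + n) j.
Proof.
pose c := (q ^+ n)%:P; pose fac i : {poly fps R} := c - 'X * (q ^+ i)%:P.
have facE i : (fac i).[1] = q ^+ n - q ^+ i by rewrite /fac /c !hornerE.
have dfac : (fac n)^`().[1] = - q ^+ n.
  by rewrite /fac /c derivB derivC derivM derivX derivC !hornerE; ring.
have gb := gauss_binomial q (polyC : {rmorphism _ -> _}) c (- 'X) (n.+1 + n).
have {gb} : \prod_(i < n.+1 + n) fac i =
    \sum_(j < (n.+1 + n).+1)
     ((-1) ^+ j * q ^+ ('C(j, 2) + n * (n.+1 + n - j)) * qbin q (n.+1 + n) j) *: 'X^j.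
  transitivity (\prod_(i < n.+1 + n) (c + - 'X * q%:P ^+ i)).
    by apply: eq_bigr => i _; rewrite /fac rmorphXn mulNr.
  rewrite gb; apply: eq_bigr => j _; rewrite -mul_polyC /c.
  rewrite [(- 'X) ^+ _]exprNn exprD exprM !rmorphM !rmorphXn /= polyCN polyC1; ring.
clearbody fac; move/(congr1 (fun p : {poly fps R} => p^`().[1])).
rewrite big_split_ord big_ord_recr /= !derivM !(hornerD, hornerM) dfac.
have -> : (fac n).[1] = 0 by rewrite facE subrr.
rewrite !mulr0 !mul0r !addr0 add0r.
rewrite !horner_prod.
have -> : \prod_(i < n) (fac (widen_ord (leqnSn n) i)).[1] = (-1) ^+ n * q ^+ 'C(n, 2) * P n.
  rewrite (eq_bigr (fun i : 'I_n => q ^+ n - q ^+ i)); last by move=> i _; rewrite facE.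
  elim: n {c fac facE dfac} => [|m IH]; first by rewrite qfact0 !big_ord0 !mul1r.
  rewrite big_ord_recl (eq_bigr (fun i : 'I_m => q * (q ^+ m - q ^+ i))); last first.
    by move=> i _; rewrite mulrBr -!exprS.
  rewrite big_split prodr_const card_ord /= IH qfactS binS bin1 exprD expr0 [(-1) ^+ m.+1]exprS; ring.
have -> : \prod_(i < n) (fac (n.+1 + i)%N).[1] = q ^+ (n * n) * P n.
  rewrite (eq_bigr (fun i : 'I_n => q ^+ n * (1 - q ^+ i.+1))); last first.
    by move=> i _; rewrite facE mulrBr mulr1 -exprD addnS addSn.
  by rewrite big_split prodr_const card_ord /= exprM.
rewrite raddf_sum horner_sum => H.
rewrite (eq_bigr (fun j : 'I__ => ((-1) ^+ j * q ^+ ('C(j, 2) + n * (n.+1 + n - j)) *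
   qbin q (n.+1 + n) j) * j%:R)); last by move=> j _; ring.
transitivity ((-1) ^+ n * q ^+ 'C(n, 2) * P n * - q ^+ n * (q ^+ (n * n) * P n)).
  by rewrite !exprD exprS; ring.
rewrite H; apply: eq_bigr => j _.
by rewrite /= derivZ hornerZ derivXn hornerMn hornerXn expr1n.
Qed.

Let qbin_euler n k m : (k <= n)%N -> (m <= k)%N -> (m <= n - k)%N ->
  eqm m (E * qbin q n k) 1.
Proof.
move=> kn mk mnk.
have Em i : (m <= i)%N -> eqm m E (P i) by move=> ?; apply: euler_eqm.
have H : eqm m (E * qbin q n k * E) (1 * E).
  rewrite mul1r; apply: eqm_trans (eqm_sym (Em n _)); last exact: leq_trans kn.
  rewrite -(qbin_qfact q kn) [E * _]mulrC.
  by apply: eqmM; [apply: eqmM => //|]; apply: Em.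
have [g gE] := fps_inv_ex (euler0 R).
have := eqmM H (eqm_refl m g); rewrite mul1r -!mulrA ![E * g]mulrC gE.
by rewrite mulr1.
Qed.

(** After multiplication by [E], each Gaussian binomial in [jac_sum] may be replaced by 1 to the
    precision needed. The common power [q ^ e] is the lowest exponent on the right and is cancelled
    at the end. *)
Lemma jacobi n :
  eqm n (E ^+ 3) (\sum_(k < n.+1) (-1) ^+ k * (2 * k + 1)%:R * q ^+ 'C(k.+1, 2)).
Proof.
pose e := (n + 'C(n, 2) + n * n)%N.
have bn := double_bin2 n; have b2n : (n + 'C(n, 2) = 'C(n.+1, 2))%N by rewrite binS bin1 addnC.
pose X j := ('C(j, 2) + n * (n.+1 + n - j))%N.
have Xl k : (k <= n)%N -> X (n - k)%N = (e + 'C(k.+1, 2))%N.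
  move=> kn; rewrite /X /e; case: (n - k)%N (subnKC kn) => [|m] E1.
    by rewrite bin_small //; have := double_bin2 k; nia.
  have -> : (n.+1 + n - m.+1 = n + k + 1)%N by lia.
  by have := double_bin2 k; have := double_bin2 m; move: bn b2n; rewrite -E1; lia.
have Xr k : (k <= n)%N -> X (n.+1 + k)%N = (e + 'C(k.+1, 2))%N.
  move=> kn; rewrite /X /e addSn; have := double_bin2 k; have := double_bin2 (n + k).
  by have : (n.+1 + n - (n + k).+1 = n - k)%N by [lia]; nia.
have bk k : (k <= 'C(k.+1, 2))%N by have := double_bin2 k; nia.
have H : eqm (e + n) ((-1) ^+ n.+1 * q ^+ e * (P n ^+ 2 * E))
   (\sum_(j < (n.+1 + n).+1) j%:R * (-1) ^+ j * q ^+ X j).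
  rewrite mulrA jac_sum big_distrl /=; apply: eqm_sum => -[j jn] _ /=.
  rewrite -!mulrA; do 2![apply: eqmM => //]; rewrite [_ * E]mulrC -[X in eqm _ _ X]mulr1 -/(X j).
  have [k kn [Xk jk]] : exists2 k, (k <= n)%N &
      X j = (e + 'C(k.+1, 2))%N /\ (n - k <= j <= n.+1 + k)%N.
    have [jn'|jn'] := leqP j n.
      by exists (n - j)%N; rewrite ?leq_subr // -Xl ?leq_subr // subKn //; lia.
    by exists (j - n.+1)%N; [lia|rewrite -Xr ?subnKC //; lia].
  apply: (@eqm_le _ _ (X j + (n - k))%N); first by rewrite Xk; have := bk k; lia.
  by apply/eqm_fqXM; apply: qbin_euler; lia.
have {H} : eqm (e + n) (q ^+ e * (P n ^+ 2 * E)) (q ^+ e *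
     \sum_(k < n.+1) (-1) ^+ k * (2 * k + 1)%:R * q ^+ 'C(k.+1, 2)).
  have -> : q ^+ e * (P n ^+ 2 * E) = (-1) ^+ n.+1 * ((-1) ^+ n.+1 * q ^+ e * (P n ^+ 2 * E)).
    by rewrite -!mulrA signrMK.
  apply: eqm_trans (eqmM (eqm_refl _ _) H) _.
  (* The terms [j = n - k] and [j = n + 1 + k] have the same exponent and opposite signs, so their
     weights combine to [(n + 1 + k) - (n - k) = 2 k + 1]. *)
  rewrite -addnS big_split_ord /= [X in _ * (X + _)](reindex_inj rev_ord_inj) /= -big_split !big_distrr /=.
  apply: eqm_sum => -[k kn] _ /=; rewrite subSS Xl // Xr //.
  rewrite exprD; set u := q ^+ e; set v := q ^+ _.
  pose d := (n - k)%N; have dk : n = (d + k)%N by rewrite subnK.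
  apply: eq_eqm; rewrite -/d (_ : n.+1 = (d + k).+1); last by rewrite -dk.
  rewrite !(exprS, exprD, addSn) [(2 * k + 1)%:R]natrD natrM.
  rewrite (_ : (d + k + k).+1%:R = d%:R + 2%:R * k%:R + 1 :> fps R); last first.
    by rewrite -natrM -natrD natr1; congr _%:R; lia.
  set s := (-1) ^+ d; set t := (-1) ^+ k; set w := d%:R; set x := k%:R.
  have ss : s * s = 1 by rewrite -expr2 sqrr_sign.
  have tt : t * t = 1 by rewrite -expr2 sqrr_sign.
  transitivity (u * v * t * (s * s) * (w * (t * t - 1) + 2 * x * (t * t) + t * t)).
    ring.
  rewrite ss tt; ring.
move/eqm_fqXM; apply: eqm_trans; rewrite exprSr; apply: eqmM => //.
by apply: eqmX; apply: euler_eqm.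
Qed.
End Jacobi.

(** The class of a monomial is inferred from its factors into an existential variable; [inclass_tac]
    then compares it by computation with the class wanted. *)
Ltac inclass_mono :=
  lazymatch goal with
  | |- is_true (inclass _ _ (@GRing.mul _ _ _)) => eapply inclassM; inclass_mono
  | |- is_true (inclass _ _ (@GRing.exp _ _ _)) => eapply inclassX; inclass_mono
  | |- is_true (inclass _ _ (@GRing.natmul _ 1 _)) => eapply inclass_nat
  | |- is_true (inclass _ _ (@GRing.opp _ _)) => eapply inclassN; inclass_mono
  | |- _ => eassumption
  end.
Ltac inclass_tac :=
  lazymatch goal with
  | |- is_true (inclass _ _ (@GRing.add _ _ _)) => apply inclassD; inclass_tac
  | |- is_true (inclass _ _ (@GRing.opp _ _)) => apply inclassN; inclass_tac
  | |- is_true (inclass _ _ (@GRing.zero _)) => apply inclass0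
  | |- _ => eapply inclass_mod; cycle 1; [inclass_mono | reflexivity]
  end.

Section Coefficients.
Variable R : comNzRingType.
Local Notation q := (fq : fps R).
Local Notation E := (euler R).

Lemma jacobi_coef m k : ((2 * k + 1) ^ 2 = 8 * m + 1)%N ->
  (E ^+ 3) m = (-1) ^+ k * (2 * k + 1)%:R.
Proof.
move=> km; have mk : (k < (m + k).+2)%N by lia.
rewrite (eqmE (jacobi R (m + k).+1)) ?ltnS ?leq_addr // fps_sum.
have co i : ((-1) ^+ i * (2 * i + 1)%:R * q ^+ 'C(i.+1, 2)) m =
   (-1) ^+ i * (2 * i + 1)%:R * (m == 'C(i.+1, 2))%:R.
  by rewrite -mulrA fps_signM fps_natM fqX mulrA.
rewrite (bigD1 (Ordinal mk)) // big1 ?addr0; last first.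
  move=> [i ilt]; rewrite -val_eqE [val _]/= [val _]/= => ik.
  rewrite co [nat_of_ord _]/=; case: eqP => [mi|]; last by rewrite mulr0.
  by case/eqP: ik; have := double_bin2 i; nia.
rewrite [LHS]addr0 co [nat_of_ord _]/= (_ : (m == _) = true) ?mulr1 //.
by apply/eqP; have := double_bin2 k; nia.
Qed.

Lemma jacobi_coef0 m : (forall b, (b ^ 2 != 8 * m + 1)%N) -> (E ^+ 3) m = 0.
Proof.
move=> H; rewrite (eqmE (jacobi R m.+1)) // fps_sum big1 // => -[i ilt] _.
rewrite [nat_of_ord _]/= -mulrA fps_signM fps_natM fqX; case: eqP => [mi|]; last by rewrite !mulr0.
have /eqP[] := H (2 * i + 1)%N; have := double_bin2 i; nia.
Qed.
End Coefficients.

Lemma sq_eq_dvdn (l a m d : nat) : prime l -> coprime l d -> (l %| m)%N ->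
  (a ^ 2 = d * m + l ^ 2)%N -> (exists b, a = l * b)%N /\ (l ^ 2 %| m)%N.
Proof.
move=> pl cl lm am.
have la : (l %| a)%N.
  have : (l %| a ^ 2)%N by rewrite am dvdn_add ?dvdn_mull // dvdn_exp.
  by rewrite Euclid_dvdX // andbT.
have : (l ^ 2 %| d * m)%N.
  have : (l ^ 2 %| a ^ 2)%N by rewrite dvdn_exp2r.
  by rewrite am dvdn_addl.
rewrite Gauss_dvdr ?coprimeXl // => ->; split=> //.
by case/dvdnP: la => b ->; exists b; rewrite mulnC.
Qed.

Section Classes.
Variable R : comNzRingType.
Local Notation q := (fq : fps R).
Local Notation E := (euler R).

Let sq_mod l a b c d n r : (0 < l)%N -> (n = r %[mod l])%N ->
  all (fun x => x ^ 2 %% l != (d * r + c) %% l)%N (iota 0 l) ->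
  b = (d * n + c)%N -> (a ^ 2 != b)%N.
Proof.
move=> l0 nr /allP H ->; apply/eqP => an.
have := H (a %% l)%N; rewrite mem_iota ltn_mod l0 => /(_ isT) /eqP[].
by rewrite modnXm an -modnDml -modnMmr nr modnMmr modnDml.
Qed.

(** Exponents of [E] make [24 n + 1] a square, so a residue class where [24 r + 1] is not a square
    modulo [l] is empty; this is a finite check. *)
Lemma euler_class0 l r : (0 < l)%N ->
  all (fun x => x ^ 2 %% l != (24 * r + 1) %% l)%N (iota 0 l) -> fpsK l r E = 0.
Proof.
move=> l0 H; apply: fpsP => n; rewrite fpsKE; case: eqP => // nr.
by apply: euler_coef0 => a; apply: sq_mod l0 nr H _.
Qed.

Lemma jacobi_class0 l r : (0 < l)%N ->
  all (fun x => x ^ 2 %% l != (8 * r + 1) %% l)%N (iota 0 l) -> fpsK l r (E ^+ 3) = 0.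
Proof.
move=> l0 H; apply: fpsP => n; rewrite fpsKE; case: eqP => // nr.
by apply: jacobi_coef0 => a; apply: sq_mod l0 nr H _.
Qed.

(* [n = delta] mod [l] exactly when [l] divides [24 n + 1]; the square root of
   [24 n + 1] is then [l] times that of [24 m + 1]. *)
Lemma euler_class_delta l delta : prime l -> (24 * delta + 1 = l ^ 2)%N ->
  (delta < l)%N -> (l %% 12 = 5 \/ l %% 12 = 7)%N ->
  fpsK l delta E = - (q ^+ delta * fpsV (l ^ 2) E).
Proof.
move=> pl dl dltl l12; have l0 := prime_gt0 pl.
have l20 : (0 < l ^ 2)%N by rewrite expn_gt0 l0.
have cl : coprime l 24.
  rewrite -(coprime_pexpl _ _ (ltn0Sn 1)) -dl coprime_sym /coprime.
  by rewrite mulnC gcdnMDl gcdn1.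
apply: fpsP => n; rewrite fpsKE fpsN fqXM.
case: eqP => [nd|nd]; last first.
  case: ifP => [dn|_]; last by rewrite oppr0.
  rewrite fpsVE; case: ifP => [/dvdnP[k nk]|_]; last by rewrite oppr0.
  by case: nd; rewrite -(subnK dn) nk -modnDml expnS mulnCA modnMr.
have dn : (delta <= n)%N.
  by rewrite (divn_eq n l) nd (modn_small dltl) leq_addl.
have ldn : (l %| n - delta)%N by rewrite -eqn_mod_dvd // nd.
have En : (24 * n + 1 = 24 * (n - delta) + l ^ 2)%N.
  by rewrite -{1}(subnK dn) -dl; lia.
rewrite dn fpsVE; case: ifP => [/dvdnP[m mn]|H]; last first.
  rewrite oppr0; apply: euler_coef0 => a; apply/eqP => an.
  by have [] := sq_eq_dvdn pl cl ldn (etrans an En); rewrite H.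
rewrite mn mulnK //.
have [[b bm]|nb] := pselect (exists b, b ^ 2 = 24 * m + 1)%N; last first.
  rewrite !euler_coef0 ?oppr0 // => a; apply/eqP => am; first by apply: nb; exists a.
  have [[b ab] _] := sq_eq_dvdn pl cl ldn (etrans am En).
  apply: nb; exists b; apply/eqP; rewrite -(eqn_pmul2l l20).
  by rewrite -expnMn -ab am En mn; lia.
rewrite (euler_coef R bm) (@euler_coef _ _ (l * b)); last first.
  by rewrite expnMn bm En mn; lia.
(* The minus sign arises because the quotients of [l b + 1] and [b + 1] by 6 have opposite parities
   when [l] is 5 or 7 modulo 12 and [b] is 1 or 5 modulo 6. *)
rewrite -signr_odd -[in RHS]signr_odd -signrN; congr (_ ^+ _).
have b6 : (b %% 6 = 1 \/ b %% 6 = 5)%N.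
  have : ((b %% 6) ^ 2 = 1 %[mod 6])%N by rewrite modnXm bm; lia.
  have : (b %% 6 < 6)%N by rewrite ltn_mod.
  by case: (b %% 6)%N => [|[|[|[|[|[|]]]]]] //; auto.
congr (nat_of_bool _).
have [k bk] : exists k, b = (6 * k + b %% 6)%N by exists (b %/ 6)%N; lia.
have [k' lk] : exists k', l = (12 * k' + l %% 12)%N by exists (l %/ 12)%N; lia.
have -> : ((l * b + 1) %/ 6)%N = (2 * k' * b + (l %% 12 * b + 1) %/ 6)%N.
  by rewrite -divnMDl //; congr (_ %/ 6)%N; rewrite {1}lk; lia.
rewrite oddD !oddM /= bk.
by case: b6 => ->; case: l12 => -> /=; lia.
Qed.
End Classes.

(** * The 5-dissection *)

Lemma fpsK_sorted (R : comNzRingType) (l r : nat) (f : fps R) (G : seq (fps R)) :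
  (r < l)%N -> f = \sum_(s < l) G`_s -> (forall s, (s < l)%N -> inclass l s G`_s) ->
  fpsK l r f = G`_r.
Proof.
move=> rl -> HG; rewrite raddf_sum (bigD1 (Ordinal rl)) //= fpsK_id ?HG //.
rewrite big1 ?addr0 // => -[s sl]; rewrite -val_eqE /= => sr.
by rewrite (fpsK_0 (HG s sl)) // !modn_small // eq_sym.
Qed.

Lemma fpsU_qK (R : comNzRingType) (l r d : nat) (f : fps R) : (0 < l)%N ->
  (l %| d + r)%N -> fpsU l (fq ^+ d * f) = fpsU l (fq ^+ d * fpsK l r f).
Proof.
move=> l0 dr; apply: fpsP => n; rewrite !fpsUE !fqXM fpsKE; case: ifP => // dn.
have -> : (l * n - d == r %[mod l])%N; last by [].
rewrite -(eqn_modDr d) subnK // modnMr eq_sym addnC; exact: dr.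
Qed.

(** For [c = 1], [A = 1 / R], [B = - R] this is the classical relation between [1 / R - 1 - R] and
    [1 / R^5 - 11 - R^5] for the Rogers-Ramanujan continued fraction. *)
Lemma quintic_identity (R : comNzRingType) (A B c : R) : A * B = - c ^+ 2 ->
  let x := A + B - c in
  x * (x ^+ 4 + 5%:R * (c * x ^+ 3) + 15%:R * (c ^+ 2 * x ^+ 2) +
   25%:R * (c ^+ 3 * x) + 25%:R * c ^+ 4) = A ^+ 5 + B ^+ 5 - 11%:R * c ^+ 5.
Proof.
move=> AB x; rewrite /x {x}.
transitivity (A ^+ 5 + B ^+ 5 - 11%:R * c ^+ 5 + (5%:R * B*c^+2 +10%:R*A*B^+2
  +5%:R*B^+3 +5%:R*A*c^+2 +10%:R*A^+2*B +5%:R*A^+3) * (A * B + c ^+ 2)); first by ring.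
by rewrite AB addNr mulr0 addr0.
Qed.

Section Five.
Local Notation q := (fq : fps int).
Local Notation E := (euler int).

Definition A5 := fpsK 5 0 E.
Definition B5 := fpsK 5 2 E.
Definition c5 := q * fpsV 25 E.

Lemma A5_class : inclass 5 0 A5. Proof. exact: inclassK. Qed.
Lemma B5_class : inclass 5 2 B5. Proof. exact: inclassK. Qed.
Lemma c5_class : inclass 5 1 c5.
Proof.
apply: (@inclass_mod _ _ (1 + 0)) => //; apply: inclassM; first exact: inclass_q.
by rewrite (_ : 25 = 5 * 5)%N // -fpsVV //; apply: inclassV.
Qed.

Lemma euler5 : E = A5 + B5 - c5.
Proof.
rewrite {1}(fpsK_sum (l := 5) E) // !big_ord_recr big_ord0 /= add0r.
rewrite (@euler_class_delta _ 5 1) //; last by left.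
rewrite (@euler_class0 _ 5 3) // (@euler_class0 _ 5 4) // /A5 /B5 /c5 expr1.
ring.
Qed.

Lemma A5_neq0 : A5 != 0.
Proof.
by apply/eqP => /(congr1 (fun f : fps int => f 0%N)); rewrite /A5 fpsKE eqxx euler0.
Qed.

(** [E^3] has no exponents of class 2 modulo 5, since 17 is not a square there. In the expansion of
    [(A + B - c)^3] that class is [3 A (A B + c^2)], and [A] is nonzero. *)
Lemma A5B5 : A5 * B5 = - c5 ^+ 2.
Proof.
have cA := A5_class; have cB := B5_class; have cc := c5_class.
have : fpsK 5 2 (E ^+ 3) = 0 by apply: jacobi_class0.
rewrite (fpsK_sorted (G := [:: A5 ^+ 3 - 3%:R * (B5 ^+ 2 * c5); 
   - 3%:R * (A5 ^+ 2 * c5) + B5 ^+ 3; 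
   3%:R * (A5 ^+ 2 * B5) + 3%:R * (A5 * c5 ^+ 2);
   - 6%:R * (A5 * B5 * c5) - c5 ^+ 3; 
   3%:R * (A5 * B5 ^+ 2) + 3%:R * (B5 * c5 ^+ 2)])) //; first last.
- by do 5?[case=> [_|] /=; first by inclass_tac].
- by rewrite !big_ord_recr big_ord0 /= euler5; ring.
move=> /= H; have : 3%:R * A5 * (A5 * B5 + c5 ^+ 2) == 0 by rewrite -H; apply/eqP; ring.
rewrite mulf_eq0 mulf_eq0 (negbTE A5_neq0) orbF => /orP[/eqP H3|].
  by have := congr1 (fun f : fps int => f 0%N) H3; rewrite fpsMn fps1.
by rewrite addr_eq0 => /eqP.
Qed.

Lemma modeq5 : E * (E ^+ 4 + 5%:R * (c5 * E ^+ 3) + 15%:R * (c5 ^+ 2 * E ^+ 2) +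
   25%:R * (c5 ^+ 3 * E) + 25%:R * c5 ^+ 4) = A5 ^+ 5 + B5 ^+ 5 - 11%:R * c5 ^+ 5.
Proof. by rewrite euler5; apply: quintic_identity A5B5. Qed.

(** Multiplied by [q], only exponents of class 4 survive [U]. Sorting the expansion by class and
    substituting [A B = - c^2] leaves an integer multiple of [c^4]; the list collects these
    integers. *)
Lemma U5_base i : (i < 5)%N -> fpsU 5 (q * (c5 ^+ i * E ^+ (4 - i))) =
  (nth 0 [:: -5; 5; -1; -1; 1] i)%:~R * (q * fpsV 5 E ^+ 4).
Proof.
have cA := A5_class; have cB := B5_class; have cc := c5_class.
have base (k : int) (f : fps int) : fpsK 5 4 f = k%:~R * c5 ^+ 4 ->
    fpsU 5 (q * f) = k%:~R * (q * fpsV 5 E ^+ 4).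
  move=> H; rewrite -{1}[q]expr1 (@fpsU_qK _ 5 4) // H.
  have -> : q ^+ 1 * (k%:~R * c5 ^+ 4) = 1 * fpsV 5 (k%:~R * (q * fpsV 5 E ^+ 4)).
    rewrite 2!rmorphM rmorph_int rmorphXn /= fpsVV // fpsV_q // /c5 exprMn; ring.
  by rewrite mul1r fpsUV.
have AB := A5B5.
move=> i5; apply: base; case: i i5 => [|[|[|[|[|//]]]]] _.
- rewrite (fpsK_sorted (G := [::
    A5^+4 - 12%:R*(A5*B5^+2*c5) - 4%:R*(B5*c5^+3);
    - 4%:R*(A5^+3*c5) + 4%:R*(A5*B5^+3) + 6%:R*(B5^+2*c5^+2);
    4%:R*(A5^+3*B5) + 6%:R*(A5^+2*c5^+2) - 4%:R*(B5^+3*c5);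
    - 12%:R*(A5^+2*B5*c5) - 4%:R*(A5*c5^+3) + B5^+4;
    6%:R*(A5^+2*B5^+2) + 12%:R*(A5*B5*c5^+2) + c5^+4])) //=.
  + by rewrite -exprMn AB /=; ring.
  + by rewrite !big_ord_recr big_ord0 /= euler5; ring.
  + by do 5?[case=> [_|] /=; first by inclass_tac].
- rewrite (fpsK_sorted (G := [::
    3%:R*(A5*B5^+2*c5) + 3%:R*(B5*c5^+3);
    A5^+3*c5 - 3%:R*(B5^+2*c5^+2);
    - 3%:R*(A5^+2*c5^+2) + B5^+3*c5;
    3%:R*(A5^+2*B5*c5) + 3%:R*(A5*c5^+3);
    - 6%:R*(A5*B5*c5^+2) - c5^+4])) //=.
  + by rewrite AB /=; ring.
  + by rewrite !big_ord_recr big_ord0 /= euler5; ring.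
  + by do 5?[case=> [_|] /=; first by inclass_tac].
- rewrite (fpsK_sorted (G := [::
    - 2%:R*(B5*c5^+3);
    B5^+2*c5^+2;
    A5^+2*c5^+2;
    - 2%:R*(A5*c5^+3);
    2%:R*(A5*B5*c5^+2) + c5^+4])) //=.
  + by rewrite AB /=; ring.
  + by rewrite !big_ord_recr big_ord0 /= euler5; ring.
  + by do 5?[case=> [_|] /=; first by inclass_tac].
- rewrite (fpsK_sorted (G := [:: B5*c5^+3; 0; 0; A5*c5^+3; - c5^+4])) //=.
  + by ring.
  + by rewrite !big_ord_recr big_ord0 /= euler5; ring.
  + by do 5?[case=> [_|] /=; first by inclass_tac].
- rewrite expr0 mulr1 mul1r fpsK_id //; by inclass_tac.
Qed.
End Five.

Lemma fpsC_is_additive (R : comNzRingType) : zmod_morphism (@fpsC R).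
Proof.
move=> c d; apply: fpsP => n; rewrite fpsB /=.
by case: eqP; rewrite ?subr0.
Qed.
Lemma fpsC_is_multiplicative (R : comNzRingType) : monoid_morphism (@fpsC R).
Proof. by split; [apply: fpsP|exact: fpsCM]. Qed.
HB.instance Definition _ (R : comNzRingType) :=
  GRing.isZmodMorphism.Build R (fps R) (@fpsC R) (@fpsC_is_additive R).
HB.instance Definition _ (R : comNzRingType) :=
  GRing.isMonoidMorphism.Build R (fps R) (@fpsC R) (@fpsC_is_multiplicative R).

Lemma prod_prim_pow (R : comNzRingType) (l k : nat) (z : R) : odd l -> z ^+ l = 1 ->
  \prod_(i < l) (z ^+ i) ^+ k = 1.
Proof.
move=> lo zl; rewrite prodrXl -(big_mkord xpredT (fun i => z ^+ i)).
by rewrite prodrXr bin2_sum bin2odd // exprM zl !expr1n.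
Qed.

Lemma prod_ord_last (R : comNzRingType) (f : nat -> R) n : (0 < n)%N ->
  \prod_(i < n) f i = \prod_(i < n.-1) f i * f n.-1.
Proof. by case: n => // n _; rewrite big_ord_recr. Qed.

(** * The norm of the Euler product *)

Section Norm.
Variables (F : fieldType) (l : nat) (w : F).
Hypotheses (pl : prime l) (lo : odd l) (pw : l.-primitive_root w).
Local Notation q := (fq : fps F).
Local Notation E := (euler F).

Lemma prod_prim_root (z : F) (Y : fps F) : l.-primitive_root z ->
  \prod_(i < l) (1 - fpsC (z ^+ i) * Y) = 1 - Y ^+ l.
Proof.
move=> pz; have zl := prim_expr_order pz; have l0 := prime_gt0 pl.
pose z' := z ^+ l.-1.
have pz' : l.-primitive_root z'.
  by rewrite prim_root_exp_coprime // coprime_sym; case: l l0 => // n _; rewrite coprimeSn.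
have zz' : z * z' = 1 by rewrite /z' -exprS prednK.
have H : \prod_(i < l) (Y - fpsC (z' ^+ i)) = Y ^+ l - 1.
  have := congr1 (fun p => (map_poly (@fpsC F) p).[Y]) (factor_Xn_sub_1 pz').
  rewrite big_mkord rmorph_prod rmorphB rmorph1 /= map_polyXn !hornerE => <-.
  rewrite horner_prod; apply: eq_bigr => i _.
  by rewrite rmorphB /= map_polyX map_polyC !hornerE.
transitivity (\prod_(i < l) ((- 1) * fpsC (z ^+ i) * (Y - fpsC (z' ^+ i)))).
  apply: eq_bigr => i _; rewrite mulrBr -!mulrA -fpsCM -exprMn zz' expr1n.
  by rewrite rmorph1; ring.
rewrite !big_split /= H prodr_const card_ord -signr_odd lo -rmorph_prod /=.
rewrite (_ : \prod_(i < l) z ^+ i = 1); first by rewrite rmorph1 /=; ring.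
exact: (prod_prim_pow 1 lo zl).
Qed.

Lemma fin_euler_twist v n :
  fpsT v (fin_euler F n) = \prod_(i < n) (1 - fpsC (v ^+ i.+1) * q ^+ i.+1).
Proof.
rewrite rmorph_prod; apply: eq_bigr => i _.
by rewrite rmorphB rmorph1 rmorphXn /= fpsT_q exprMn -fpsCX.
Qed.

Lemma fin_eulerV m n : (0 < m)%N ->
  fpsV m (fin_euler F n) = \prod_(i < n) (1 - q ^+ (m * i.+1)).
Proof.
move=> m0; rewrite rmorph_prod; apply: eq_bigr => i _.
by rewrite rmorphB rmorph1 rmorphXn /= fpsV_q // exprM.
Qed.

Let D n := \prod_(i < l) (1 - fpsC (w ^+ (i * n)) * q ^+ n).

Let D_coprime n : ~~ (l %| n)%N -> D n = 1 - q ^+ (l * n).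
Proof.
move=> ln; rewrite mulnC exprM -(@prod_prim_root (w ^+ n)).
  by apply: eq_bigr => i _; rewrite -exprM mulnC.
by rewrite prim_root_exp_coprime // coprime_sym prime_coprime.
Qed.

Let D_dvd m : D (l * m) = (1 - q ^+ (l * m)) ^+ l.
Proof.
transitivity (\prod_(i < l) (1 - q ^+ (l * m))); last by rewrite prodr_const card_ord.
apply: eq_bigr => i _.
by rewrite mulnCA exprM (prim_expr_order pw) expr1n rmorph1 mul1r.
Qed.

Let norm_fin M :
  \prod_(n < l * M) D n.+1 * \prod_(m < M) (1 - q ^+ (l ^ 2 * m.+1)) =
  \prod_(n < l * M) (1 - q ^+ (l * n.+1)) * (\prod_(m < M) (1 - q ^+ (l * m.+1))) ^+ l.
Proof.
elim: M => [|M IH]; first by rewrite muln0 !big_ord0 expr1n.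
rewrite mulnS addnC ![\prod_(n < _ + _) _]big_split_ord /= ![\prod_(m < M.+1) _]big_ord_recr /=.
(* In a block of [l] consecutive indices only the last is divisible by [l]. *)
have key : \prod_(i < l) D (l * M + i).+1 * (1 - q ^+ (l ^ 2 * M.+1)) =
   \prod_(i < l) (1 - q ^+ (l * (l * M + i).+1)) * (1 - q ^+ (l * M.+1)) ^+ l.
  have l1 : (l.-1.+1 = l)%N by rewrite prednK ?prime_gt0.
  rewrite (prod_ord_last (fun i => D (l * M + i).+1)) ?prime_gt0 //.
  rewrite (prod_ord_last (fun i => 1 - q ^+ (l * (l * M + i).+1))) ?prime_gt0 //.
  have -> : ((l * M + l.-1).+1 = l * M.+1)%N by rewrite -addnS l1 mulnS addnC.
  rewrite D_dvd.
  rewrite (eq_bigr (fun i : 'I_l.-1 => 1 - q ^+ (l * (l * M + i).+1))); last first.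
    move=> i _; apply: D_coprime; rewrite -addnS dvdn_addr ?dvdn_mulr // gtnNdvd //.
    by rewrite -{2}l1 ltnS.
  by rewrite [(l * (l * M.+1))%N]mulnA mulnn; ring.
rewrite exprMn.
transitivity ((\prod_(n < l * M) D n.+1 * \prod_(m < M) (1 - q ^+ (l ^ 2 * m.+1))) *
  (\prod_(i < l) D (l * M + i).+1 * (1 - q ^+ (l ^ 2 * M.+1)))); first by ring.
by rewrite IH key; ring.
Qed.

(** The conjugates of [1 - q^n] multiply to [1 - q^(l n)] if [l] does not divide [n], and coincide
    otherwise. The factor [fpsV (l ^ 2) E] supplies the factors [1 - q^(l n)] with [l] dividing [n],
    which completes one copy of [fpsV l E]. *)
Lemma euler_norm :
  \prod_(i < l) fpsT (w ^+ i) E * fpsV (l ^ 2) E = fpsV l E ^+ l.+1.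
Proof.
have l0 := prime_gt0 pl.
apply: eqmP => M; have Ml : (M <= l * M)%N by rewrite leq_pmull.
have H1 : eqm M E (fin_euler F (l * M)) by apply: euler_eqm.
have H2 : eqm M E (fin_euler F M) by apply: euler_eqm.
rewrite exprS.
have L : eqm M (\prod_(i < l) fpsT (w ^+ i) E * fpsV (l ^ 2) E)
  (\prod_(i < l) fpsT (w ^+ i) (fin_euler F (l * M)) * fpsV (l ^ 2) (fin_euler F M)).
  apply: eqmM; last exact: eqmV.
  by apply: eqm_prod => i _; apply: eqmT.
have Rr : eqm M (fpsV l E * fpsV l E ^+ l)
   (fpsV l (fin_euler F (l * M)) * fpsV l (fin_euler F M) ^+ l).
  by apply: eqmM; [apply: eqmV|apply/eqmX/eqmV].
apply: eqm_trans L _; apply: eqm_trans (eqm_sym Rr); apply: eq_eqm.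
rewrite !fin_eulerV ?expn_gt0 ?l0 // -norm_fin; congr (_ * _).
rewrite (eq_bigr (fun i : 'I_l => \prod_(n < l * M) (1 - fpsC (w ^+ (i * n.+1)) * q ^+ n.+1))).
  by rewrite exchange_big.
by move=> i _; rewrite fin_euler_twist; apply: eq_bigr => n _; rewrite exprM.
Qed.
End Norm.

Lemma monic_prod_roots (D : idomainType) (p : {poly D}) (xs : seq D) :
  p \is monic -> size p = (size xs).+1 -> all (root p) xs -> uniq xs ->
  p = \prod_(x <- xs) ('X - x%:P).
Proof.
move=> pm sp rp ux; set r := \prod_(x <- xs) _.
have rm : r \is monic by apply: monic_prod => x _; apply: monicXsubC.
have sr : size r = (size xs).+1 by rewrite size_prod_XsubC.
apply/eqP; rewrite -subr_eq0; apply/negPn/negP => d0.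
have sd : (size (p - r)%R <= size xs)%N.
  apply/leq_sizeP => j; rewrite leq_eqVlt coefB => /orP[/eqP <-|xj].
    move: pm rm; rewrite !monicE !lead_coefE sp sr /= => /eqP -> /eqP ->.
    by rewrite subrr.
  by rewrite !nth_default ?subrr ?sp ?sr.
have := max_poly_roots d0 _ ux; rewrite ltnNge sd => /(_ _)/negP; apply => //.
apply/allP => x xx; rewrite /root hornerD hornerN (rootP (allP rp _ xx)).
by rewrite sub0r oppr_eq0 -/(root _ _) root_prod_XsubC.
Qed.

Lemma fps_map_euler (R S : comNzRingType) (phi : {rmorphism R -> S}) :
  fps_map phi (euler R) = euler S.
Proof.
suff fin n : fps_map phi (fin_euler R n) = fin_euler S n.
  by apply: fpsP => n; rewrite fps_mapE /= -fps_mapE fin.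
rewrite rmorph_prod; apply: eq_bigr => i _.
by rewrite rmorphB rmorph1 rmorphXn /= fps_map_q.
Qed.

Section Conjugates.
Variables (l k : nat) (w : algC).
Hypotheses (pl : prime l) (lo : odd l) (kl : coprime k l).
Hypothesis pw : l.-primitive_root w.
Local Notation E := (euler algC).

(* The [l] conjugates of [E] under [q -> w q] are the roots of [p], so [p.[0]] is
   their product up to sign, which [euler_norm] evaluates. *)
Lemma euler_conjugates (p : {poly fps algC}) : p \is monic -> size p = l.+1 ->
  (forall u, u ^+ l = 1 -> root p (fpsC (u ^+ k) * fpsT u E)) ->
  - p.[0] * fpsV (l ^ 2) E = fpsV l E ^+ l.+1.
Proof.
move=> pm sp rp; rewrite -(euler_norm pl lo pw); congr (_ * _).
pose x i := fpsC ((w ^+ i) ^+ k) * fpsT (w ^+ i) E.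
have x0 i : x i 0%N = (w ^+ k) ^+ i.
  by rewrite fpsC_mul fpsTE mul1r euler0 mulr1 -!exprM mulnC.
have -> : p = \prod_(y <- [seq x i | i <- iota 0 l]) ('X - y%:P).
  apply: monic_prod_roots => //; first by rewrite size_map size_iota.
    apply/allP => y /mapP[i _ ->]; apply: rp.
    by rewrite exprAC (prim_expr_order pw) expr1n.
  rewrite map_inj_in_uniq ?iota_uniq // => i j; rewrite !mem_iota !add0n => il jl.
  move/(congr1 (fun f : fps algC => f 0%N)); rewrite !x0 => /eqP.
  rewrite (eq_prim_root_expr (n := l)) ?prim_root_exp_coprime //.
  by rewrite !modn_small // => /eqP.
rewrite big_map horner_prod -(subn0 l) -/(index_iota 0 l) big_mkord.
rewrite (eq_bigr (fun i : 'I_l => (-1) * (fpsC ((w ^+ i) ^+ k) * fpsT (w ^+ i) E))); last first.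
  by move=> i _; rewrite hornerXsubC sub0r mulN1r.
rewrite !big_split /= prodr_const card_ord -signr_odd lo -rmorph_prod /=.
by rewrite (prod_prim_pow k lo (prim_expr_order pw)) rmorph1 mul1r mulN1r opprK subn0.
Qed.
End Conjugates.

Lemma norm5 :
  (A5 ^+ 5 + B5 ^+ 5 - 11%:R * c5 ^+ 5) * fpsV 25 (euler int) = fpsV 5 (euler int) ^+ 6.
Proof.
pose phi : {rmorphism int -> algC} := intr.
apply: (@fps_map_inj _ _ phi); first exact: intr_inj.
have [w pw] := C_prim_root_exists (isT : 0 < 5)%N.
set N := A5 ^+ 5 + _ - _.
pose A := fps_map phi A5; pose B := fps_map phi B5; pose c := fps_map phi c5.
have AB : A * B = - c ^+ 2 by rewrite -rmorphM A5B5 rmorphN rmorphXn.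
have NE : fps_map phi N = A ^+ 5 + B ^+ 5 - 11%:R * c ^+ 5.
  by rewrite /N rmorphB rmorphD !rmorphXn rmorphM rmorphXn rmorph_nat.
pose s : seq (fps algC) := [:: - fps_map phi N; 25%:R * c ^+ 4; 25%:R * c ^+ 3;
   15%:R * c ^+ 2; 5%:R * c; 1].
have sE : Poly s = s :> seq _ by rewrite (@PolyK _ 1) //= oner_eq0.
have sm : Poly s \is monic by rewrite monicE lead_coefE sE /=.
have ss : size (Poly s) = 6%N by rewrite sE.
(* The exponent [4 = -1] modulo 5 undoes the twist of [c5], of class 1. The conjugates become
   [u^4 A + u B - c], with the same [A B], [A^5 + B^5] and [c], so [quintic_identity] makes them
   roots of the same polynomial. *)
have := @euler_conjugates 5 4 w isT isT isT pw (Poly s) sm ss.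
rewrite horner_Poly /= => H.
rewrite rmorphM rmorphXn /= !fps_mapV fps_map_euler -H ?mulr0 ?add0r ?opprK //.
move=> u u5; rewrite /root !horner_cons hornerC; apply/eqP.
have EE : euler algC = A + B - c.
  by rewrite -(fps_map_euler phi) euler5 rmorphB rmorphD.
pose U : fps algC := fpsC u; have U5 : U ^+ 5 = 1 by rewrite -rmorphXn u5 rmorph1.
set x := fpsC _ * _.
have xE : x = U ^+ 4 * A + U * B - c.
  rewrite /x EE rmorphB rmorphD /= (fpsT_inclass u5 (inclass_map phi A5_class)).
  rewrite (fpsT_inclass u5 (inclass_map phi B5_class)) (fpsT_inclass u5 (inclass_map phi c5_class)).
  rewrite -/A -/B -/c !fpsCX -/U.
  have -> : U ^+ 4 * (U ^+ 0 * A + U ^+ 2 * B - U ^+ 1 * c) = U ^+ 4 * A + U ^+ 5 * U * B - U ^+ 5 * c.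
    by ring.
  by rewrite U5 !mul1r.
have AB' : (U ^+ 4 * A) * (U * B) = - c ^+ 2.
  by rewrite -AB -[RHS]mul1r -U5; ring.
have := quintic_identity AB'; rewrite /= -xE => Q.
have {Q}: x * (x ^+ 4 + 5%:R * (c * x ^+ 3) + 15%:R * (c ^+ 2 * x ^+ 2) + 25%:R * (c ^+ 3 * x) +
     25%:R * c ^+ 4) - (A ^+ 5 + B ^+ 5 - 11%:R * c ^+ 5) = 0.
  rewrite Q; transitivity (A ^+ 5 * ((U ^+ 5) ^+ 4 - 1) + B ^+ 5 * (U ^+ 5 - 1)); first by ring.
  by rewrite U5; ring.
by move=> H0; rewrite NE -[RHS]H0; ring.
Qed.

(** * The 7-dissection *)

(** It is invariant under the twists [A, B, C -> u^5 A, u^3 B, u^6 C] with [u^7 = 1]; at the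
    sections of [E] it turns out in [t7E] to be [q * fpsV 7 E ^+ 4]. *)
Definition septic_tau (R : comNzRingType) (A B C c : R) :=
  - (A ^+ 3 * C + C ^+ 3 * B + B ^+ 3 * A) - 8%:R * c ^+ 4.

Definition septic_cofactor (R : comNzRingType) (c t x : R) :=
  x ^+ 6 + 7%:R * (c * x ^+ 5) + 21%:R * (c ^+ 2 * x ^+ 4) + 49%:R * (c ^+ 3 * x ^+ 3) +
  (147%:R * c ^+ 4 + 7%:R * t) * x ^+ 2 + (343%:R * c ^+ 5 + 35%:R * (c * t)) * x +
  (343%:R * c ^+ 6 + 49%:R * (c ^+ 2 * t)).

(* The multipliers come from reducing the difference of the two sides modulo the
   ideal of the four relations. *)
Lemma septic_identity (R : comNzRingType) (A B C c : R) :
  A * B * C + c ^+ 3 = 0 -> A ^+ 2 * B + C * c ^+ 2 - B ^+ 2 * c = 0 ->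
  C ^+ 2 * A + B * c ^+ 2 - A ^+ 2 * c = 0 -> B ^+ 2 * C + A * c ^+ 2 - C ^+ 2 * c = 0 ->
  let t := septic_tau A B C c in let x := A + B + C - c in
  c * (x * septic_cofactor c t x) = t ^+ 2.
Proof.
move=> r0 r1 r2 r3 t x; rewrite /septic_cofactor.
transitivity (t ^+ 2
 + (- 9%:R*(c^+5) + 6%:R*(A*B*C*c^+2) - 35%:R*(C*c^+4) + 203%:R*(A*B*C^+2*c) - 35%:R*(C^+2*c^+3)
      + 14%:R*(A*B*C^+3) - 28%:R*(C^+3*c^+2) + 21%:R*(C^+4*c) - 28%:R*(B*c^+4) + 196%:R*(A*B^+2*C*c)
      - 56%:R*(B*C*c^+3) + 28%:R*(A*B^+2*C^+2) - 28%:R*(B*C^+2*c^+2) + 64%:R*(B*C^+3*c) - 35%:R*(B^+2*c^+3)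
      + 21%:R*(A*B^+3*C) - 14%:R*(B^+2*C*c^+2) + 112%:R*(B^+2*C^+2*c) - 28%:R*(B^+3*c^+2) + 84%:R*(B^+3*C*c)
      - 2%:R*(B^+3*C^+2) + 21%:R*(B^+4*c) - 28%:R*(A*c^+4) + 196%:R*(A^+2*B*C*c) - 56%:R*(A*C*c^+3)
      - 7%:R*(A*C^+2*c^+2) + 84%:R*(A*C^+3*c) - 84%:R*(A*B*c^+3) - 28%:R*(A*B^+2*c^+2) + 64%:R*(A*B^+3*c)
      + 7%:R*(A*B^+4) - 42%:R*(A^+2*c^+3) + 112%:R*(A^+2*C^+2*c) - 3%:R*(A^+2*C^+3) - 7%:R*(A^+2*B*c^+2)
      + 112%:R*(A^+2*B^+2*c) + 60%:R*(A^+3*C*c) - 7%:R*(A^+3*C^+2) + 84%:R*(A^+3*B*c) - 2%:R*(A^+3*B^+2)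
      + 14%:R*(A^+4*c) - 7%:R*(A^+4*C)) * (A * B * C + c ^+ 3)
 + (28%:R*(C^+2*c^+3) - 7%:R*(C^+3*c^+2) + 28%:R*(B*C*c^+3) - 3%:R*(B*C^+2*c^+2) - 7%:R*(B*C^+3*c)
      - 7%:R*(C*c^+4) - 7%:R*(B^+2*C^+2*c) - 28%:R*(B*c^+4) - B^+3*C*c + 7%:R*(B^+2*c^+3)
      + 7%:R*(A*C*c^+3) - 28%:R*(A*C^+2*c^+2) + A*C^+4 + 7%:R*(c^+5) - 14%:R*(B*C^+4)
      - 28%:R*(A*c^+4) + 7%:R*(A*B^+2*c^+2) - 28%:R*(B^+2*C^+3) + 3%:R*(A*B*c^+3) - 21%:R*(B^+3*C^+2)
      - 7%:R*(B^+4*C) - 28%:R*(A^+2*C*c^+2) + 3%:R*(A^+2*C^+2*c) + 7%:R*(A^+2*C^+3) + 7%:R*(A^+2*B*c^+2)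
      + 28%:R*(A^+2*B^+2*c) + 7%:R*(A^+3*C^+2) + A^+3*c^+2 + 7%:R*(A^+3*C*c) + 21%:R*(A^+3*B*c)
      + 7%:R*(A^+4*c) + 14%:R*(A*B^+3*c) - B^+5) * (A ^+ 2 * B + C * c ^+ 2 - B ^+ 2 * c)
 + (21%:R*(A*C^+3*c) + 7%:R*(C^+4*c) + 28%:R*(A^+2*C^+2*c) + 14%:R*(A^+3*C*c) - A^+5) * (C ^+ 2 * A + B * c ^+ 2 - A ^+ 2 * c)
 + (- C^+5) * (B ^+ 2 * C + A * c ^+ 2 - C ^+ 2 * c)); last first.
  by rewrite r0 r1 r2 r3 !mulr0 !addr0.
rewrite /x /t /septic_tau; ring.
Qed.

Section Seven.
Local Notation q := (fq : fps int).
Local Notation E := (euler int).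

Definition A7 := fpsK 7 0 E.
Definition B7 := fpsK 7 5 E.
Definition C7 := fpsK 7 1 E.
Definition c7 := q ^+ 2 * fpsV 49 E.
Local Notation A := A7.
Local Notation B := B7.
Local Notation C := C7.
Local Notation c := c7.

Lemma A7_class : inclass 7 0 A. Proof. exact: inclassK. Qed.
Lemma B7_class : inclass 7 5 B. Proof. exact: inclassK. Qed.
Lemma C7_class : inclass 7 1 C. Proof. exact: inclassK. Qed.
Lemma c7_class : inclass 7 2 c.
Proof.
apply: (@inclass_mod _ _ (2 * 1 + 0)) => //; apply: inclassM; first exact/inclassX/inclass_q.
by rewrite (_ : 49 = 7 * 7)%N // -fpsVV //; apply: inclassV.
Qed.

Lemma euler7 : E = A + B + C - c.
Proof.
rewrite {1}(fpsK_sum (l := 7) E) // !big_ord_recr big_ord0 /= add0r.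
rewrite (@euler_class_delta _ 7 2) //; last by right.
rewrite (@euler_class0 _ 7 3) // (@euler_class0 _ 7 4) // (@euler_class0 _ 7 6) //.
rewrite /A7 /B7 /C7 /c7; ring.
Qed.

(** As [8 * 6 + 1 = 49], in class 6 the square roots of [8 n + 1] are 7 times those of [8 m + 1]
    with [n = 49 m + 6]. The index [k] becomes [7 k + 3], which changes the sign. *)
Lemma jacobi_delta7 : fpsK 7 6 (E ^+ 3) = - (7%:R * c ^+ 3).
Proof.
have -> : c ^+ 3 = q ^+ 6 * fpsV 49 (E ^+ 3) by rewrite /c7 exprMn -exprM rmorphXn.
apply: fpsP => n; rewrite fpsN fps_natM fqXM fpsKE.
case: eqP => [n6|n6]; last first.
  case: ifP => [dn|_]; last by rewrite mulr0 oppr0.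
  rewrite fpsVE; case: ifP => [/dvdnP[k nk]|_]; last by rewrite mulr0 oppr0.
  by case: n6; rewrite -(subnK dn) nk -modnDml (_ : 49 = 7 * 7)%N // mulnA modnMl.
have dn : (6 <= n)%N by rewrite (divn_eq n 7) n6; lia.
have ldn : (7 %| n - 6)%N by rewrite -eqn_mod_dvd // n6.
have En : (8 * n + 1 = 8 * (n - 6) + 7 ^ 2)%N by lia.
rewrite dn fpsVE; case: ifP => [/dvdnP[m mn]|H]; last first.
  rewrite mulr0 oppr0; apply: jacobi_coef0 => a; apply/eqP => an.
  by have [] := @sq_eq_dvdn 7 a (n - 6) 8 isT isT ldn (etrans an En); rewrite H.
rewrite mn mulnK //.
have [[b bm]|nb] := pselect (exists b, b ^ 2 = 8 * m + 1)%N; last first.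
  rewrite !jacobi_coef0 ?mulr0 ?oppr0 // => a; apply/eqP => am; first by apply: nb; exists a.
  have [[b ab] _] := @sq_eq_dvdn 7 a (n - 6) 8 isT isT ldn (etrans am En).
  by apply: nb; exists b; lia.
have [k bk] : exists k, b = (2 * k + 1)%N.
  exists b./2; have : odd (b ^ 2) by rewrite bm; lia.
  by rewrite oddX /=; lia.
rewrite bk in bm; rewrite (jacobi_coef _ bm) (@jacobi_coef _ _ (7 * k + 3)); last by lia.
rewrite (_ : 2 * (7 * k + 3) + 1 = 7 * (2 * k + 1))%N; last by lia.
have -> : (-1) ^+ (7 * k + 3) = - (-1) ^+ k :> int.
  by rewrite -signr_odd -[in RHS]signr_odd -signrN; congr (_ ^+ _); congr nat_of_bool; lia.
by rewrite natrM; ring.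
Qed.

(** The four relations are read off this table: classes 2, 4 and 5 vanish because 17, 33 and 41 are
    not squares modulo 7, and class 6 is given by [jacobi_delta7]. *)
Let cube r : (r < 7)%N -> fpsK 7 r (E ^+ 3) = [::
    A^+3 - 6%:R*(A*B*c) + 3%:R*(B*C^+2);
    3%:R*(A^+2*C) + B^+3 - 6%:R*(B*C*c);
    - 3%:R*(A^+2*c) + 3%:R*(A*C^+2) + 3%:R*(B*c^+2);
    3%:R*(A*B^+2) - 6%:R*(A*C*c) + C^+3;
    3%:R*(A*c^+2) + 3%:R*(B^+2*C) - 3%:R*(C^+2*c);
    3%:R*(A^+2*B) - 3%:R*(B^+2*c) + 3%:R*(C*c^+2);
    6%:R*(A*B*C) - c^+3]`_r.
Proof.
have cA := A7_class; have cB := B7_class; have cC := C7_class; have cc := c7_class.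
move=> r7; apply: fpsK_sorted => //.
  by rewrite !big_ord_recr big_ord0 /= euler7; ring.
by do 7?[case=> [_|] /=; first by inclass_tac].
Qed.

Lemma c7_neq0 : c != 0.
Proof.
apply/eqP => /(congr1 (fun f : fps int => f 2));
by rewrite /c7 fqXM leqnn subnn fpsVE dvdn0 div0n euler0.
Qed.

Let nat_mul_eq0 k (f : fps int) : (0 < k)%N -> k%:R * f = 0 -> f = 0.
Proof.
move=> k0 /eqP; rewrite mulf_eq0 => /orP[/eqP H|/eqP //].
have := congr1 (fun g : fps int => g 0%N) H; rewrite fpsMn fps1 fps0 => /eqP.
by rewrite pnatr_eq0; lia.
Qed.

Lemma rel7_0 : A * B * C + c ^+ 3 = 0.
Proof.
have := cube (isT : 6 < 7)%N; rewrite jacobi_delta7 /= => H.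
apply: (@nat_mul_eq0 6) => //; rewrite -(subrr (- (7%:R * c ^+ 3))) {1}H; ring.
Qed.

Lemma rel7_1 : A ^+ 2 * B + C * c ^+ 2 - B ^+ 2 * c = 0.
Proof.
have := cube (isT : 5 < 7)%N; rewrite jacobi_class0 //= => H.
by apply: (@nat_mul_eq0 3) => //; rewrite [RHS]H; ring.
Qed.

Lemma rel7_2 : C ^+ 2 * A + B * c ^+ 2 - A ^+ 2 * c = 0.
Proof.
have := cube (isT : 2 < 7)%N; rewrite jacobi_class0 //= => H.
by apply: (@nat_mul_eq0 3) => //; rewrite [RHS]H; ring.
Qed.

Lemma rel7_3 : B ^+ 2 * C + A * c ^+ 2 - C ^+ 2 * c = 0.
Proof.
have := cube (isT : 4 < 7)%N; rewrite jacobi_class0 //= => H.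
by apply: (@nat_mul_eq0 3) => //; rewrite [RHS]H; ring.
Qed.

Definition t7 := septic_tau A B C c.

Lemma modeq7 : c * (E * septic_cofactor c t7 E) = t7 ^+ 2.
Proof.
by rewrite euler7; apply: septic_identity; [exact: rel7_0|exact: rel7_1|exact: rel7_2|exact: rel7_3].
Qed.

(** Modulo the four relations the component of class 5 lies in the span of [c^6] and [t7 c^2]. Where
    a relation is used, its explicit multiplier records the reduction. *)
Lemma K7_base i : (i < 7)%N -> fpsK 7 5 (c ^+ i * E ^+ (6 - i)) =
  (nth 0 [:: 49; 49; -7; -7; 1; -1; 1] i)%:~R * c ^+ 6 +
  (nth 0 [:: 0; 10; -4; 0; 0; 0; 0] i)%:~R * (t7 * c ^+ 2).
Proof.
have cA := A7_class; have cB := B7_class; have cC := C7_class; have cc := c7_class.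
have r0 := rel7_0; have r1 := rel7_1; have r2 := rel7_2; have r3 := rel7_3.
case: i => [|[|[|[|[|[|[|//]]]]]]] _.
- rewrite (fpsK_sorted (G := [::
    A^+6 - 30%:R*(A^+4*B*c) + 60%:R*(A^+3*B*C^+2) + 90%:R*(A^+2*B^+2*c^+2) - 60%:R*(A^+2*C*c^+3)
      + 30%:R*(A*B^+4*C) - 180%:R*(A*B^+2*C^+2*c) + 60%:R*(A*C^+3*c^+2) - 20%:R*(B^+3*c^+3) + 15%:R*(B^+2*C^+4)
      + 30%:R*(B*C*c^+4) - 6%:R*(C^+5*c);
    6%:R*(A^+5*C) + 20%:R*(A^+3*B^+3) - 120%:R*(A^+3*B*C*c) + 60%:R*(A^+2*B*C^+3) + 15%:R*(A^+2*c^+4)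
      - 30%:R*(A*B^+4*c) + 180%:R*(A*B^+2*C*c^+2) - 60%:R*(A*C^+2*c^+3) + 15%:R*(B^+4*C^+2) - 60%:R*(B^+2*C^+3*c)
      - 6%:R*(B*c^+5) + 15%:R*(C^+4*c^+2);
    - 6%:R*(A^+5*c) + 15%:R*(A^+4*C^+2) + 60%:R*(A^+3*B*c^+2) + 60%:R*(A^+2*B^+3*C) - 180%:R*(A^+2*B*C^+2*c)
      - 60%:R*(A*B^+2*c^+3) + 30%:R*(A*B*C^+4) + 30%:R*(A*C*c^+4) + B^+6 - 30%:R*(B^+4*C*c)
      + 90%:R*(B^+2*C^+2*c^+2) - 20%:R*(C^+3*c^+3);
    15%:R*(A^+4*B^+2) - 30%:R*(A^+4*C*c) + 20%:R*(A^+3*C^+3) - 60%:R*(A^+2*B^+3*c) + 180%:R*(A^+2*B*C*c^+2)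
      + 60%:R*(A*B^+3*C^+2) - 120%:R*(A*B*C^+3*c) - 6%:R*(A*c^+5) + 15%:R*(B^+4*c^+2) - 60%:R*(B^+2*C*c^+3)
      + 6%:R*(B*C^+5) + 15%:R*(C^+2*c^+4);
    15%:R*(A^+4*c^+2) + 60%:R*(A^+3*B^+2*C) - 60%:R*(A^+3*C^+2*c) - 60%:R*(A^+2*B*c^+3) + 15%:R*(A^+2*C^+4)
      + 6%:R*(A*B^+5) - 120%:R*(A*B^+3*C*c) + 180%:R*(A*B*C^+2*c^+2) + 20%:R*(B^+3*C^+3) + 15%:R*(B^+2*c^+4)
      - 30%:R*(B*C^+4*c) - 6%:R*(C*c^+5);
    6%:R*(A^+5*B) - 60%:R*(A^+3*B^+2*c) + 60%:R*(A^+3*C*c^+2) + 90%:R*(A^+2*B^+2*C^+2) - 60%:R*(A^+2*C^+3*c)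
      + 60%:R*(A*B^+3*c^+2) - 120%:R*(A*B*C*c^+3) + 6%:R*(A*C^+5) + 6%:R*(B^+5*C) - 60%:R*(B^+3*C^+2*c)
      + 60%:R*(B*C^+3*c^+2) + c^+6;
    30%:R*(A^+4*B*C) - 20%:R*(A^+3*c^+3) + 15%:R*(A^+2*B^+4) - 180%:R*(A^+2*B^+2*C*c) + 90%:R*(A^+2*C^+2*c^+2)
      + 60%:R*(A*B^+2*C^+3) + 30%:R*(A*B*c^+4) - 30%:R*(A*C^+4*c) - 6%:R*(B^+5*c) + 60%:R*(B^+3*C*c^+2)
      - 60%:R*(B*C^+2*c^+3) + C^+6])) //=.
  + transitivity ((49)%:~R * c ^+ 6 + (0)%:~R * (septic_tau A B C c * c ^+ 2)
    + (- 48%:R*(c^+3) + 36%:R*(A*B*C)) * (A * B * C + c ^+ 3)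
    + (54%:R*(B*C^+2) - 54%:R*(A*B*c) + 6%:R*(A^+3)) * (A ^+ 2 * B + C * c ^+ 2 - B ^+ 2 * c)
    + (6%:R*(C^+3) - 54%:R*(A*C*c)) * (C ^+ 2 * A + B * c ^+ 2 - A ^+ 2 * c)
    + (6%:R*(B^+3)) * (B ^+ 2 * C + A * c ^+ 2 - C ^+ 2 * c)).
      by rewrite /septic_tau /=; ring.
    by rewrite r0 r1 r2 r3 ?mulr0 ?addr0.
  + by rewrite !big_ord_recr big_ord0 /= euler7; ring.
  + by do 7?[case=> [_|] /=; first by inclass_tac].
- rewrite (fpsK_sorted (G := [::
    5%:R*(A^+4*B*c) - 30%:R*(A^+2*B^+2*c^+2) + 30%:R*(A^+2*C*c^+3) + 30%:R*(A*B^+2*C^+2*c) - 20%:R*(A*C^+3*c^+2)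
      + 10%:R*(B^+3*c^+3) - 20%:R*(B*C*c^+4) + C^+5*c;
    20%:R*(A^+3*B*C*c) - 10%:R*(A^+2*c^+4) + 5%:R*(A*B^+4*c) - 60%:R*(A*B^+2*C*c^+2) + 30%:R*(A*C^+2*c^+3)
      + 10%:R*(B^+2*C^+3*c) + 5%:R*(B*c^+5) - 5%:R*(C^+4*c^+2);
    A^+5*c - 20%:R*(A^+3*B*c^+2) + 30%:R*(A^+2*B*C^+2*c) + 30%:R*(A*B^+2*c^+3) - 20%:R*(A*C*c^+4)
      + 5%:R*(B^+4*C*c) - 30%:R*(B^+2*C^+2*c^+2) + 10%:R*(C^+3*c^+3);
    5%:R*(A^+4*C*c) + 10%:R*(A^+2*B^+3*c) - 60%:R*(A^+2*B*C*c^+2) + 20%:R*(A*B*C^+3*c) + 5%:R*(A*c^+5)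
      - 5%:R*(B^+4*c^+2) + 30%:R*(B^+2*C*c^+3) - 10%:R*(C^+2*c^+4);
    - 5%:R*(A^+4*c^+2) + 10%:R*(A^+3*C^+2*c) + 30%:R*(A^+2*B*c^+3) + 20%:R*(A*B^+3*C*c) - 60%:R*(A*B*C^+2*c^+2)
      - 10%:R*(B^+2*c^+4) + 5%:R*(B*C^+4*c) + 5%:R*(C*c^+5);
    10%:R*(A^+3*B^+2*c) - 20%:R*(A^+3*C*c^+2) + 10%:R*(A^+2*C^+3*c) - 20%:R*(A*B^+3*c^+2) + 60%:R*(A*B*C*c^+3)
      + 10%:R*(B^+3*C^+2*c) - 20%:R*(B*C^+3*c^+2) - c^+6;
    10%:R*(A^+3*c^+3) + 30%:R*(A^+2*B^+2*C*c) - 30%:R*(A^+2*C^+2*c^+2) - 20%:R*(A*B*c^+4) + 5%:R*(A*C^+4*c)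
      + B^+5*c - 20%:R*(B^+3*C*c^+2) + 30%:R*(B*C^+2*c^+3)])) //=.
  + transitivity ((49)%:~R * c ^+ 6 + (10)%:~R * (septic_tau A B C c * c ^+ 2)
    + (30%:R*(c^+3) + 10%:R*(A*B*C)) * (A * B * C + c ^+ 3)
    + (- 10%:R*(B*C^+2) + 10%:R*(A*B*c)) * (A ^+ 2 * B + C * c ^+ 2 - B ^+ 2 * c)
    + (10%:R*(A*C*c)) * (C ^+ 2 * A + B * c ^+ 2 - A ^+ 2 * c)).
      by rewrite /septic_tau /=; ring.
    by rewrite r0 r1 r2 ?mulr0 ?addr0.
  + by rewrite !big_ord_recr big_ord0 /= euler7; ring.
  + by do 7?[case=> [_|] /=; first by inclass_tac].
- rewrite (fpsK_sorted (G := [::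
    6%:R*(A^+2*B^+2*c^+2) - 12%:R*(A^+2*C*c^+3) + 4%:R*(A*C^+3*c^+2) - 4%:R*(B^+3*c^+3) + 12%:R*(B*C*c^+4);
    6%:R*(A^+2*c^+4) + 12%:R*(A*B^+2*C*c^+2) - 12%:R*(A*C^+2*c^+3) - 4%:R*(B*c^+5) + C^+4*c^+2;
    4%:R*(A^+3*B*c^+2) - 12%:R*(A*B^+2*c^+3) + 12%:R*(A*C*c^+4) + 6%:R*(B^+2*C^+2*c^+2) - 4%:R*(C^+3*c^+3);
    12%:R*(A^+2*B*C*c^+2) - 4%:R*(A*c^+5) + B^+4*c^+2 - 12%:R*(B^+2*C*c^+3) + 6%:R*(C^+2*c^+4);
    A^+4*c^+2 - 12%:R*(A^+2*B*c^+3) + 12%:R*(A*B*C^+2*c^+2) + 6%:R*(B^+2*c^+4) - 4%:R*(C*c^+5);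
    4%:R*(A^+3*C*c^+2) + 4%:R*(A*B^+3*c^+2) - 24%:R*(A*B*C*c^+3) + 4%:R*(B*C^+3*c^+2) + c^+6;
    - 4%:R*(A^+3*c^+3) + 6%:R*(A^+2*C^+2*c^+2) + 12%:R*(A*B*c^+4) + 4%:R*(B^+3*C*c^+2) - 12%:R*(B*C^+2*c^+3)])) //=.
  + transitivity ((-7)%:~R * c ^+ 6 + (-4)%:~R * (septic_tau A B C c * c ^+ 2)
    + (- 24%:R*(c^+3)) * (A * B * C + c ^+ 3)).
      by rewrite /septic_tau /=; ring.
    by rewrite r0 ?mulr0 ?addr0.
  + by rewrite !big_ord_recr big_ord0 /= euler7; ring.
  + by do 7?[case=> [_|] /=; first by inclass_tac].
- rewrite (fpsK_sorted (G := [::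
    3%:R*(A^+2*C*c^+3) + B^+3*c^+3 - 6%:R*(B*C*c^+4);
    - 3%:R*(A^+2*c^+4) + 3%:R*(A*C^+2*c^+3) + 3%:R*(B*c^+5);
    3%:R*(A*B^+2*c^+3) - 6%:R*(A*C*c^+4) + C^+3*c^+3;
    3%:R*(A*c^+5) + 3%:R*(B^+2*C*c^+3) - 3%:R*(C^+2*c^+4);
    3%:R*(A^+2*B*c^+3) - 3%:R*(B^+2*c^+4) + 3%:R*(C*c^+5);
    6%:R*(A*B*C*c^+3) - c^+6;
    A^+3*c^+3 - 6%:R*(A*B*c^+4) + 3%:R*(B*C^+2*c^+3)])) //=.
  + transitivity ((-7)%:~R * c ^+ 6 + (0)%:~R * (septic_tau A B C c * c ^+ 2)
    + (6%:R*(c^+3)) * (A * B * C + c ^+ 3)).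
      by rewrite /septic_tau /=; ring.
    by rewrite r0 ?mulr0 ?addr0.
  + by rewrite !big_ord_recr big_ord0 /= euler7; ring.
  + by do 7?[case=> [_|] /=; first by inclass_tac].
- rewrite (fpsK_sorted (G := [::
    2%:R*(B*C*c^+4);
    A^+2*c^+4 - 2%:R*(B*c^+5);
    2%:R*(A*C*c^+4);
    - 2%:R*(A*c^+5) + C^+2*c^+4;
    B^+2*c^+4 - 2%:R*(C*c^+5);
    c^+6;
    2%:R*(A*B*c^+4)])) //=.
  + transitivity ((1)%:~R * c ^+ 6 + (0)%:~R * (septic_tau A B C c * c ^+ 2)).
      by rewrite /septic_tau /=; ring.
    by rewrite ?mulr0 ?addr0.
  + by rewrite !big_ord_recr big_ord0 /= euler7; ring.
  + by do 7?[case=> [_|] /=; first by inclass_tac].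
- rewrite (fpsK_sorted (G := [:: 0; B*c^+5; 0; A*c^+5; C*c^+5; - c^+6; 0])) //=.
  + transitivity ((-1)%:~R * c ^+ 6 + (0)%:~R * (septic_tau A B C c * c ^+ 2)).
      by rewrite /septic_tau /=; ring.
    by rewrite ?mulr0 ?addr0.
  + by rewrite !big_ord_recr big_ord0 /= euler7; ring.
  + by do 7?[case=> [_|] /=; first by inclass_tac].
- rewrite (fpsK_sorted (G := [:: 0; 0; 0; 0; 0; c^+6; 0])) //=.
  + transitivity ((1)%:~R * c ^+ 6 + (0)%:~R * (septic_tau A B C c * c ^+ 2)).
      by rewrite /septic_tau /=; ring.
    by rewrite ?mulr0 ?addr0.
  + by rewrite !big_ord_recr big_ord0 /= euler7; ring.
  + by do 7?[case=> [_|] /=; first by inclass_tac].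
Qed.
End Seven.

Lemma norm7 :
  euler int * septic_cofactor c7 t7 (euler int) * fpsV 49 (euler int) = fpsV 7 (euler int) ^+ 8.
Proof.
pose phi : {rmorphism int -> algC} := intr.
apply: (@fps_map_inj _ _ phi); first exact: intr_inj.
have [w pw] := C_prim_root_exists (isT : 0 < 7)%N.
set N := euler int * _.
pose A := fps_map phi A7; pose B := fps_map phi B7; pose C := fps_map phi C7.
pose c := fps_map phi c7.
pose t := septic_tau A B C c.
have tE : fps_map phi t7 = t.
  rewrite /t /t7 /septic_tau rmorphB rmorphN !rmorphD.
  by rewrite !(rmorphM _ (_ ^+ 3)) (rmorphM _ 8%:R) !rmorphXn rmorph_nat.
have r0 : A * B * C + c ^+ 3 = 0.
  by rewrite -!rmorphM -rmorphXn -rmorphD rel7_0 rmorph0.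
have r1 : A ^+ 2 * B + C * c ^+ 2 - B ^+ 2 * c = 0.
  by rewrite -!rmorphXn -!rmorphM -rmorphD -rmorphB rel7_1 rmorph0.
have r2 : C ^+ 2 * A + B * c ^+ 2 - A ^+ 2 * c = 0.
  by rewrite -!rmorphXn -!rmorphM -rmorphD -rmorphB rel7_2 rmorph0.
have r3 : B ^+ 2 * C + A * c ^+ 2 - C ^+ 2 * c = 0.
  by rewrite -!rmorphXn -!rmorphM -rmorphD -rmorphB rel7_3 rmorph0.
have c0 : c != 0.
  apply/eqP; rewrite -[0](rmorph0 (fps_map phi)) => /(@fps_map_inj _ _ phi intr_inj) H.
  by have := c7_neq0; rewrite H eqxx.
have NE : c * fps_map phi N = t ^+ 2.
  by rewrite -tE -rmorphXn -modeq7 rmorphM.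
pose s : seq (fps algC) := [:: - fps_map phi N; 343%:R * c ^+ 6 + 49%:R * (c ^+ 2 * t);
  343%:R * c ^+ 5 + 35%:R * (c * t); 147%:R * c ^+ 4 + 7%:R * t; 49%:R * c ^+ 3;
  21%:R * c ^+ 2; 7%:R * c; 1].
have sE : Poly s = s :> seq _ by rewrite (@PolyK _ 1) //= oner_eq0.
have sm : Poly s \is monic by rewrite monicE lead_coefE sE /=.
have ss : size (Poly s) = 8%N by rewrite sE.
(* Here [5 = -2] modulo 7 undoes the twist of [c7], of class 2, and [septic_tau] does not change. As
   [septic_identity] carries a factor [c], cancelling it needs [c] nonzero. *)
have := @euler_conjugates 7 5 w isT isT isT pw (Poly s) sm ss.
rewrite horner_Poly /= => H.
rewrite rmorphM rmorphXn /= !fps_mapV fps_map_euler -H ?mulr0 ?add0r ?opprK //.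
move=> u u7; rewrite /root !horner_cons hornerC; apply/eqP.
have EE : euler algC = A + B + C - c.
  by rewrite -(fps_map_euler phi) euler7 rmorphB !rmorphD.
pose U : fps algC := fpsC u; have U7 : U ^+ 7 = 1 by rewrite -rmorphXn u7 rmorph1.
set x := fpsC _ * _.
have xE : x = U ^+ 5 * A + U ^+ 3 * B + U ^+ 6 * C - c.
  rewrite /x EE rmorphB !rmorphD /= (fpsT_inclass u7 (inclass_map phi A7_class)).
  rewrite (fpsT_inclass u7 (inclass_map phi B7_class)) (fpsT_inclass u7 (inclass_map phi C7_class)).
  rewrite (fpsT_inclass u7 (inclass_map phi c7_class)).
  rewrite -/A -/B -/C -/c !fpsCX -/U.
  transitivity (U ^+ 5 * A + U ^+ 7 * U ^+ 3 * B + U ^+ 6 * C - U ^+ 7 * c); first by ring.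
  by rewrite U7 !mul1r.
have tU : septic_tau (U ^+ 5 * A) (U ^+ 3 * B) (U ^+ 6 * C) c = t.
  rewrite /t /septic_tau.
  transitivity (- ((U ^+ 7) ^+ 3 * (A ^+ 3 * C + C ^+ 3 * B) + (U ^+ 7) ^+ 2 * (B ^+ 3 * A)) - 8%:R * c ^+ 4).
    by ring.
  by rewrite U7; ring.
have := @septic_identity _ (U ^+ 5 * A) (U ^+ 3 * B) (U ^+ 6 * C) c.
rewrite -xE tU => SI.
have {SI} : c * (x * septic_cofactor c t x) = t ^+ 2.
  apply: SI.
  - transitivity ((U ^+ 7) ^+ 2 * (A * B * C) + c ^+ 3); first by ring.
    by rewrite U7 expr1n mul1r.
  - transitivity (U ^+ 6 * (U ^+ 7 * A ^+ 2 * B + C * c ^+ 2 - B ^+ 2 * c)); first by ring.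
    by rewrite U7 mul1r r1 mulr0.
  - transitivity (U ^+ 3 * ((U ^+ 7) ^+ 2 * C ^+ 2 * A + B * c ^+ 2 - U ^+ 7 * A ^+ 2 * c)); first by ring.
    by rewrite U7 expr1n !mul1r r2 mulr0.
  transitivity (U ^+ 5 * (U ^+ 7 * B ^+ 2 * C + A * c ^+ 2 - U ^+ 7 * C ^+ 2 * c)); first by ring.
  by rewrite U7 !mul1r r3 mulr0.
rewrite -NE => /(mulfI c0) H0.
have -> : fps_map phi N = x * septic_cofactor c t x by [].
rewrite /septic_cofactor; ring.
Qed.

(** Combining [modeq7] and [norm7] shows that the squares agree; the coefficient of [q], which is 1
    on both sides, decides the sign. *)
Lemma t7E : t7 = fq * fpsV 7 (euler int) ^+ 4.
Proof.
set s := fq * _.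
have : t7 ^+ 2 = s ^+ 2.
  rewrite -modeq7 /s exprMn -exprM -norm7 /c7; ring.
have s1 : s 1%N = 1 by rewrite /s fqM fpsX0 fpsVE dvdn0 div0n euler0 expr1n.
have t1 : t7 1%N = 1.
  have eA : eqm 2 A7 1.
    by apply: eqmI => -[|[|//]] _; rewrite /A7 fpsKE fps1 // eqxx euler0.
  have eB : eqm 2 B7 0 by apply: eqmI => -[|[|//]] _; rewrite /B7 fpsKE.
  have eC : eqm 2 C7 (- fq).
    apply: eqmI => -[|[|//]] _; rewrite /C7 fpsKE fpsN; first by rewrite oppr0.
    by rewrite eqxx (@euler_coef _ 1 5).
  have ec : eqm 2 c7 0 by apply: eqm_fqX.
  have : eqm 2 t7 (septic_tau 1 0 (- fq) 0).
    rewrite /t7 /septic_tau; apply: eqmD; apply: eqmN; last first.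
      by apply: eqmM => //; apply: eqmX.
    by do 2?[apply: eqmD]; apply: eqmM => //; apply: eqmX.
  move/eqmE => -> //; rewrite (_ : septic_tau _ _ _ _ = fq) //.
  by rewrite /septic_tau; ring.
move/eqP; rewrite eqf_sqr => /orP[/eqP //|/eqP H].
by move: t1; rewrite H fpsN s1.
Qed.

Lemma U7_base i : (i < 7)%N -> fpsU 7 (fq ^+ 2 * (c7 ^+ i * (euler int) ^+ (6 - i))) =
  (nth 0 [:: 49; 49; -7; -7; 1; -1; 1] i)%:~R * (fq ^+ 2 * fpsV 7 (euler int) ^+ 6) +
  (nth 0 [:: 0; 10; -4; 0; 0; 0; 0] i)%:~R * (fq * (euler int) ^+ 4 * fpsV 7 (euler int) ^+ 2).
Proof.
move=> i7; rewrite (@fpsU_qK _ 7 5) // K7_base // t7E.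
set a := _%:~R; set b := _%:~R.
have -> : fq ^+ 2 * (a * c7 ^+ 6 + b * (fq * fpsV 7 (euler int) ^+ 4 * c7 ^+ 2)) =
  1 * fpsV 7 (a * (fq ^+ 2 * fpsV 7 (euler int) ^+ 6) + b * (fq * euler int ^+ 4 * fpsV 7 (euler int) ^+ 2)).
  rewrite [fpsV 7 (_ + _)]rmorphD /= [fpsV 7 (a * _)]rmorphM [fpsV 7 (b * _)]rmorphM /a /b !rmorph_int -/a -/b /=.
  rewrite [fpsV 7 (fq ^+ 2 * _)]rmorphM [fpsV 7 (fq * _ * _)]rmorphM /= [fpsV 7 (fq * _)]rmorphM !rmorphXn /=.
  by rewrite fpsVV // fpsV_q // /c7 -/a -/b; ring.
by rewrite mul1r fpsUV.
Qed.

(** * Iterating the operator U *)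

Opaque fps_add fps_mul fps_opp.

(** Keeping the polynomial apart from its value at [t] gives access to the divisibility of its
    coefficients. *)
Definition zeval (t : fps int) (p : {poly int}) : fps int := (map_poly intr p).[t].

Section Zeval.
Variable t : fps int.
Lemma zevalD p r : zeval t (p + r) = zeval t p + zeval t r.
Proof. by rewrite /zeval rmorphD hornerD. Qed.
Lemma zeval0 : zeval t 0 = 0.
Proof. by rewrite /zeval rmorph0 horner0. Qed.
Lemma zevalM p r : zeval t (p * r) = zeval t p * zeval t r.
Proof. by rewrite /zeval rmorphM hornerM. Qed.
Lemma zevalZ (k : int) p : zeval t (k *: p) = k%:~R * zeval t p.
Proof. by rewrite /zeval map_polyZ hornerZ. Qed.
Lemma zevalXn n : zeval t 'X^n = t ^+ n.
Proof. by rewrite /zeval map_polyXn hornerXn. Qed.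
Lemma zevalC (k : int) : zeval t k%:P = k%:~R.
Proof. by rewrite /zeval map_polyC hornerC. Qed.
Lemma zevalE p : zeval t p = \sum_(i < size p) (p`_i)%:~R * t ^+ i.
Proof.
rewrite -{1}[p]coefK poly_def.
elim/big_rec2: _ => [|i x y _ <-]; first by rewrite zeval0.
by rewrite zevalD zevalZ zevalXn.
Qed.
End Zeval.

(* [K] shifts the powers of [F]: the expansions start from [F ^ a] with [a]
   negative. *)
Section Admissible.
Variables (l d K : nat).

(** The second clause is the valuation bound [floor ((l j + K - d a - 1) / (2 d))]; quantifying over
    [e] avoids truncated subtraction and division. *)
Definition adm (a : nat) (m : {poly int}) :=
  (forall j, (l * j + K < d * a)%N -> m`_j = 0) /\
  (forall e j, (2 * d * e + d * a + 1 <= l * j + K)%N -> (l%:Z ^+ e %| m`_j)%Z).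

Lemma admD a m m' : adm a m -> adm a m' -> adm a (m + m').
Proof.
move=> [z1 d1] [z2 d2]; split=> [j H|e j H]; rewrite coefD.
  by rewrite z1 ?z2 ?addr0.
by apply: rpredD; [apply: d1|apply: d2].
Qed.

(** This treats one term [k F^(a - s) t^r] of the recurrence. The left inequality preserves the
    order of vanishing in [t]; the right one says that the valuation [v] of [k] pays for the shift
    by [r]. *)
Lemma adm_step a b s v r (k : int) m : adm b m -> a = (b + s)%N ->
  (l%:Z ^+ v %| k)%Z -> (d * s <= l * r <= 2 * d * v + d * s)%N ->
  adm a (k *: (m * 'X^r)).
Proof.
move=> [mz md] -> lk /andP[sr rs]; split=> [j H|e j H]; rewrite coefZ coefMXn.
  by case: ltnP => jr; rewrite ?mulr0 // mz ?mulr0 //; nia.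
case: ltnP => jr; first by rewrite mulr0 dvdz0.
have [ev|ve] := leqP e v.
  by rewrite dvdz_mulr // (dvdz_trans _ lk) // dvdz_exp2l.
have -> : e = (v + (e - v))%N by lia.
by rewrite exprD dvdz_mul // md //; nia.
Qed.
End Admissible.

(** * The functions F and t and the expansion of U (F ^ a) *)

Section Inverse.
Variables (l d w : nat).
Local Notation q := (fq : fps int).
Local Notation E := (euler int).
Local Notation V := (fpsV l).

Definition euler_inv : fps int := projT1 (cid (fps_inv_ex (euler0 int))).
Lemma euler_invK : euler_inv * E = 1.
Proof. exact: (projT2 (cid (fps_inv_ex (euler0 int)))). Qed.

(* [mod_F] is [eta (l ^ 2 tau) / eta (tau)] and [mod_t] is
   [(eta (l tau) / eta (tau)) ^ w], for [24 d = l ^ 2 - 1] and [d w = l + 1]. *)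
Definition mod_F := euler_inv * (q ^+ d * fpsV (l ^ 2) E).
Definition mod_t := q * (euler_inv * V E) ^+ w.
Local Notation F := mod_F.
Local Notation t := mod_t.

Lemma mod_FE : F * E = q ^+ d * fpsV (l ^ 2) E.
Proof. by rewrite /F mulrAC euler_invK mul1r. Qed.

Lemma mod_tE : t * E ^+ w = q * V E ^+ w.
Proof. by rewrite /t -mulrA -exprMn mulrAC euler_invK mul1r. Qed.

Lemma euler_neq0 : E != 0.
Proof. by apply/eqP => H; have := euler0 int; rewrite H. Qed.

Lemma eulerV_neq0 m : fpsV m E != 0.
Proof.
apply/eqP => /(congr1 (fun f : fps int => f 0%N)).
by rewrite fpsVE dvdn0 div0n euler0.
Qed.

Lemma mod_tV : (0 < l)%N -> V t * V E ^+ w = q ^+ l * fpsV (l ^ 2) E ^+ w.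
Proof.
by move=> l0; rewrite -rmorphXn -rmorphM mod_tE rmorphM rmorphXn /= fpsV_q // fpsVV.
Qed.

(** The eta quotients telescope. The identity is used to replace powers of [t] under [U] by powers
    of [F], whose images are known. *)
Lemma mod_Fw : (0 < l)%N -> (d * w = l.+1)%N -> F ^+ w = t * V t.
Proof.
move=> l0 dw; have H := mulf_neq0 (expf_neq0 w euler_neq0) (expf_neq0 w (eulerV_neq0 l)).
apply: (mulIf H); rewrite mulrA -exprMn mod_FE exprMn -exprM dw.
transitivity (t * E ^+ w * (V t * V E ^+ w)); last by ring.
by rewrite mod_tE mod_tV // exprS; ring.
Qed.
End Inverse.

Section Expansion5.
Local Notation q := (fq : fps int).
Local Notation E := (euler int).
Local Notation F := (mod_F 5 1).
Local Notation t := (mod_t 5 6).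

Lemma mod_eq5 : F ^+ 5 = (1 + 5%:R * F + 15%:R * F ^+ 2 + 25%:R * F ^+ 3 + 25%:R * F ^+ 4) * fpsV 5 t.
Proof.
apply: (mulIf (expf_neq0 6 (eulerV_neq0 5))).
have Fc : F * E = c5 by rewrite mod_FE.
rewrite -[RHS]mulrA mod_tV // -norm5 -modeq5.
have -> : q ^+ 5 * fpsV (5 ^ 2) E ^+ 6 = (F * E) ^+ 5 * fpsV 25 E by rewrite Fc /c5; ring.
by rewrite -Fc; ring.
Qed.

(** The factor [E^4] makes [E^4 F^a = c5^a E^(4 - a)] for [a < 5], so [U5_base] starts the
    recurrence of order 5 given by [mod_eq5]. *)
Lemma U5_expand a : exists2 m, fpsU 5 (q * (E ^+ 4 * F ^+ a)) = q * fpsV 5 E ^+ 4 * zeval t m &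
  adm 5 1 4 a m.
Proof.
elim/ltn_ind: a => a IH; have [a5|a5] := ltnP a 5.
  exists (nth 0 [:: -5; 5; -1; -1; 1] a)%:P.
    rewrite zevalC [RHS]mulrC -U5_base //; congr (fpsU 5 (q * _)).
    have -> : c5 = F * E by rewrite mod_FE.
    transitivity (F ^+ a * E ^+ (a + (4 - a))); first by rewrite (subnKC (a5 : (a <= 4)%N)) mulrC.
    by rewrite exprD [(F * E) ^+ a]exprMn mulrA.
  split=> [j|e j]; rewrite coefC; first by move=> H; case: eqP => // j0; lia.
  case: eqP => [->|]; last by rewrite dvdz0.
  by case: a {IH} a5 => [|[|[|[|[|//]]]]] _ /=; case: e => [|[|e]] //; lia.
have rec s : (0 < s)%N -> (s <= 5)%N -> exists2 m,
    fpsU 5 (q * (E ^+ 4 * F ^+ (a - s))) = q * fpsV 5 E ^+ 4 * zeval t m &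
    adm 5 1 4 (a - s) m.
  by move=> s0 s5; apply: IH; lia.
have [m1 e1 h1] := rec 1 isT isT; have [m2 e2 h2] := rec 2 isT isT.
have [m3 e3 h3] := rec 3 isT isT; have [m4 e4 h4] := rec 4 isT isT.
have [m5 e5 h5] := rec 5 isT isT.
exists (25 *: (m1 * 'X^1) + 25 *: (m2 * 'X^1) + 15 *: (m3 * 'X^1) + 5 *: (m4 * 'X^1) + 1 *: (m5 * 'X^1)).
  have -> : q * (E ^+ 4 * F ^+ a) = (q * (E ^+ 4 * F ^+ (a - 5)) + 5%:R * (q * (E ^+ 4 * F ^+ (a - 4)))
     + 15%:R * (q * (E ^+ 4 * F ^+ (a - 3))) + 25%:R * (q * (E ^+ 4 * F ^+ (a - 2)))
     + 25%:R * (q * (E ^+ 4 * F ^+ (a - 1)))) * fpsV 5 t.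
    have fa s : (s <= 5)%N -> F ^+ (a - s) = F ^+ (a - 5) * F ^+ (5 - s).
      by move=> s5; rewrite -exprD; congr (_ ^+ _); lia.
    rewrite (fa 4) // (fa 3) // (fa 2) // (fa 1) // -{1}(subnK a5) exprD mod_eq5 /=.
    by rewrite ?subn1 /=; ring.
  rewrite fpsU_mulV // !fpsUD !fpsU_natM e1 e2 e3 e4 e5.
  rewrite !zevalD !zevalZ !zevalM !zevalXn; ring.
(* The values [v] are the 5-adic valuations of the coefficients 25, 25, 15, 5, 1 of the modular
   equation. *)
by do ![apply: admD]; [apply: (adm_step (s := 1) (v := 2) h1)|apply: (adm_step (s := 2) (v := 2) h2)
  |apply: (adm_step (s := 3) (v := 1) h3)|apply: (adm_step (s := 4) (v := 1) h4)
  |apply: (adm_step (s := 5) (v := 0) h5)] => //; lia.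
Qed.

(** Since [F E = q * fpsV 25 E], the series [q E^4 F^(a + 4)] is [F^a] times the image under
    [fpsV 5] of [q * fpsV 5 E ^+ 4], which leaves [U] and cancels. *)
Lemma U5_F a : exists2 m, fpsU 5 (F ^+ a) = zeval t m &
  (forall j, (5 * j < a)%N -> m`_j = 0) /\
  (forall e j, (2 * e + a + 1 <= 5 * j)%N -> (5%:Z ^+ e %| m`_j)%Z).
Proof.
have [m mE [m0 md]] := U5_expand (a + 4).
have : fpsU 5 (F ^+ a) * (q * fpsV 5 E ^+ 4) = zeval t m * (q * fpsV 5 E ^+ 4).
  rewrite [RHS]mulrC -mE -fpsU_mulV //; congr fpsU.
  rewrite rmorphM rmorphXn /= fpsV_q // fpsVV // exprD -[in RHS]mulrA.
  transitivity (F ^+ a * (q * (q ^+ 1 * fpsV (5 ^ 2) E) ^+ 4)); first by ring.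
  by rewrite -mod_FE; ring.
have nz : q * fpsV 5 E ^+ 4 != 0.
  rewrite mulf_neq0 ?expf_neq0 ?eulerV_neq0 //.
  by apply/eqP => /(congr1 (fun f : fps int => f 1%N)).
move/(mulIf nz) => ->; exists m => //; split=> [j H|e j H]; [apply: m0|apply: md]; lia.
Qed.
End Expansion5.

Section Expansion7.

(* The coefficients are variables because comparing numerals of [fps int] by
   conversion does not terminate in practice. *)
Let lin (G : nat -> fps int) (f g : fps int) (k1 k2 k3 k4 k5 k6 k7 k8 k9 : nat) :
  fpsU 7 ((G 7 + k1%:R * G 6 + k2%:R * G 5 + k3%:R * G 4 + k4%:R * G 3 + k5%:R * G 2 + k6%:R * G 1)
    * fpsV 7 f + (k7%:R * G 3 + k8%:R * G 2 + k9%:R * G 1) * fpsV 7 g) =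
  (fpsU 7 (G 7) + k1%:R * fpsU 7 (G 6) + k2%:R * fpsU 7 (G 5) + k3%:R * fpsU 7 (G 4)
    + k4%:R * fpsU 7 (G 3) + k5%:R * fpsU 7 (G 2) + k6%:R * fpsU 7 (G 1)) * f +
  (k7%:R * fpsU 7 (G 3) + k8%:R * fpsU 7 (G 2) + k9%:R * fpsU 7 (G 1)) * g.
Proof. by rewrite fpsUD !fpsU_mulV // !fpsUD !fpsU_natM. Qed.

Local Notation q := (fq : fps int).
Local Notation E := (euler int).
Local Notation F := (mod_F 7 2).
Local Notation t := (mod_t 7 4).

(** In [norm7], terms without [t7] acquire [c7^7] and hence [fpsV 7 t ^+ 2]; terms linear in [t7]
    acquire [t7 c7^3] and hence a single [fpsV 7 t]. *)
Lemma mod_eq7 : F ^+ 7 =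
  (1 + 7%:R * F + 21%:R * F ^+ 2 + 49%:R * F ^+ 3 + 147%:R * F ^+ 4 + 343%:R * F ^+ 5 +
   343%:R * F ^+ 6) * fpsV 7 t ^+ 2 +
  (7%:R * F ^+ 4 + 35%:R * F ^+ 5 + 49%:R * F ^+ 6) * fpsV 7 t.
Proof.
apply: (mulIf (expf_neq0 8 (eulerV_neq0 7))).
have Fc : F * E = c7 by rewrite mod_FE.
have Vt : fpsV 7 t * fpsV 7 E ^+ 4 = q ^+ 7 * fpsV 49 E ^+ 4 by rewrite mod_tV.
have Vt2 : fpsV 7 t ^+ 2 * fpsV 7 E ^+ 8 = c7 ^+ 7 * fpsV 49 E.
  transitivity ((fpsV 7 t * fpsV 7 E ^+ 4) ^+ 2); first by ring.
  by rewrite Vt /c7; ring.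
have Vt1 : fpsV 7 t * fpsV 7 E ^+ 8 = t7 * c7 ^+ 3 * fpsV 49 E.
  transitivity ((fpsV 7 t * fpsV 7 E ^+ 4) * fpsV 7 E ^+ 4); first by ring.
  by rewrite Vt t7E /c7; ring.
rewrite -[in LHS]norm7 mulrDl -[X in _ = X + _]mulrA -[X in _ = _ + X]mulrA Vt1 Vt2.
by rewrite -Fc /septic_cofactor; ring.
Qed.

(** The factor [E^6] plays the role of [E^4] for 5. The shift is [K = 5 = 2 * 6 - 7]: 12 for passing
    from [a] to [a + 6], less 7 for one extra factor [t], which [U7_F] removes. *)
Lemma U7_expand a : exists2 m,
  fpsU 7 (q ^+ 2 * (E ^+ 6 * F ^+ a)) = q * E ^+ 4 * fpsV 7 E ^+ 2 * zeval t m &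
  adm 7 2 5 a m.
Proof.
elim/ltn_ind: a => a IH; have [a7|a7] := ltnP a 7.
  exists ((nth 0 [:: 0; 10; -4; 0; 0; 0; 0] a)%:P +
      (nth 0 [:: 49; 49; -7; -7; 1; -1; 1] a) *: 'X).
    have -> : q ^+ 2 * (E ^+ 6 * F ^+ a) = q ^+ 2 * (c7 ^+ a * E ^+ (6 - a)).
      have -> : c7 = F * E by rewrite mod_FE.
      congr (_ * _); transitivity (F ^+ a * E ^+ (a + (6 - a))).
        by rewrite (subnKC (a7 : (a <= 6)%N)) mulrC.
      by rewrite exprD [(F * E) ^+ a]exprMn mulrA.
    rewrite U7_base // zevalD zevalC zevalZ -(expr1 'X) zevalXn expr1.
    have -> : q ^+ 2 * fpsV 7 E ^+ 6 = q * fpsV 7 E ^+ 2 * (t * E ^+ 4).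
      by rewrite mod_tE; ring.
    ring.
  split=> [j|e j]; rewrite coefD coefC coefZ coefX.
    by case: a {IH} a7 => [|[|[|[|[|[|[|//]]]]]]] _ /=; case: j => [|[|j]] //=; lia.
  case: a {IH} a7 => [|[|[|[|[|[|[|//]]]]]]] _ /=; case: j => [|[|j]] //=;
   rewrite ?mulr1 ?mulr0 ?addr0 ?add0r ?dvdz0 //; case: e => [|[|[|e]]] //; lia.
have rec s : (0 < s)%N -> (s <= 7)%N -> exists2 m,
    fpsU 7 (q ^+ 2 * (E ^+ 6 * F ^+ (a - s))) = q * E ^+ 4 * fpsV 7 E ^+ 2 * zeval t m &
    adm 7 2 5 (a - s) m.
  by move=> s0 s7; apply: IH; lia.
have [m1 e1 h1] := rec 1 isT isT; have [m2 e2 h2] := rec 2 isT isT.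
have [m3 e3 h3] := rec 3 isT isT; have [m4 e4 h4] := rec 4 isT isT.
have [m5 e5 h5] := rec 5 isT isT; have [m6 e6 h6] := rec 6 isT isT.
have [m7 e7 h7] := rec 7 isT isT.
exists (1 *: (m7 * 'X^2) + 7 *: (m6 * 'X^2) + 21 *: (m5 * 'X^2) + 49 *: (m4 * 'X^2) +
  147 *: (m3 * 'X^2) + 343 *: (m2 * 'X^2) + 343 *: (m1 * 'X^2) +
  7 *: (m3 * 'X^1) + 35 *: (m2 * 'X^1) + 49 *: (m1 * 'X^1)).
  pose G s := q ^+ 2 * (E ^+ 6 * F ^+ (a - s)).
  have -> : q ^+ 2 * (E ^+ 6 * F ^+ a) =
      (G 7 + 7%:R * G 6 + 21%:R * G 5 + 49%:R * G 4 + 147%:R * G 3 + 343%:R * G 2 + 343%:R * G 1)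
        * fpsV 7 (t ^+ 2) + (7%:R * G 3 + 35%:R * G 2 + 49%:R * G 1) * fpsV 7 t.
    have fa s : (s <= 7)%N -> G s = G 7 * F ^+ (7 - s).
      move=> s7; rewrite /G (_ : F ^+ (a - s) = F ^+ (a - 7) * F ^+ (7 - s)); first by ring.
      by rewrite -exprD; congr (_ ^+ _); lia.
    rewrite (fa 6) // (fa 5) // (fa 4) // (fa 3) // (fa 2) // (fa 1) // -{1}(subnK a7) exprD.
    by rewrite mod_eq7 rmorphXn /G /=; ring.
  rewrite -/(G 1) in e1; rewrite -/(G 2) in e2; rewrite -/(G 3) in e3.
  rewrite -/(G 4) in e4; rewrite -/(G 5) in e5; rewrite -/(G 6) in e6.
  rewrite -/(G 7) in e7; clearbody G.
  rewrite lin e1 e2 e3 e4 e5 e6 e7.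
  rewrite !zevalD !zevalZ !zevalM !zevalXn; ring.
by do ![apply: admD]; [apply: (adm_step (s := 7) (v := 0) h7)|apply: (adm_step (s := 6) (v := 1) h6)
  |apply: (adm_step (s := 5) (v := 1) h5)|apply: (adm_step (s := 4) (v := 2) h4)
  |apply: (adm_step (s := 3) (v := 2) h3)|apply: (adm_step (s := 2) (v := 3) h2)
  |apply: (adm_step (s := 1) (v := 3) h1)|apply: (adm_step (s := 3) (v := 1) h3)
  |apply: (adm_step (s := 2) (v := 1) h2)|apply: (adm_step (s := 1) (v := 2) h1)] => //; lia.
Qed.

Lemma U7_F a : exists2 m, fpsU 7 (F ^+ a) = zeval t m &
  (forall j, (7 * j < 2 * a)%N -> m`_j = 0) /\
  (forall e j, (4 * e + 2 * a + 1 <= 7 * j)%N -> (7%:Z ^+ e %| m`_j)%Z).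
Proof.
have [m mE [m0 md]] := U7_expand (a + 6).
have [m' mX] : exists m', m = m' * 'X.
  exists (\poly_(i < size m) m`_i.+1); apply/polyP => -[|i].
    by rewrite coefMX /= m0 //; lia.
  by rewrite coefMX /= coef_poly; case: ltnP => // im; rewrite nth_default //; lia.
have : fpsU 7 (F ^+ a) * (q ^+ 2 * fpsV 7 E ^+ 6) = zeval t m' * (q ^+ 2 * fpsV 7 E ^+ 6).
  have -> : zeval t m' * (q ^+ 2 * fpsV 7 E ^+ 6) = q * E ^+ 4 * fpsV 7 E ^+ 2 * zeval t m.
    have -> : q ^+ 2 * fpsV 7 E ^+ 6 = q * fpsV 7 E ^+ 2 * (t * E ^+ 4).
      by rewrite mod_tE; ring.
    by rewrite mX zevalM -(expr1 'X) zevalXn; ring.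
  rewrite -mE -fpsU_mulV //; congr fpsU.
  rewrite rmorphM !rmorphXn /= fpsV_q // fpsVV // exprD.
  transitivity (F ^+ a * (q ^+ 2 * (q ^+ 2 * fpsV (7 ^ 2) E) ^+ 6)); first by ring.
  by rewrite -mod_FE; ring.
have nz : q ^+ 2 * fpsV 7 E ^+ 6 != 0.
  rewrite mulf_neq0 ?expf_neq0 ?eulerV_neq0 //.
  by apply/eqP => /(congr1 (fun f : fps int => f 1%N)).
move/(mulIf nz) => ->; exists m'; split=> [j H|e j H].
  by have := m0 j.+1; rewrite mX coefMX /=; apply; lia.
by have := md e j.+1; rewrite mX coefMX /=; apply; lia.
Qed.
End Expansion7.

(** * Powers of l gained by iterating U *)

Section Congruence.
Variables (l d w : nat).
Local Notation q := (fq : fps int).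
Local Notation E := (euler int).
Local Notation V := (fpsV l).
Local Notation U := (fpsU l).
Local Notation F := (mod_F l d).
Local Notation t := (mod_t l w).
Hypotheses (l5 : (5 <= l)%N) (d0 : (0 < d)%N) (dw : (d * w = l.+1)%N).
Hypotheses (l24 : (24 * d + 1 = l ^ 2)%N) (dl : (4 * d < l)%N || (l == 7) && (d == 2)).
Hypothesis HF : forall a, exists2 m, U (F ^+ a) = zeval t m &
  (forall j, (l * j < d * a)%N -> m`_j = 0) /\
  (forall e j, (2 * d * e + d * a + 1 <= l * j)%N -> (l%:Z ^+ e %| m`_j)%Z).

Let l0 : (0 < l)%N. Proof. exact: leq_trans l5. Qed.

(* [U] maps [modM 0] to [modM 1], that is, to [l] times [modM 0]. *)
Definition modM (s : nat) (x : fps int) := exists2 p, x = t * zeval t p &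
  forall j, (l%:Z ^+ (j + s) %| p`_j)%Z.

Lemma modM0 s : modM s 0.
Proof. by exists 0 => [|j]; rewrite ?zeval0 ?mulr0 // coef0 dvdz0. Qed.

Lemma modMD s x y : modM s x -> modM s y -> modM s (x + y).
Proof.
move=> [p -> Hp] [r -> Hr]; exists (p + r) => [|j].
  by rewrite zevalD mulrDr.
by rewrite coefD; apply: rpredD; [apply: Hp|apply: Hr].
Qed.

Lemma modM1 x : modM 1 x -> exists2 y, modM 0 y & x = l%:R * y.
Proof.
have lz : l%:Z != 0 by move: l0; case: (l).
move=> [p -> Hp]; exists (t * zeval t (map_poly (fun c => c %/ l%:Z)%Z p)).
  exists (map_poly (fun c => c %/ l%:Z)%Z p) => // j.
  rewrite coef_map_id0 ?div0z //; have := Hp j.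
  rewrite addn0 addn1 exprSr => /dvdzP[c ->].
  by rewrite mulrA mulzK // dvdz_mull.
rewrite -[X in zeval t X](_ : l%:Z *: map_poly (fun c => c %/ l%:Z)%Z p = p).
  by rewrite zevalZ -pmulrn; ring.
apply/polyP => j; rewrite coefZ coef_map_id0 ?div0z //.
have := Hp j; rewrite addn1 exprSr => /dvdzP[c ->].
by rewrite mulrA mulzK // [LHS]mulrC.
Qed.

(** By [mod_Fw], [t^(i + 1)] times the image of [F^k t^(i + 1)] is that of [F^(k + w (i + 1))],
    whose expansion starts at degree [i + 2] or later; cancelling leaves a multiple of [t]. There
    are two uses: [s = 1, k = 0], which gains a factor [l], and [s = 0] with [k] at most 2, which
    loses nothing. *)
Lemma modM_U s k x : (s + k <= 2)%N -> (s * k = 0)%N -> (s <= 1)%N -> modM 0 x -> modM s (U (F ^+ k * x)).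
Proof.
move=> sk sk0 s1 [p -> Hp].
rewrite zevalE !mulr_sumr raddf_sum /=.
elim/big_ind: _ => [||i _]; [exact: modM0|exact: modMD|].
have [m mE [m0 md]] := HF (k + w * i.+1).
have dk : (d * (k + w * i.+1) = d * k + l.+1 * i.+1)%N by rewrite mulnDr mulnA dw.
pose m' := \poly_(j < size m) m`_(i.+2 + j).
have mm' : m = m' * 'X^(i.+2).
  apply/polyP => j; rewrite coefMXn; case: ltnP => ij; first by rewrite m0 // dk; nia.
  rewrite coef_poly subnKC //; case: ltnP => // mj.
  by apply: nth_default; apply: leq_trans mj (leq_subr _ _).
have F0 : t ^+ i.+1 != 0.
  rewrite expf_neq0 //; apply/eqP => H; have := mod_tE l w; rewrite H mul0r.
  by apply/eqP; rewrite eq_sym mulf_neq0 ?expf_neq0 ?eulerV_neq0 //; apply/eqP => /(congr1 (fun f : fps int => f 1%N)).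
have Ut : U (F ^+ k * t ^+ i.+1) = t * zeval t m'.
  apply: (mulIf F0); rewrite -fpsU_mulV // rmorphXn /=.
  have -> : F ^+ k * t ^+ i.+1 * V t ^+ i.+1 = F ^+ (k + w * i.+1).
    by rewrite exprD exprM (mod_Fw l0 dw) [(t * V t) ^+ _]exprMn; ring.
  by rewrite mE mm' zevalM zevalXn !exprS; ring.
exists ((p`_i) *: m') => [|j].
  rewrite zevalZ (_ : F ^+ k * (t * _) = (p`_i)%:~R * (F ^+ k * t ^+ i.+1)); last by rewrite exprS; ring.
  have -> f c : U (c%:~R * f) = c%:~R * U f by apply: fpsP => n; rewrite fpsUE !fps_intrM.
  by rewrite Ut; ring.
rewrite coefZ coef_poly; case: ltnP => jm; last by rewrite mulr0 dvdz0.
have := Hp i; rewrite addn0 => Hi.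
have [js|js] := leqP (j + s) i; first by rewrite dvdz_mulr // (dvdz_trans _ Hi) // dvdz_exp2l.
have -> : (j + s = i + (j + s - i))%N by lia.
rewrite exprD dvdz_mul // md // dk.
have : (s = 0 \/ k = 0)%N by lia.
have [u ju] : exists u, (j + s = i + u)%N by exists (j + s - i)%N; lia.
have -> : (j + s - i = u)%N by lia.
(* The general estimate uses [4 d < l], true for [l = 5]. The pair [l = 7], [d = 2] just misses it
   and is settled by its own arithmetic. *)
move=> sk'; case/orP: dl => [dl'|/andP[/eqP -> /eqP ->]]; last by lia.
have H1 : (2 * d * u + d * k + i <= 2 * d * j.+1)%N.
  have /(leq_mul (leqnn d)) H2 : (2 * u + k + i <= 2 * j.+1)%N by case: sk'; lia.
  have : (i <= d * i)%N by rewrite leq_pmull.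
  lia.
have : ((4 * d + 1) * j.+1 <= l * j.+1)%N by rewrite leq_mul2r; lia.
have : (d <= d * j.+1)%N by rewrite leq_pmulr.
lia.
Qed.
Variable k : nat.
Hypothesis k12 : (0 < k <= 2)%N.

Lemma modM_base : modM 0 (U (F ^+ k)).
Proof.
have [m -> [m0 md]] := HF k.
pose m' := \poly_(j < size m) m`_(j.+1).
have mm' : m = m' * 'X^1.
  apply/polyP => j; rewrite coefMXn; case: ltnP => ij; first by rewrite m0 //; nia.
  rewrite coef_poly subn1 prednK //; case: ltnP => // mj.
  by apply: nth_default; apply: ltnW.
exists m' => [|j]; first by rewrite {1}mm' zevalM zevalXn mulrC.
rewrite coef_poly; case: ltnP => jm; last by rewrite dvdz0.
apply: md; rewrite addn0.
case/orP: dl => [dl'|/andP[/eqP -> /eqP ->]]; last by lia.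
by nia.
Qed.

(** Up to the relabelling of exponents in [sections_coef], this is the part of [1 / E^k] on the
    exponents [m] with [24 m = k] modulo [l^r]. The shift [k d = k (l^2 - 1) / 24] aligns the
    residue class at every other step. *)
Fixpoint sections r : fps int :=
  if r is r'.+1 then U ((if odd r' then 1 else q ^+ (k * d)) * sections r')
  else euler_inv ^+ k.

Lemma sections_odd r : sections r.*2.+1 = U (q ^+ (k * d) * sections r.*2).
Proof. by rewrite [LHS]/= odd_double. Qed.

Lemma sections_even r : sections r.*2.+2 = U (sections r.*2.+1).
Proof. by rewrite [LHS]/= odd_double /= mul1r odd_double. Qed.

Opaque sections.

(** It turns the shift by [q ^+ (k * d)] into a factor [F^k], at the price of a series in [q^l] that
    leaves [U]. *)
Let FkE x : F ^+ k * (E ^+ k * x) = q ^+ (k * d) * x * V (V E ^+ k).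
Proof.
rewrite mulrA -exprMn mod_FE exprMn -exprM rmorphXn /= fpsVV // mulnn.
by rewrite [(d * k)%N]mulnC; ring.
Qed.

(** The shifted step is [modM_U] with [s = 0] and keeps the power of [l]; the step without shift is
    [modM_U] with [s = 1], and [modM1] extracts the new factor. *)
Lemma sections_modM r :
  (exists2 x, modM 0 x & V E ^+ k * sections r.*2.+1 = l%:R ^+ r * x) /\
  (exists2 x, modM 0 x & E ^+ k * sections r.*2.+2 = l%:R ^+ r.+1 * x).
Proof.
have step r' : (exists2 x, modM 0 x & V E ^+ k * sections r'.*2.+1 = l%:R ^+ r' * x) ->
    exists2 x, modM 0 x & E ^+ k * sections r'.*2.+2 = l%:R ^+ r'.+1 * x.
  move=> [x Mx xE]; have [y My yE] := modM1 (@modM_U 1 0 _ isT erefl isT Mx).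
  exists y => //; rewrite sections_even mulrC -fpsU_mulV //.
  rewrite rmorphXn [X in U X]mulrC /= xE -natrX.
  have -> : U ((l ^ r')%:R * x) = (l ^ r')%:R * U x by apply: fpsU_natM.
  by rewrite expr0 mul1r in yE; rewrite yE natrX exprSr; ring.
elim: r => [|r [IH1 [x Mx xE]]].
  suff H : exists2 x, modM 0 x & V E ^+ k * sections 1 = l%:R ^+ 0 * x.
    by split => //; exact: (step 0%N H).
  exists (U (F ^+ k)); first exact: modM_base.
  rewrite mul1r (sections_odd 0) mulrC -fpsU_mulV //; congr (U _).
  have <- := FkE (euler_inv ^+ k); rewrite -exprMn [E * _]mulrC euler_invK.
  by rewrite expr1n mulr1.
suff H : exists2 x, modM 0 x & V E ^+ k * sections r.*2.+3 = l%:R ^+ r.+1 * x.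
  by split => //; exact: (step r.+1 H).
have k2 : (0 + k <= 2)%N by lia.
exists (U (F ^+ k * x)); first exact: modM_U.
rewrite -doubleS sections_odd doubleS mulrC -fpsU_mulV // -FkE xE -natrX -fpsU_natM; congr (U _); ring.
Qed.

Lemma sections_dvd r : exists h, sections r = (l ^ r./2)%:R * h.
Proof.
have div (f g x y : fps int) N : g * f = 1 -> f ^+ k * x = l%:R ^+ N * y ->
    exists h, x = (l ^ N)%:R * h.
  move=> gf H; exists (g ^+ k * y); rewrite mulrCA natrX -H mulrA -exprMn gf.
  by rewrite expr1n mul1r.
case: r => [|r]; first by exists (sections 0); rewrite mul1r.
have [[x _ H1] [y _ H2]] := sections_modM r./2.
have [rs|rs] : (r.+1 = r./2.*2.+1 \/ r.+1 = r./2.*2.+2)%N by lia.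
  have -> : (r.+1./2 = r./2)%N by lia.
  rewrite rs; apply: (div _ (V euler_inv) _ _ _ _ H1).
  by rewrite -rmorphM euler_invK rmorph1.
have -> : (r.+1./2 = r./2.+1)%N by lia.
by rewrite rs; apply: div H2; apply: euler_invK.
Qed.

(** A shift made at an even stage [r] contributes [24 k d l^r = k (l^(r + 2) - l^r)]; these
    contributions telescope to [k l^u - k] with [u = (uphalf r).*2]. *)
Lemma sections_coef r n m :
  (24 * m + k * l ^ (uphalf r).*2 = 24 * l ^ r * n + k)%N ->
  sections r n = (euler_inv ^+ k) m.
Proof.
Transparent sections.
elim: r n => [|r IH] n H; first by congr (_ _); move: H; rewrite !expn0; lia.
rewrite [sections _]/= fpsUE; case: ifPn => [ro|re].
  rewrite mul1r; apply: IH.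
  have E1 : (24 * l ^ r.+1 * n = 24 * l ^ r * (l * n))%N by rewrite expnSr; lia.
  have u1 : uphalf r.+1 = uphalf r by lia.
  by rewrite -E1 -H u1.
rewrite fqXM.
have ur : (uphalf r).*2 = r by lia.
have ur' : (uphalf r.+1).*2 = r.+2 by lia.
have H' : (24 * m + k * ((24 * d + 1) * l ^ r) = 24 * (l ^ r * (l * n)) + k)%N.
  have E1 : (24 * l ^ r.+1 * n = 24 * (l ^ r * (l * n)))%N by rewrite expnSr; lia.
  by rewrite -E1 -H ur' l24 -expnD add2n.
have lr : (0 < l ^ r)%N by rewrite expn_gt0 l0.
(* [fqXM] gives 0 for indices below the shift, so this case has to be excluded. *)
have kdn : (k * d <= l * n)%N.
  rewrite leqNgt; apply/negP => lt.
  have : (l ^ r * (l * n).+1 <= l ^ r * (k * d))%N by rewrite leq_mul2l lt orbT.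
  have : (k <= k * l ^ r)%N by rewrite leq_pmulr.
  by move: H'; lia.
rewrite kdn; apply: IH; rewrite ur -[(24 * _ * _)%N]mulnA mulnBr.
have : (l ^ r * (k * d) <= l ^ r * (l * n))%N by rewrite leq_mul2l kdn orbT.
by move: H'; lia.
Qed.

(** The index relation of [sections_coef] is solved for [n]: the difference is divisible by [l^r] by
    hypothesis and by 24 because [l^2 = 24 d + 1], and these two are coprime. *)
Lemma pow_inv_euler_dvd r m : (24 * m = k %[mod l ^ r])%N ->
  exists h : int, (euler_inv ^+ k) m = (l ^ r./2)%:R * h.
Proof.
move=> H; pose u := (uphalf r).*2.
have cl : coprime 24 (l ^ r).
  by rewrite coprimeXr // -(coprime_pexpr _ _ (isT : 0 < 2)%N) -l24 mulnC /coprime gcdnMDl.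
have H1 : (l ^ r %| 24 * m + k * l ^ u - k)%N.
  rewrite -eqn_mod_dvd; last by rewrite (leq_trans _ (leq_addl _ _)) // leq_pmulr // expn_gt0 l0.
  have lu : (l ^ r %| l ^ u)%N by rewrite dvdn_exp2l // /u; lia.
  have lu0 : ((k * l ^ u) %% l ^ r = 0)%N by apply/eqP; rewrite -/(dvdn _ _) dvdn_mull.
  by rewrite -modnDmr lu0 addn0 H.
have H2 : (24 %| 24 * m + k * l ^ u - k)%N.
  have E1 : (l ^ u = 1 %[mod 24])%N.
    have l2 : (l ^ 2 %% 24 = 1)%N by rewrite -l24 mulnC modnMDl.
    by rewrite /u -mul2n expnM -modnXm l2 exp1n.
  rewrite -eqn_mod_dvd; last by rewrite (leq_trans _ (leq_addl _ _)) // leq_pmulr // expn_gt0 l0.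
  by rewrite mulnC modnMDl -modnMmr E1 modnMmr muln1.
have /dvdnP[n nE] : (24 * l ^ r %| 24 * m + k * l ^ u - k)%N by rewrite Gauss_dvd // H1 H2.
have [h hE] := sections_dvd r.
exists (h n); rewrite -(@sections_coef r n m); last first.
  have : (k <= k * l ^ u)%N by rewrite leq_pmulr // expn_gt0 l0.
  by rewrite -/u; lia.
by rewrite hE fps_natM.
Qed.
End Congruence.

Theorem pow_inv_euler_congr (l k r m : nat) : l = 5%N \/ l = 7%N -> (0 < k <= 2)%N ->
  (24 * m = k %[mod l ^ r])%N -> exists h : int, (euler_inv ^+ k) m = (l ^ r./2)%:R * h.
Proof.
case=> -> k12 H.
  apply: (@pow_inv_euler_dvd 5 1 6) H => // a.
  have [p pE [p0 pd]] := U5_F a; exists p => //.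
  by split=> [j|e j]; rewrite ?mul1n; [apply: p0|apply: pd].
apply: (@pow_inv_euler_dvd 7 2 4) H => // a.
by have [p pE [p0 pd]] := U7_F a; exists p.
Qed.

(** * Counting partitions *)

Section Counting.
Variable R : comNzRingType.
Local Notation q := (fq : fps R).
Implicit Types (f : fps R).

Lemma geometric_eqm c w n : (0 < w)%N ->
  eqm n.+1 ((1 - fpsC c * q ^+ w) * \sum_(j < n.+1) (fpsC c * q ^+ w) ^+ j) 1.
Proof.
move=> w0; rewrite -opprB mulNr -subrX1 opprB -[X in eqm _ _ X]subr0.
apply: eqmD; first exact: eqm_refl.
apply: eqmN; rewrite exprMn mulrC -exprM.
by apply: eqm_fqX; rewrite leq_pmull.
Qed.

Lemma fpsC_prod I (r : seq I) (F : I -> R) :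
  fpsC (\prod_(i <- r) F i) = \prod_(i <- r) fpsC (F i).
Proof. by apply: (big_morph _ (@fpsCM R)). Qed.

(** Each inverse factor is a geometric series, cut at exponent [n] since the weights are positive.
    The [e i] leave room for a sign character. *)
Lemma weighted_count n N (w : 'I_N -> nat) (e : 'I_N -> R) f :
  (forall i, (0 < w i)%N) ->
  eqm n.+1 (f * \prod_(i < N) (1 - fpsC (e i) * q ^+ w i)) 1 ->
  f n = \sum_(m : {ffun 'I_N -> 'I_n.+1} | (\sum_(i < N) w i * m i == n)%N)
    \prod_(i < N) e i ^+ m i.
Proof.
move=> w0; set D := \prod_(i < N) _ => fD.
pose G := \prod_(i < N) \sum_(j < n.+1) (fpsC (e i) * q ^+ w i) ^+ j.
have DG : eqm n.+1 (D * G) 1.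
  have E1 : \prod_(i < N) (1 : fps R) = 1 by rewrite big1_eq.
  rewrite -[X in eqm _ _ X]E1 /D /G -big_split /=.
  by apply: eqm_prod => i _; apply: geometric_eqm.
have fG : eqm n.+1 f G.
  apply: (@eqm_trans _ _ (f * (D * G))).
    by rewrite -{1}[f]mulr1; apply: eqmM; [apply: eqm_refl|apply: eqm_sym].
  by rewrite mulrA -[X in eqm _ _ X]mul1r; apply: eqmM; last exact: eqm_refl.
rewrite (eqmE fG) // /G bigA_distr_bigA fps_sum [RHS]big_mkcond; apply: eq_bigr => m _.
have -> : \prod_(i < N) (fpsC (e i) * q ^+ w i) ^+ m i =
    fpsC (\prod_(i < N) e i ^+ m i) * q ^+ (\sum_(i < N) w i * m i).
  rewrite fpsC_prod -prodrXr -big_split /=; apply: eq_bigr => i _.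
  by rewrite exprMn fpsCX exprM.
by rewrite fpsC_mul fqX eq_sym; case: eqP => _; rewrite ?mulr1 ?mulr0.
Qed.

Lemma prod_ord_double (S : pzSemiRingType) n (F : nat -> S) :
  \prod_(i < n.*2) F i = \prod_(k < n) (F k.*2 * F k.*2.+1).
Proof.
elim: n => [|n IH]; first by rewrite !big_ord0.
by rewrite doubleS !big_ord_recr /= IH mulrA.
Qed.

Lemma euler_eqmS n : eqm n.+1 (euler R) (fin_euler R n).
Proof.
apply: eqm_trans (euler_eqm R (leqnn n.+1)) _; rewrite fin_eulerS -[X in eqm _ _ X]mulr1.
by apply: eqmM; [apply: eqm_refl|apply: eqm_fq1].
Qed.
End Counting.

Lemma euler_inv_fin n : eqm n.+1 (euler_inv * fin_euler int n) 1.
Proof.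
rewrite -euler_invK; apply: eqmM; first exact: eqm_refl.
by apply/eqm_sym/euler_eqmS.
Qed.

Lemma partition_count n : (#|[set m : {ffun 'I_n -> 'I_n.+1} |
  (\sum_(i < n) i.+1 * m i == n)%N]|)%:Z = euler_inv n.
Proof.
rewrite (@weighted_count int n n (fun i => i.+1) (fun=> 1)) //; last first.
  apply: eqm_trans (euler_inv_fin n); apply: eq_eqm; congr (_ * _).
  by apply: eq_bigr => i _; rewrite mul1r.
rewrite -natz -sum1_card natr_sum; apply: eq_big => [m|m _]; first by rewrite inE.
by rewrite big1 // => i _; rewrite expr1n.
Qed.

(** Twice the indicator of even permutations is 1 plus the sign. The indices [2 k] and [2 k + 1]
    share the weight [v = k + 1] and have signs -1 and 1, so the signed product pairs up as
    [(1 + q^v) (1 - q^v) = 1 - q^(2 v)], giving [fpsV 2] of the partition series. *)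
Lemma even_partition_count n : (#|[set m : {ffun 'I_n.*2.*2 -> 'I_n.*2.+1} |
    ~~ odd (\sum_(i < n.*2.*2) i.+1 * m i)%N &&
    (\sum_(i < n.*2.*2) i.+2./2 * m i == n.*2)%N]|)%:Z *+ 2 =
  (euler_inv ^+ 2) n.*2 + euler_inv n.
Proof.
have [w2 w3] : (forall k, k.*2.+2./2 = k.+1) /\ (forall k, k.*2.+3./2 = k.+1) by split=> k; lia.
rewrite (@weighted_count int n.*2 n.*2.*2 (fun i => i.+2./2) (fun=> 1) (euler_inv ^+ 2)) //; last first.
  have -> : \prod_(i < n.*2.*2) (1 - fpsC 1 * fq ^+ i.+2./2) = fin_euler int n.*2 ^+ 2.
    rewrite (prod_ord_double _ (fun i => 1 - fpsC 1 * fq ^+ i.+2./2)) -prodrXl.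
    by apply: eq_bigr => k _; rewrite w2 w3 mul1r expr2.
  by rewrite -exprMn -[X in eqm _ _ X](expr1n _ 2); apply/eqmX/euler_inv_fin.
have -> : euler_inv n = (fpsV 2 euler_inv) n.*2.
  by rewrite fpsVE -muln2 dvdn_mull // mulnK.
rewrite (@weighted_count int n.*2 n.*2.*2 (fun i => i.+2./2) (fun i => (-1) ^+ i.+1)
  (fpsV 2 euler_inv)) //; last first.
  have -> : \prod_(i < n.*2.*2) (1 - fpsC ((-1) ^+ i.+1) * fq ^+ i.+2./2) =
      fpsV 2 (fin_euler int n.*2).
    rewrite (prod_ord_double _ (fun i => 1 - fpsC ((-1) ^+ i.+1) * fq ^+ i.+2./2)) rmorph_prod.
    apply: eq_bigr => k _; rewrite w2 w3 rmorphB rmorph1 [X in _ = _ - X]rmorphXn /= fpsV_q //.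
    rewrite -[(-1) ^+ k.*2.+1]signr_odd -[(-1) ^+ k.*2.+2]signr_odd /= odd_double /=.
    rewrite expr1 expr0 -exprM mulnC exprM.
    have -> : fpsC (-1) = -1 :> fps int by apply: fpsP => -[|m]; rewrite fpsN.
    by rewrite -[fpsC 1]/(1 : fps int); ring.
  by rewrite -rmorphM -(rmorph1 (fpsV 2)); apply/eqmV/euler_inv_fin.
rewrite -big_split -natz -sum1_card natr_sum -sumrMnl big_mkcond [RHS]big_mkcond /=.
apply: eq_bigr => m _; rewrite inE; case: eqP => _; last by rewrite andbF.
rewrite andbT [X in _ = X + _]big1 => [|i _]; last by rewrite expr1n.
under [X in _ = _ + X]eq_bigr do rewrite -exprM.
rewrite prodrXr -signr_odd; case: (odd _) => //=.
Qed.

Local Open Scope classical_set_scope.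
Local Open Scope ring_scope.

Lemma gamma_sym_euler (S : set symN) n : S_Cox `<=` S -> S `<=` T_N ->
  (gamma S n)%:Z = euler_inv n.
Proof. by move=> CoxS ST; rewrite (gamma_sym CoxS ST) partition_count. Qed.

Lemma gamma_alt_euler (S : set altN) n : S_A `<=` S -> S `<=` T_A ->
  (gamma S (2 * n))%:Z *+ 2 = (euler_inv ^+ 2) (2 * n)%N + euler_inv n.
Proof.
move=> AS ST; rewrite mul2n (gamma_alt AS ST) -even_partition_count.
congr (_%:Z *+ 2); apply: eq_card => m; rewrite !inE /even_type.
by rewrite (sum_lengths_of m predn).
Qed.

Lemma floor_half_pred (j : nat) : Num.floor (j%:R / 2 - 1 : rat) = j./2%:Z - 1.
Proof.
have jE : j%:R = (odd j)%:R + 2 * j./2%:R :> rat.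
  by rewrite -{1}(odd_double_half j) natrD -muln2 natrM mulrC.
apply: floor_def; rewrite subrK intrB -pmulrn jE.
by case: (odd j); apply/andP; split; rewrite ?subrK -?pmulrn /=; lra.
Qed.

(** The modulus has exponent [j./2 - 1], one less than the power of [l] at hand, so the quotient is
    [z l]; this includes [j = 1], where the modulus is [1 / l]. *)
Lemma congr_mod_pow (l j : nat) (a b z : int) : (0 < l)%N ->
  a - b = (l ^ j./2)%:R * z ->
  congr_mod (l%:R ^ Num.floor (j%:R / 2 - 1 : rat)) a%:~R b%:~R.
Proof.
move=> l0 H; rewrite /congr_mod -intrB H floor_half_pred rmorphM rmorph_nat natrX.
have lr : (l%:R : rat) != 0 by rewrite pnatr_eq0 -lt0n.
rewrite expfzDr // -exprnP exprN1.
have -> : l%:R ^+ j./2 * z%:~R / (l%:R ^+ j./2 / l%:R) = z%:~R * l%:R :> rat.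
  by field; rewrite ?expf_neq0 ?lr.
by rewrite rpredM ?intr_int ?rpred_nat.
Qed.

Theorem theorem1p1 (S : set symN) (S' : set altN)
    (genS : generates S) (CoxS : S_Cox `<=` S) (ST : S `<=` T_N)
    (genS' : generates S') (AS' : S_A `<=` S') (ST' : S' `<=` T_A)
    (l j : nat) (hl : l = 5%N \/ l = 7%N) (hj : (1 <= j)%N)
    (n : nat) (hn : (24 * n = 1 %[mod l ^ j])%N) :
  let M : rat := l%:R ^ Num.floor (j%:R / 2 - 1 : rat) in
  congr_mod M (gamma S' (2 * n))%:R (gamma S n)%:R /\
  congr_mod M (gamma S n)%:R 0.
Proof.
have hn2 : (24 * (2 * n) = 2 %[mod l ^ j])%N by rewrite mulnCA -modnMmr hn modnMmr.
have [x xE] := pow_inv_euler_congr hl (isT : (0 < 1 <= 2)%N) hn.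
have [y yE] := pow_inv_euler_congr hl (isT : (0 < 2 <= 2)%N) hn2.
rewrite expr1 -(gamma_sym_euler n CoxS ST) in xE.
have := gamma_alt_euler n AS' ST'; rewrite yE -(gamma_sym_euler n CoxS ST).
set a := gamma S' _; set b := gamma S n in xE *; move=> aE M.
have l0 : (0 < l)%N by case: hl => ->.
split; last by apply: (@congr_mod_pow l j b%:Z 0 x l0); rewrite subr0.
suff [z zE] : exists z, a%:Z - b%:Z = (l ^ j./2)%:R * z.
  exact: (@congr_mod_pow l j a%:Z b%:Z z l0).
have lo : odd (l ^ j./2) by rewrite oddX; case: hl => ->; rewrite orbT.
have E : (a%:Z - b%:Z) * 2 = (l ^ j./2)%:R * (y - x).
  by rewrite mulrBl mulr_natr aE xE; ring.
(* Write [P = l ^ j./2 = 1 + 2 h]. From [2 (a - b) = P (y - x)] one gets [a - b = P (a - b) - 2 h (a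
   - b) = P (a - b - h (y - x))]. *)
exists (a%:Z - b%:Z - ((l ^ j./2)./2)%:R * (y - x)).
have PE : (l ^ j./2)%:R = 1 + 2 * ((l ^ j./2)./2)%:R :> int.
  by rewrite -{1}(odd_double_half (l ^ j./2)) lo natrD -muln2 natrM mulrC.
have : 2 != 0 :> int by [].
move/mulIf; apply; rewrite E PE -mulrA mulrBl E PE; ring.
Qed.
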